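(* Let $\mu$ be a probability measure on $\mathbb{R}^d$, absolutely continuous with respect to Lebesgue measure, with convex support $X\ni0$. Let $\alpha>1$, $\beta=\frac{\alpha}{\alpha-1}$, $1\ge\tau\ge\frac2\beta$, $A>0$, and consider the cost function $c=c^*_{A,\frac{\alpha\tau}{\alpha-1}}$. Let $F:(0,\infty)\to\mathbb{R}$ satisfy A1)–A4). Let $K\ge2$ and $R=R_{\frac{K-1}{K}}$, and assume $$\int_{B_R^c}\Phi\bigl(4\,c(I_F(|x|))\bigr)d\mu(x)<\infty,\qquad\Phi(x)=\sup_{y\ge0}\bigl(xy-yF(y)+y\bigr).$$ Assume in addition that there exists $\delta>0$ with $$\int_{B_R^c}\Phi_{\tau,\beta}\bigl(\delta\,I_{F_{\tau,\beta}}(|x|)^2\bigr)d\mu(x)<\infty,\qquad\Phi_{\tau,\beta}(x)=\sup_{y>0}\bigl(xy-yF_{\tau,\beta}(y)+y\bigr),$$ and that there is $\lambda_2>0$ such that $\int_{\mathbb{R}^d}(f-m_f)^2d\mu\le\lambda_2\int_{\mathbb{R}^d}|\nabla f|^2d\mu$ for every smooth $f$. Then there exist $B,C>0$ such that for every smooth $f$ $$\int_{\mathbb{R}^d} f^2F\Bigl(\frac{f^2}{\int f^2d\mu}\Bigr)d\mu\le C\int_{\{f^2\ge K\int f^2d\mu\}}f^2c^*\Bigl(\frac{|\nabla f|}{|f|}\Bigr)d\mu+B\,\mathrm{Var}_\mu f .$$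
   Context: Assumptions on $F:(0,\infty)\to\mathbb{R}$: A1) $F$ is concave, increasing and $F(1)=0$; A2) $\lim_{y\to0}yF(y)=0$ and $\lim_{y\to\infty}F(y)=\infty$; A3) $yF(y)$ is convex on $[0,1+\Delta]$ for some $\Delta>0$; A4) there is $y_0\ge1$ such that $yF'(y)$ is non-increasing and $yF'(y)\le1$ on $[y_0,\infty)$. For $A>0$, $q>1$: $c_{A,q}(x)=\frac{x^2}{2}$ if $|x|\le A$ and $c_{A,q}(x)=A^{2-q}\frac{|x|^q}{q}+A^2\frac{q-2}{2q}$ if $|x|\ge A$. For $c:[0,\infty)\to[0,\infty)$, $c^*(x)=\sup_{y\ge0}(xy-c(y))$ (so for $c=c^*_{A,\frac{\alpha\tau}{\alpha-1}}$ one has $c^*=c_{A,\frac{\alpha\tau}{\alpha-1}}$). $F_{\tau,\beta}=\psi_{\tau,\beta}\circ F$, where $\psi_{\tau,\beta}(x)=x$ for $x\le1$ and $\psi_{\tau,\beta}(x)=\frac\beta2\bigl([1+\tau(x-1)]^{\frac{2}{\tau\beta}}-1\bigr)+1$ for $x\ge1$. $B_r=\{x:|x|\le r\}$, $B_r^c$ is its complement; $R(X)\in(0,\infty]$ is the smallest number with $X\subset B_{R(X)}$; for $t\in(0,1)$, $R_t>0$ is the number with $\mu(|x|\le R_t)=t$. For Borel $S$, $\mu^+(S)=\liminf_{h\to0+}\frac{\mu(S^h)-\mu(S)}{h}$ with $S^h=\{x:\mathrm{dist}(x,S)\le h\}$. For a function $G:(0,\infty)\to\mathbb{R}$, $$I_G(r)=\sup\Bigl\{\frac{\mu(S)G(1/\mu(S))}{\mu^+(S)}:\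 S\text{ Borel},\ \mu(S)=1-\mu(B_r)\Bigr\},$$ with the convention $I_G(r)=0$ for $r\ge R(X)$. $m_f=\inf\{t:\mu(f>t)\le\frac12\}$ is the median of $f$; $\mathrm{Var}_\mu f=\int f^2d\mu-(\int f\,d\mu)^2$. Conventions: in the conclusion $f$ ranges over smooth functions with $0<\int f^2d\mu<\infty$; right-hand sides may be $+\infty$; $yF(y)$ is $0$ at $y=0$, and $f^2c^*(|\nabla f|/|f|)$ is $0$ where $f=0$ (there $\nabla f=0$ almost everywhere). *)

(* Defs.v *)
From HB Require Import structures.
From mathcomp Require Import all_boot all_order all_algebra.
From mathcomp Require Import all_classical all_reals all_analysis.

Set Implicit Arguments.
Unset Strict Implicit.
Unset Printing Implicit Defensive.

Import Order.TTheory GRing.Theory Num.Theory.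
Import numFieldNormedType.Exports.

Local Open Scope classical_set_scope.
Local Open Scope ring_scope.

(* R^d is the type 'rV[R]_d with its Borel sigma-algebra. *)
HB.instance Definition _ (R : realType) (m n : nat) :=
  @isMeasurable.Build (sigma_display (@open 'M[R]_(m, n))) 'M[R]_(m, n)
    <<s @open 'M[R]_(m, n) >>
    (@sigma_algebra0 _ setT _) (@sigma_algebraC _ _)
    (@sigma_algebra_bigcup _ setT _).

Section euclidean.
Context {R : realType} {d : nat}.
Implicit Types (x : 'rV[R]_d) (f : 'rV[R]_d -> R).

(* The library norm `|x| of a row vector is the sup norm. *)
Definition enorm x : R := Num.sqrt (\sum_(i < d) x 0 i ^+ 2).

Definition eball (r : R) : set 'rV[R]_d := [set x | enorm x <= r].

Definition partial (i : 'I_d) f : 'rV[R]_d -> R :=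
  fun x => 'D_(delta_mx 0 i) f x.

Definition grad f x : 'rV[R]_d := \row_(i < d) partial i f x.

(* C^infinity: all iterated partial derivatives exist and are continuous.
   The existence clause is needed because 'D_v f x is total. *)
Definition smooth f : Prop :=
  forall s : seq 'I_d, let g := foldr partial f s in
    continuous g /\ forall (i : 'I_d) x, derivable g x (delta_mx 0 i).

Definition box (a b : 'rV[R]_d) : set 'rV[R]_d :=
  [set x | forall i : 'I_d, a 0 i <= x 0 i <= b 0 i].

(* d-dimensional Lebesgue (outer) measure: infimum of the total volumes of
   countable coverings by boxes. *)
Definition lebesgue_outer (S : set 'rV[R]_d) : \bar R :=
  ereal_inf [set e | exists a b : nat -> 'rV[R]_d,
    [/\ forall k i, a k 0 i <= b k 0 i,
        S `<=` \bigcup_k box (a k) (b k) &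
        e = (\sum_(0 <= k <oo) (\prod_(i < d) (b k 0 i - a k 0 i))%:E)%E]].

(* dist(x, S) is +oo when S is empty. *)
Definition enlargement (S : set 'rV[R]_d) (h : R) : set 'rV[R]_d :=
  [set x | (ereal_inf [set (enorm (x - y))%:E | y in S] <= h%:E)%E].

Definition radius (X : set 'rV[R]_d) : \bar R :=
  ereal_inf [set r%:E | r in [set r | X `<=` eball r]].

End euclidean.

Section measure_notions.
Context {R : realType} {d : nat} (mu : probability 'rV[R]_d R).
Implicit Types (f : 'rV[R]_d -> R) (S : set 'rV[R]_d).

Definition supp : set 'rV[R]_d :=
  [set x | forall U, open U -> U x -> (0 < mu U)%E].

Definition mu_plus S : \bar R :=
  limf_einf (fun h : R => ((mu (enlargement S h) - mu S) * (h^-1)%:E)%E) 0^'+.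

(* In \bar R, t%:E / 0 = +oo for t > 0 and t%:E / +oo = 0. *)
Definition isop (G : R -> R) (r : R) : \bar R :=
  if (radius supp <= r%:E)%E then 0%E else
  ereal_sup [set ((fine (mu S) * G (1 / fine (mu S)))%:E / mu_plus S)%E |
             S in [set S | measurable S /\ mu S = (1 - mu (eball r))%E]].

Definition median f : R :=
  inf [set t : R | (mu [set x | (t < f x)%R] <= (1 / 2)%:E)%E].

Definition Var f : \bar R :=
  (\int[mu]_x (f x ^+ 2)%:E - (\int[mu]_x (f x)%:E) ^+ 2)%E.

End measure_notions.

Section one_variable.
Context {R : realType}.
Implicit Types (F : R -> R) (x : \bar R).

(* Functions on ]0, +oo[ are represented by total functions on R whose values
   off ]0, +oo[ are irrelevant; then y * F y is indeed 0 at y = 0. *)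
Record admissible F : Prop := {
  adm_concave :
    convex_function (`]0, +oo[%classic : set R) (fun y => - F y : R^o);
  adm_incr : {in `]0, +oo[ &, nondecreasing_fun F};
  adm_one : F 1 = 0;
  adm_zero : y * F y @[y --> 0^'+] --> (0 : R);
  adm_infty : F y @[y --> +oo] --> +oo;
  adm_convex : exists2 D : R, 0 < D &
    convex_function (`[0, 1 + D]%classic : set R) (fun y => y * F y : R^o);
  adm_deriv : exists2 y0 : R, 1 <= y0 &
    [/\ forall y, y0 <= y -> derivable F y 1,
        {in `[y0, +oo[ &, nonincreasing_fun (fun y => y * F^`()%classic y)} &
        forall y, y0 <= y -> y * F^`()%classic y <= 1]
}.

Definition cost (A q t : R) : R :=
  if `|t| <= A then t ^+ 2 / 2
  else A `^ (2 - q) * (`|t| `^ q / q) + A ^+ 2 * ((q - 2) / (2 * q)).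

(* Extended real arguments are allowed, since isop may be +oo; a finite-valued
   c then has value +oo at +oo. *)
Definition conjugate (c : \bar R -> \bar R) x : \bar R :=
  ereal_sup [set (x * y%:E - c y%:E)%E | y in [set y : R | 0 <= y]].

Definition cost_conj (A q : R) : \bar R -> \bar R :=
  conjugate (fun x => (cost A q (fine x))%:E).

Definition Phi F x : \bar R :=
  ereal_sup [set (x * y%:E - (y * F y)%:E + y%:E)%E | y in [set y : R | 0 <= y]].

Definition Phi_pos F x : \bar R :=
  ereal_sup [set (x * y%:E - (y * F y)%:E + y%:E)%E | y in [set y : R | 0 < y]].

Definition psi (tau beta x : R) : R :=
  if x <= 1 then x
  else beta / 2 * ((1 + tau * (x - 1)) `^ (2 / (tau * beta)) - 1) + 1.

End one_variable.

(* Main.v *)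
(* Write y = f^2 / m with m the second moment of f. Where y < K, concavity gives
   y F(y) <= p (y - 1)^2 + p (y - 1), and (y - 1)^2 is controlled by (sqrt y - 1)^2, whose
   integral is at most 2 Var f / m. Where y >= K, the level sets {y > K 2^k} are handled one
   dyadic layer at a time. For t in (s, 2s) the isoperimetric function bounds
   mu(y >= t) F(1 / mu(y >= t)) by I_F(r(t)) times the perimeter of {y >= t}, where B_r(t) has
   the complementary mass. Young's inequality for the cost, the Fenchel inequality
   4 c(I_F) <= a V + F(1/a) with V = Phi(4 c(I_F)), and the coarea inequality then give
   T_(k+1) <= T_k / 2 + C * (cost of the layer) for T_k = s_k F(s_k) mu(y > s_k), s_k = K 2^k.
   The integrability of V is transported to the levels of y by comparing the law of r(y) with
   that of |x|; the levels where V is infinite form a null set for the law of y, hence a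
   Lebesgue null set by the Poincare inequality. Coarea needs bounded superlevel sets, obtained
   from f / (1 + (f^2 + |x|^2) / n), whose logarithmic gradient exceeds that of f by at most
   n^(-1/2). *)
From HB Require Import structures.
Require Import Defs.
From mathcomp Require Import all_boot all_order all_algebra.
From mathcomp Require Import finmap all_classical all_reals all_analysis.
From mathcomp Require Import measurable_realfun ring lra.

Set Implicit Arguments.
Unset Strict Implicit.
Unset Printing Implicit Defensive.

Import Order.TTheory GRing.Theory Num.Theory.
Import numFieldNormedType.Exports.

Local Open Scope classical_set_scope.
Local Open Scope ring_scope.

(** * Euclidean norm and enlargements *)

(** Measurability in the radius or in the level is available for V only, through the integrability
    hypothesis, and not for the isoperimetric function or the perimeter of {y >= t}. So the
    isoperimetric function is replaced by a majorant nu, obtained from V by the monotone map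
    [young_inv], and the coarea inequality is stated for any measurable minorant [rho] of the
    perimeter. With [rho] = Y / nu and test function nu, the product is the constant Y and the left
    side is explicit. This needs nu to be finite at almost every level, whence the passage from null
    sets of the law of y to Lebesgue null sets: a function of y varying only over levels without
    mass would have zero gradient almost everywhere without being constant, against the Poincare
    inequality. The factor 1/2 in the recursion comes from a freedom in Young's inequality: since
    the conjugate cost is doubling, the coefficient e of c(I_F) can be made small at the price of a
    larger coefficient of the gradient term. The value of e is dictated by the tail integral of V
    and by F(2). *)

Section euclidean_space.
Context {R : realType} {d : nat}.
Implicit Types (x y z : 'rV[R]_d) (f g : 'rV[R]_d -> R).

Lemma sum_sqr_ge0 x : 0 <= \sum_(i < d) x 0 i ^+ 2.
Proof. by apply: sumr_ge0 => i _; exact: sqr_ge0. Qed.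

Lemma enorm_ge0 x : 0 <= enorm x.
Proof. exact: sqrtr_ge0. Qed.

Lemma sqr_enorm x : enorm x ^+ 2 = \sum_(i < d) x 0 i ^+ 2.
Proof. by rewrite sqr_sqrtr// sum_sqr_ge0. Qed.

Lemma enorm_eq0 x : enorm x = 0 -> x = 0.
Proof.
move=> x0; apply/rowP => i; rewrite mxE.
have /eqP := sqr_enorm x; rewrite x0 expr0n/= eq_sym.
rewrite psumr_eq0; last by move=> ? _; exact: sqr_ge0.
by move=> /allP/(_ i); rewrite mem_index_enum => /(_ isT)/=; rewrite sqrf_eq0 => /eqP.
Qed.

Lemma enorm0 : enorm (0 : 'rV[R]_d) = 0.
Proof. by rewrite /enorm big1 ?sqrtr0// => i _; rewrite mxE expr0n. Qed.

Lemma enormN x : enorm (- x) = enorm x.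
Proof. by rewrite /enorm; congr Num.sqrt; apply: eq_bigr => i _; rewrite mxE sqrrN. Qed.

Lemma enormB x y : enorm (x - y) = enorm (y - x).
Proof. by rewrite -enormN opprB. Qed.

Lemma enormZ (k : R) x : enorm (k *: x) = `|k| * enorm x.
Proof.
rewrite /enorm -sqrtr_sqr -sqrtrM ?sqr_ge0//; congr Num.sqrt.
by rewrite mulr_sumr; apply: eq_bigr => i _; rewrite mxE exprMn.
Qed.

Lemma cauchy_schwarz x y : \sum_(i < d) x 0 i * y 0 i <= enorm x * enorm y.
Proof.
set S := (X in X <= _).
have [x0|x0] := eqVneq (enorm x) 0.
  rewrite x0 mul0r /S big1// => i _.
  by rewrite (enorm_eq0 x0) mxE mul0r.
have [y0|y0] := eqVneq (enorm y) 0.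
  rewrite y0 mulr0 /S big1// => i _.
  by rewrite (enorm_eq0 y0) mxE mulr0.
have xy0 : 0 < enorm x * enorm y.
  by rewrite mulr_gt0// lt_neqAle eq_sym ?x0 ?y0 enorm_ge0.
rewrite -(ler_pM2r xy0) -expr2.
have : 0 <= \sum_(i < d) (x 0 i * enorm y - y 0 i * enorm x) ^+ 2.
  by apply: sumr_ge0 => i _; exact: sqr_ge0.
have -> : \sum_(i < d) (x 0 i * enorm y - y 0 i * enorm x) ^+ 2 =
    enorm y ^+ 2 * \sum_(i < d) x 0 i ^+ 2 +
    enorm x ^+ 2 * \sum_(i < d) y 0 i ^+ 2 - 2 * (enorm x * enorm y) * S.
  rewrite /S !mulr_sumr -big_split/= -sumrB; apply: eq_bigr => i _; ring.
rewrite -!sqr_enorm exprMn; nra.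
Qed.

Lemma ler_enormD x y : enorm (x + y) <= enorm x + enorm y.
Proof.
rewrite -(@ler_pXn2r _ 2)// ?nnegrE ?addr_ge0 ?enorm_ge0//.
rewrite sqr_enorm.
have -> : \sum_(i < d) (x + y) 0 i ^+ 2 =
   \sum_(i < d) x 0 i ^+ 2 + \sum_(i < d) y 0 i ^+ 2 +
   2 * \sum_(i < d) x 0 i * y 0 i.
  rewrite mulr_sumr -!big_split/=; apply: eq_bigr => i _; rewrite mxE; ring.
rewrite -!sqr_enorm; have := cauchy_schwarz x y; nra.
Qed.

Lemma ler_enormB x y : enorm x - enorm y <= enorm (x - y).
Proof. by rewrite lerBlDr (le_trans _ (ler_enormD _ _))// subrK. Qed.

Lemma ler_dist_enorm x y : `|enorm x - enorm y| <= enorm (x - y).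
Proof. by rewrite ler_norml lerNl opprB ler_enormB enormB ler_enormB. Qed.

Lemma ler_coord_enorm x i : `|x 0 i| <= enorm x.
Proof.
rewrite -sqrtr_sqr ler_wsqrtr//.
by rewrite (bigD1 i)//= lerDl sumr_ge0// => j _; exact: sqr_ge0.
Qed.

Lemma ler_norm_enorm x : `|x| <= enorm x.
Proof.
rewrite [leLHS]/Num.norm/= mx_normrE.
by apply: bigmax_le => [|[i j] _/=]; [exact: enorm_ge0|rewrite ord1 ler_coord_enorm].
Qed.

Lemma ler_coord_norm x i : `|x 0 i| <= `|x|.
Proof.
by rewrite [leRHS]/Num.norm/= mx_normrE; apply/bigmax_geP; right; exists (0, i).
Qed.

Lemma ler_enorm_sum x : enorm x <= \sum_(i < d) `|x 0 i|.
Proof.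
have S0 : 0 <= \sum_(i < d) `|x 0 i| by apply: sumr_ge0.
rewrite -(@ler_pXn2r _ 2)// ?nnegrE ?enorm_ge0// sqr_enorm expr2 mulr_suml.
apply: ler_sum => i _; rewrite -real_normK ?num_real// expr2 ler_wpM2l//.
by rewrite (bigD1 i)//= lerDl sumr_ge0.
Qed.

Lemma ler_enorm_norm x : enorm x <= d%:R * `|x|.
Proof.
apply: (le_trans (ler_enorm_sum x)).
rewrite mulr_natl -[X in _ *+ X]card_ord -sumr_const.
by apply: ler_sum => i _; rewrite ler_coord_norm.
Qed.

(** The ambient topology is that of the sup norm, and the two norms dominate each other up to the
    factor d; [d.+1] keeps the quotient meaningful in dimension 0. *)
Lemma enorm_nbhs x (A : set 'rV[R]_d) :
  nbhs x A <-> exists2 e : R, 0 < e & forall y, enorm (x - y) < e -> A y.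
Proof.
split.
  move=> /nbhs_ballP[e /= e0 eA]; exists e => // y xy; apply: eA.
  by rewrite -ball_normE/=; exact: le_lt_trans (ler_norm_enorm _) xy.
move=> [e e0 eA]; apply/nbhs_ballP; exists (e / d.+1%:R) => /=.
  by rewrite divr_gt0.
move=> y; rewrite -ball_normE/= => xy; apply: eA.
apply: (le_lt_trans (ler_enorm_norm _)).
move: xy; rewrite ltr_pdivlMr// => /(le_lt_trans _); apply.
by rewrite mulrC ler_wpM2l// ler_nat.
Qed.

Lemma enorm_continuous : continuous (@enorm R d).
Proof.
move=> x A /nbhs_ballP[e /= e0 eA]; apply/enorm_nbhs; exists e => // y xy.
apply: eA; rewrite -ball_normE/=.
exact: le_lt_trans (ler_dist_enorm x y) xy.
Qed.

Lemma open_measurable_rV (A : set 'rV[R]_d) : open A -> measurable A.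
Proof. by move=> oA; apply: sub_sigma_algebra. Qed.

Lemma closed_measurable_rV (A : set 'rV[R]_d) : closed A -> measurable A.
Proof.
move=> cA; rewrite -(setCK A); apply: measurableC.
by apply: open_measurable_rV; exact: closed_openC.
Qed.

Lemma continuous_measurable_rV f : continuous f -> measurable_fun setT f.
Proof.
move=> cf; apply: (measurability _ (RGenOpens.measurableE R)).
move=> _ [_ [a [b ->] <-]]; rewrite setTI.
apply: open_measurable_rV; move/continuousP: cf; apply.
exact: interval_open.
Qed.

Lemma closed_ge f (t : R) : continuous f -> closed [set x | t <= f x].
Proof.
move=> /continuous_closedP/(_ `[t, +oo[%classic (@rray_closed _ _ _)).
by congr closed; apply/seteqP; split => x /=; rewrite in_itv/= andbT.
Qed.

Lemma closed_le f (t : R) : continuous f -> closed [set x | f x <= t].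
Proof.
move=> /continuous_closedP/(_ `]-oo, t]%classic (@lray_closed _ _ _)).
by congr closed; apply/seteqP; split => x /=; rewrite in_itv.
Qed.

Lemma closed_eball r : closed (@eball R d r).
Proof. by apply: closed_le; exact: enorm_continuous. Qed.

Lemma measurable_eball r : measurable (@eball R d r).
Proof. by apply: closed_measurable_rV; exact: closed_eball. Qed.

Lemma compact_eball r : compact (@eball R d r).
Proof.
apply: bounded_closed_compact; last exact: closed_eball.
exists r; split; first exact: num_real.
by move=> M rM x /= xr; rewrite (le_trans (ler_norm_enorm x))// (le_trans xr)// ltW.
Qed.

(** Only x is confined to C; y may leave it, as the estimates near the edge of a ball require. Half
    of each local modulus is spent on moving the centre. *)
Lemma compact_unif_continuous f (C : set 'rV[R]_d) (e : R) : continuous f ->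
  compact C -> 0 < e ->
  exists2 h : R, 0 < h & forall x y, C x -> enorm (x - y) < h -> `|f x - f y| < e.
Proof.
move=> cf cC e0.
have H : \forall h \near (0:R)^'+, C `<=`
    (fun x => forall y, enorm (x - y) < h -> `|f x - f y| < e).
  apply: ((iffLR (compact_near_coveringP C)) cC R (0 : R)^'+
    (fun h x => forall y, enorm (x - y) < h -> `|f x - f y| < e)) => x Cx.
  have /enorm_nbhs[h h0 hP] : \forall y \near x, `|f x - f y| < e / 2.
    by move/cvgrPdist_lt : (cf x); apply; rewrite divr_gt0.
  exists ([set y | enorm (x - y) < h / 2], [set k | 0 < k < h / 2]) => /=.
    split; first by apply/enorm_nbhs; exists (h / 2) => //; rewrite divr_gt0.
    near=> k; apply/andP; split => //; near: k.
    by apply: nbhs_right_lt; rewrite divr_gt0.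
  move=> [y k]/= [xy /andP[k0 kh]] z yz.
  rewrite -(subrK (f x) (f y)) -addrA (le_lt_trans (ler_normD _ _))//.
  rewrite [ltRHS]splitr ltrD//.
    by rewrite distrC hP// (lt_le_trans xy)// ler_pdivrMr// ler_pMr// ler1n.
  rewrite hP// -(subrK y x) -addrA (le_lt_trans (ler_enormD _ _))//.
  by rewrite [ltRHS]splitr ltrD// (lt_trans yz).
have [h [h0 hC]] : exists h, 0 < h /\ C `<=`
    (fun x => forall y, enorm (x - y) < h -> `|f x - f y| < e).
  near (0:R)^'+ => h; exists h; split => //; near: h; exact: H.
by exists h => // x y Cx; exact: hC.
Unshelve. all: by end_near. Qed.

Lemma compact_ubounded f (C : set 'rV[R]_d) : continuous f -> compact C ->
  exists2 M : R, 0 < M & forall x, C x -> `|f x| <= M.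
Proof.
move=> cf cC.
have /compact_bounded[M [Mr MP]] : compact (f @` C).
  by apply: continuous_compact => //; exact: continuous_subspaceT.
exists (`|M| + 1); first by rewrite ltr_pwDr.
move=> x Cx; apply: (MP (`|M| + 1)); last by exists x.
by rewrite (le_lt_trans (ler_norm _))// ltrDl.
Qed.

(** The distance to S is 1-Lipschitz, so a strict excess over h persists nearby. A real k is
    inserted between h and the distance because the latter is +oo when S is empty. *)
Lemma enlargement_closed (S : set 'rV[R]_d) (h : R) : closed (enlargement S h).
Proof.
rewrite -openC; move=> x /= /negP; rewrite -ltNge => hx.
have [k /andP[hk kx]] : exists k : R,
    (h < k) && (k%:E <= ereal_inf [set (enorm (x - y))%:E | y in S])%E.
  move: hx; set I := ereal_inf _ => hx.
  case: I hx => [r|_|//].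
    by rewrite lte_fin => hr; exists r; rewrite hr lexx.
  by exists (h + 1); rewrite ltrDl ltr01 leey.
apply/enorm_nbhs; exists ((k - h) / 2); first by rewrite divr_gt0// subr_gt0.
move=> z xz /=; apply/negP; rewrite -ltNge.
apply: (@lt_le_trans _ _ ((k + h) / 2)%:E).
  by rewrite lte_fin; lra.
apply: le_ereal_inf_tmp => _ [y Sy <-]; rewrite lee_fin.
have : k <= enorm (x - y).
  by rewrite -lee_fin (le_trans kx)//; apply: ereal_inf_lbound; exists y.
have := ler_enormD (x - z) (z - y); rewrite addrA subrK; lra.
Qed.

Lemma measurable_enlargement (S : set 'rV[R]_d) (h : R) :
  measurable (enlargement S h).
Proof. by apply: closed_measurable_rV; exact: enlargement_closed. Qed.

Lemma sub_enlargement (S : set 'rV[R]_d) (h : R) : 0 <= h -> S `<=` enlargement S h.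
Proof.
move=> h0 x Sx; rewrite /enlargement/=; apply: ge_ereal_inf.
by exists (enorm (x - x))%:E; [exists x|rewrite subrr enorm0 lee_fin].
Qed.

(** The infimum defining the distance need not be attained, hence the larger radius k. *)
Lemma enlargement_lt (S : set 'rV[R]_d) (h k : R) x : h < k ->
  enlargement S h x -> exists2 y, S y & enorm (x - y) < k.
Proof.
move=> hk; rewrite /enlargement/= => hx.
have /ereal_inf_ltP[_ [y Sy <-]] : (ereal_inf [set (enorm (x - y))%:E | y in S] < k%:E)%E.
  by rewrite (le_lt_trans hx)// lte_fin.
by rewrite lte_fin => xy; exists y.
Qed.

End euclidean_space.

(** * Smooth functions *)

Section flat_functions.
Context {R : realType}.
Implicit Types t u : R.

(* The factor [t ^- k] makes the family closed under derivation. *)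
Definition flat (k : nat) t : R := if 0 < t then t ^- k * expR (- t^-1) else 0.

Lemma flat_le0 k t : t <= 0 -> flat k t = 0.
Proof. by move=> t0; rewrite /flat ltNge t0. Qed.

Lemma flat_ge0 k t : 0 <= flat k t.
Proof.
by rewrite /flat; case: ifPn => // t0; rewrite mulr_ge0// ?expR_ge0// invr_ge0 exprn_ge0// ltW.
Qed.

Lemma flat_gt0 k t : 0 < t -> 0 < flat k t.
Proof. by move=> t0; rewrite /flat t0 mulr_gt0// ?expR_gt0// invr_gt0 exprn_gt0. Qed.

(** From exp(u) >= u at u = 1 / ((k+2) t), raised to the power k+2. The two spare powers of t make
    the difference quotient of [flat k] at 0 tend to 0. *)
Lemma flat_le k t : 0 <= t -> flat k t <= k.+2%:R ^+ k.+2 * t ^+ 2.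
Proof.
rewrite le_eqVlt => /predU1P[<-|t0]; first by rewrite flat_le0// expr0n mulr0.
rewrite /flat t0.
have e0 : (k.+2%:R * t)^-1 ^+ k.+2 <= expR t^-1.
  have -> : expR t^-1 = expR ((k.+2%:R * t)^-1) ^+ k.+2.
    rewrite -expRM_natl; congr expR; rewrite -mulr_natr invfM mulrC mulrA.
    by rewrite -mulr_natl; field; rewrite !gt_eqF//= ?ltr0n.
  rewrite lerXn2r// ?nnegrE ?expR_ge0// ?invr_ge0 ?mulr_ge0// ?ltW//.
  by rewrite (lt_le_trans _ (expR_ge1Dx _))// ltr_pwDl.
rewrite expRN.
have p0 : 0 < (k.+2%:R * t)^-1 ^+ k.+2 by rewrite exprn_gt0// invr_gt0 mulr_gt0.
have : (expR t^-1)^-1 <= (k.+2%:R * t) ^+ k.+2.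
  rewrite -[leRHS]invrK lef_pV2 ?posrE ?invr_gt0 ?exprn_gt0 ?mulr_gt0 ?expR_gt0//.
  by rewrite -exprVn.
move=> /(ler_wpM2l (_ : 0 <= t ^- k)) => /(_ _)/le_trans; apply.
  by rewrite invr_ge0 exprn_ge0// ltW.
rewrite exprMn [X in _ * (_ * X)](_ : _ = t ^+ k * t ^+ 2); last by rewrite -exprD addn2.
by rewrite mulrCA [X in _ * X]mulrA mulVf ?mul1r// expf_neq0// gt_eqF.
Qed.

Lemma is_derive_flat k t :
  is_derive t 1 (flat k) (- k%:R * flat k.+1 t + flat k.+2 t).
Proof.
have [t0|t0|<-] := ltgtP 0 t.
- apply: (@near_eq_is_derive _ _ _ ((fun u => u ^+ k * expR (- u)) \o GRing.inv)).
    near=> u; rewrite /flat ifT /=; first by rewrite exprVn.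
    by near: u; exact: lt_nbhsr.
  have dV : is_derive t 1 (GRing.inv : R -> R) (- t ^- 2).
    by apply: is_derive_eq (is_deriveV _ _) _; [rewrite gt_eqF|rewrite /GRing.scale/= mulr1].
  have dE : is_derive t^-1 1 (fun u => u ^+ k * expR (- u))
      (k%:R * t^-1 ^+ k.-1 * expR (- t^-1) - t^-1 ^+ k * expR (- t^-1)).
    have d1 : is_derive t^-1 1 (fun u : R => expR (- u)) (expR (- t^-1) * -1).
      exact: is_derive1_comp (is_derive_expR _) (is_deriveN (is_derive_id _ _)).
    have := is_deriveM (is_deriveX k (is_derive_id t^-1 (1 : R))) d1.
    rewrite (_ : (id ^+ k * _) = (fun u => u ^+ k * expR (- u))); last first.
      by apply/funext => u; rewrite exprfctE.
    move=> /is_derive_eq; apply.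
    rewrite /GRing.scale/= mulr1 exprfctE; ring.
  apply: (is_derive_eq (is_derive1_comp dE dV)).
  rewrite /flat t0 -!exprVn.
  by case: k dE => [|k] _ /=; rewrite ?exprS ?expr0; ring.
- apply: (@near_eq_is_derive _ _ _ (cst 0)).
    near=> u; rewrite flat_le0//; apply: ltW; near: u; exact: lt_nbhsl.
  by apply: is_derive_eq; rewrite !flat_le0 ?mulr0 ?addr0// ltW.
- rewrite !flat_le0// mulr0 addr0.
  have H : h^-1 *: (flat k (h *: 1 + 0) - flat k 0) @[h --> (0 : R)^'] --> (0 : R).
    apply/cvgrPdist_lt => e e0; near=> h.
    have h0 : h != 0 by near: h; exact: nbhs_dnbhs_neq.
    rewrite sub0r normrN [flat k 0]flat_le0// subr0 /GRing.scale/= mulr1 addr0.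
    have [hl|hl] := leP h 0; first by rewrite flat_le0// mulr0 normr0.
    rewrite ger0_norm; last by rewrite mulr_ge0 ?flat_ge0 ?invr_ge0 1?ltW.
    rewrite ltr_pdivrMl//.
    apply: (le_lt_trans (flat_le _ (ltW hl))).
    rewrite expr2 mulrCA ltr_pM2l//.
    rewrite -ltr_pdivlMl ?exprn_gt0// (le_lt_trans (ler_norm _))//; near: h.
    by apply: dnbhs0_lt; rewrite mulr_gt0// invr_gt0 exprn_gt0.
  by apply: DeriveDef; [apply/cvg_ex; exists 0|exact/cvg_lim].
Unshelve. all: by end_near. Qed.

Lemma continuous_flat k : continuous (flat k).
Proof.
move=> t; apply: differentiable_continuous; apply/derivable1_diffP.
by case: (is_derive_flat k t).
Qed.

(** A step built without a quotient: the inner argument is nonpositive for t <= 0 and constant for t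
    >= 1. The height [smooth_step 1] is left unnormalised, so that the derivative is a product of
    two values of [flat 2], each in [0, 1]. *)
Definition smooth_step t : R := flat 0 (flat 0 1 - flat 0 (1 - t)).

Lemma le_flat0 : {homo flat 0 : t u / t <= u}.
Proof.
move=> t u tu; have [u0|u0] := leP u 0.
  by rewrite !flat_le0// (le_trans tu).
rewrite {2}/flat u0 /flat expr0 invr1 !mul1r; case: ifPn => [t0|_].
  by rewrite ler_expR lerN2 lef_pV2.
exact: expR_ge0.
Qed.

(** With u = 1/t the upper bound is u^2 <= exp(u), which follows from u <= (1 + u/4)^2 <=
    exp(u/2). *)
Lemma flat2_le1 t : 0 <= flat 2 t <= 1.
Proof.
rewrite flat_ge0/= /flat; case: ifPn => // t0.
rewrite expRN ler_pdivrMl ?mulr1; last first.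
  by rewrite exprn_gt0.
rewrite -[leLHS]invrK -[leRHS]invrK lef_pV2 ?posrE ?invr_gt0 ?exprn_gt0 ?expR_gt0 ?invrK//.
have -> : expR t^-1 = expR (t^-1 / 4) ^+ 4.
  by rewrite -expRM_natl; congr expR; field; rewrite gt_eqF.
have t'0 : 0 < t^-1 by rewrite invr_gt0.
have z2 : t^-1 <= expR (t^-1 / 4) ^+ 2.
  have a0 : 0 < t^-1 / 4 by rewrite divr_gt0.
  have : (1 + t^-1 / 4) ^+ 2 <= expR (t^-1 / 4) ^+ 2.
    by rewrite lerXn2r ?nnegrE ?expR_ge0 ?expR_ge1Dx ?addr_ge0// ltW.
  apply: le_trans; have := sqr_ge0 (1 - t^-1 / 4); nra.
rewrite -exprVn (_ : 4 = 2 * 2)%N// exprM lerXn2r// nnegrE ?ltW//.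
by rewrite exprn_gt0// expR_gt0.
Qed.

Lemma smooth_step_le0 t : t <= 0 -> smooth_step t = 0.
Proof.
by move=> t0; apply: flat_le0; rewrite subr_le0 le_flat0// lerDl oppr_ge0.
Qed.

Lemma smooth_step_ge1 t : 1 <= t -> smooth_step t = smooth_step 1.
Proof.
move=> t1; rewrite /smooth_step subrr [flat 0 0]flat_le0// [flat 0 (1 - t)]flat_le0//.
by rewrite subr_le0.
Qed.

Lemma smooth_step1_gt0 : 0 < smooth_step 1.
Proof.
by rewrite /smooth_step subrr [flat 0 0]flat_le0// subr0 flat_gt0// flat_gt0.
Qed.

Lemma smooth_step_ge0 t : 0 <= smooth_step t. Proof. exact: flat_ge0. Qed.

Definition dsmooth_step t : R :=
  flat 2 (flat 0 1 - flat 0 (1 - t)) * flat 2 (1 - t).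

Lemma is_derive_smooth_step t : is_derive t 1 smooth_step (dsmooth_step t).
Proof.
have d0 u : is_derive u 1 (flat 0) (flat 2 u).
  by apply: (is_derive_eq (is_derive_flat 0 u)); rewrite oppr0 mul0r add0r.
have d1 : is_derive t 1 (fun t => 1 - t) (-1 : R).
  by apply: (is_derive_eq (is_deriveB (is_derive_cst _ _ _) (is_derive_id _ _))); rewrite sub0r.
have d2 : is_derive t 1 (fun t => flat 0 (1 - t)) (flat 2 (1 - t) * -1).
  exact: (@is_derive1_comp _ (flat 0) (fun t => 1 - t) _ _ _ (d0 (1 - t)) d1).
have d3 : is_derive t 1 (fun t => flat 0 1 - flat 0 (1 - t)) (flat 2 (1 - t)).
  apply: is_derive_eq (is_deriveB (is_derive_cst (flat 0 1) t 1) d2) _.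
  by rewrite mulrN1 sub0r opprK.
exact: (@is_derive1_comp _ (flat 0) (fun t => flat 0 1 - flat 0 (1 - t)) _ _ _ (d0 _) d3).
Qed.

Lemma dsmooth_step_bound t :
  0 <= dsmooth_step t <= 1 /\ (~~ (0 < t < 1) -> dsmooth_step t = 0).
Proof.
rewrite /dsmooth_step; split.
  have /andP[a0 a1] := flat2_le1 (flat 0 1 - flat 0 (1 - t)).
  have /andP[b0 b1] := flat2_le1 (1 - t).
  by rewrite mulr_ge0//= mulr_ile1.
rewrite negb_and -!leNgt => /orP[t0|t1].
  by rewrite flat_le0 ?mul0r// subr_le0 le_flat0// lerDl oppr_ge0.
by rewrite [flat 2 (1 - t)]flat_le0 ?mulr0// subr_le0.
Qed.

End flat_functions.


(** * Closure properties and first-order expansion of smooth functions *)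

Section smooth_closure.
Context {R : realType} {d : nat}.
Implicit Types (f g : 'rV[R]_d -> R) (x v : 'rV[R]_d).

(** A derivative along v at x is the derivative at 0 of s -> g(s v + x), so the chain rule of one
    variable applies. *)
Lemma is_derive_comp_dir (h : R -> R) f x v (dh df : R) :
  is_derive (f x) 1 h dh -> is_derive x v f df -> is_derive x v (h \o f) (dh * df).
Proof.
have E (g : 'rV[R]_d -> R) D : is_derive x v g D <-> is_derive (0 : R) 1 (fun s : R => g (s *: v + x)) D.
  have e1 : (fun h => h^-1 *: ((g \o shift x) (h *: v) - g x)) =
     (fun h : R => h^-1 *: (((fun s : R => g (s *: v + x)) \o shift 0) (h *: 1) - g (0 *: v + x))).
    by apply/funext => s /=; rewrite addr0 scale0r add0r /GRing.scale/= mulr1.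
  split=> -[]; rewrite /derivable /derive; [rewrite e1|rewrite -e1] => a b; exact: DeriveDef.
move=> Dh /E Df; apply/E.
have Dh' : is_derive (f (0 *: v + x)) 1 h dh by rewrite scale0r add0r.
exact: is_derive1_comp Dh' Df.
Qed.

Lemma is_derive_coord (i j : 'I_d) x :
  is_derive x (delta_mx 0 i : 'rV[R]_d) (fun y : 'rV[R]_d => y 0 j) (i == j)%:R.
Proof.
have H : (fun h : R => h^-1 *: (((fun y : 'rV[R]_d => y 0 j) \o shift x)
   (h *: (delta_mx 0 i : 'rV[R]_d)) - x 0 j)) @ (0 : R)^' --> ((i == j)%:R : R).
  apply: (@cvg_near_cst _ _ ((i == j)%:R : R)).
  near=> h; rewrite /= !mxE eqxx/= addrK eq_sym.
  rewrite /GRing.scale/= mulrA mulVf ?mul1r//.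
  by near: h; exact: nbhs_dnbhs_neq.
by apply: DeriveDef; [apply/cvg_ex; eexists; exact: H|exact/cvg_lim].
Unshelve. all: by end_near. Qed.

(* Closed under partial derivatives, so that membership implies smoothness. *)
Inductive smooth_expr : ('rV[R]_d -> R) -> Prop :=
| SE_smooth f : smooth f -> smooth_expr f
| SE_cst (c : R) : smooth_expr (cst c)
| SE_coord i : smooth_expr (fun x => x 0 i)
| SE_add f g : smooth_expr f -> smooth_expr g -> smooth_expr (f + g)
| SE_mul f g : smooth_expr f -> smooth_expr g -> smooth_expr (f * g)
| SE_inv f : (forall x, f x != 0) -> smooth_expr f -> smooth_expr (fun x => (f x)^-1)
| SE_flat k f : smooth_expr f -> smooth_expr (flat k \o f).

Lemma smooth_partial i f : smooth f -> smooth (partial i f).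
Proof. by move=> sf s; have := sf (rcons s i); rewrite foldr_rcons. Qed.

Lemma smooth_continuous f : smooth f -> continuous f.
Proof. by move=> /(_ [::])[]. Qed.

Lemma smooth_derivable f i x : smooth f ->
  is_derive x (delta_mx 0 i : 'rV[R]_d) f (partial i f x).
Proof. by move=> /(_ [::])[_ /(_ i x)] fi; apply: DeriveDef. Qed.

(** By induction on the expression: the partial derivative of each constructor is again an
    expression. That of [flat k] calls on the indices k+1 and k+2, which is why the whole family is
    included. *)
Lemma smooth_expr_partial f : smooth_expr f ->
  continuous f /\ forall i, (forall x, derivable f x (delta_mx 0 i)) /\
                            smooth_expr (partial i f).
Proof.
have E g dg i : (forall x, is_derive x (delta_mx 0 i : 'rV[R]_d) g (dg x)) ->
    smooth_expr dg -> (forall x, derivable g x (delta_mx 0 i)) /\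
      smooth_expr (partial i g).
  move=> D sdg; split=> [x|]; first by case: (D x).
  by have -> : partial i g = dg by apply/funext => x; case: (D x).
have P g i : (forall x, derivable g x (delta_mx 0 i)) ->
    forall x, is_derive x (delta_mx 0 i : 'rV[R]_d) g (partial i g x).
  by move=> D x; exact: DeriveDef.
elim=> {f} [f sf|c|j|f g sf [cf pf] sg [cg pg]|f g sf [cf pf] sg [cg pg]|f f0 sf [cf pf]|
  k f sf [cf pf]].
- split; first exact: smooth_continuous.
  move=> i; split; last by apply: SE_smooth; exact: smooth_partial.
  by case: (sf [::]).
- split; first by move=> x; exact: cst_continuous.
  by move=> i; apply: (E _ (cst 0)); exact: SE_cst.
- split; first by move=> x; exact: coord_continuous.
  move=> i; apply: (E _ (cst ((i == j)%:R))); last exact: SE_cst.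
  by move=> x; exact: is_derive_coord.
- split; first by move=> x; exact: continuousD (cf x) (cg x).
  move=> i; have [df sdf] := pf i; have [dg sdg] := pg i.
  apply: (E _ (partial i f + partial i g)); last exact: SE_add.
  by move=> x; apply: is_deriveD; exact: P.
- split; first by move=> x; exact: continuousM (cf x) (cg x).
  move=> i; have [df sdf] := pf i; have [dg sdg] := pg i.
  apply: (E _ (f * partial i g + g * partial i f)); last first.
    by apply: SE_add; exact: SE_mul.
  by move=> x; apply: is_deriveM; exact: P.
- split; first by move=> x; apply: continuousV => //; exact: cf.
  move=> i; have [df sdf] := pf i.
  apply: (E _ (cst (-1) * ((fun x => (f x)^-1) * (fun x => (f x)^-1)) * partial i f)).
    move=> x; apply: DeriveDef; first by apply: derivableV.
    rewrite deriveV// /GRing.scale/= /partial !fctE; congr (_ * _).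
    by rewrite mulN1r -expr2 exprVn.
  apply: SE_mul => //; apply: SE_mul; first exact: SE_cst.
  by apply: SE_mul; exact: SE_inv.
- split; first by move=> x; apply: continuous_comp; [exact: cf|exact: continuous_flat].
  move=> i; have [df sdf] := pf i.
  apply: (E _ ((cst (- k%:R) * (flat k.+1 \o f) + (flat k.+2 \o f)) * partial i f)).
    by move=> x; apply: is_derive_comp_dir; [exact: is_derive_flat|exact: P].
  apply: SE_mul => //; apply: SE_add; last exact: SE_flat.
  by apply: SE_mul; [exact: SE_cst|exact: SE_flat].
Qed.

Lemma smooth_expr_smooth f : smooth_expr f -> smooth f.
Proof.
move=> sf s g; suff : smooth_expr g.
  by move=> /smooth_expr_partial[cg pg]; split=> // i x; case: (pg i).
rewrite /g => {g}; elim: s => //= i s /smooth_expr_partial[_ pg].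
by case: (pg i).
Qed.

Lemma grad_continuous f : smooth f -> continuous (fun x => enorm (grad f x)).
Proof.
move=> sf.
suff H : forall s : seq 'I_d, continuous (fun x => \sum_(i <- s) grad f x 0 i ^+ 2).
  by move=> x; apply: (continuous_comp (H _ x) (@sqrt_continuous R _)).
elim=> [|i s IH].
  rewrite (_ : (fun x => _) = cst 0); first by move=> x; exact: cst_continuous.
  by apply/funext => x; rewrite big_nil.
rewrite (_ : (fun x => _) = (partial i f * partial i f) +
    (fun x => \sum_(j <- s) grad f x 0 j ^+ 2)).
  have c := smooth_continuous (smooth_partial i sf).
  by move=> x; exact: continuousD (continuousM (c x) (c x)) (IH x).
by apply/funext => x; rewrite big_cons mxE expr2.
Qed.

Lemma measurable_grad f : smooth f -> measurable_fun setT (fun x => enorm (grad f x)).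
Proof. by move=> sf; apply: continuous_measurable_rV; exact: grad_continuous. Qed.

(** [smooth] speaks of partial derivatives, so the expansion is obtained by moving from x to y one
    coordinate at a time, with the mean value theorem on each edge. The gradient is taken at x, the
    point known to lie in the ball, and h is uniform over the ball. *)
Lemma smooth_increment f (N e : R) : smooth f -> 0 < e ->
  exists2 h : R, 0 < h & forall x y, @eball R d N x -> enorm (x - y) < h ->
    f y - f x <= enorm (x - y) * (enorm (grad f x) + e).
Proof.
move=> sf e0.
(* The error is split over the coordinates: the sum of the |y_i - x_i| is at most d |x - y|. *)
pose e' := e / d.+1%:R.
have e'0 : 0 < e' by rewrite divr_gt0.
have [h h0 hP] : exists2 h : R, 0 < h & forall i x y, @eball R d N x ->
    enorm (x - y) < h -> `|partial i f x - partial i f y| < e'.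
  have /choice[h hP] : forall i : 'I_d, exists h : R, 0 < h /\ forall x y, @eball R d N x ->
      enorm (x - y) < h -> `|partial i f x - partial i f y| < e'.
    move=> i; have [h h0 hP] := compact_unif_continuous
      (smooth_continuous (smooth_partial i sf)) (@compact_eball R d N) e'0.
    by exists h.
  exists (\big[Num.min/1]_(i < d) h i).
    by apply: lt_bigmin => // i _; case: (hP i).
  move=> i x y Nx xy; case: (hP i) => _; apply=> //.
  by rewrite (lt_le_trans xy)// bigmin_le_cond.
exists h => // x y Nx xy.
(* The corners of the path from x to y; every point of it stays within |x - y| of x. *)
pose w (k : nat) : 'rV[R]_d := \row_j (if (j < k)%N then y 0 j else x 0 j).
have w0 : w 0%N = x by apply/rowP => j; rewrite mxE ltn0.
have wd : w d = y by apply/rowP => j; rewrite mxE ltn_ord.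
have -> : f y - f x = \sum_(i < d) (f (w i.+1) - f (w i)).
  by rewrite -wd -w0 -(telescope_sumr (fun k => f (w k)) (leq0n d)) big_mkord.
have step (i : 'I_d) : f (w i.+1) - f (w i) <=
    partial i f x * (y 0 i - x 0 i) + e' * `|y 0 i - x 0 i|.
  pose z (s : R) := s *: delta_mx 0 i + w i.
  have zD (s : R) : is_derive s (1 : R) (fun s => f (z s)) (partial i f (z s)).
    have sc : is_derive s (1 : R) (fun s : R => s) 1 by exact: is_derive_id.
    have [fd _] := smooth_derivable i (z s) sf.
    have e1 : (fun h => h^-1 *: (((fun s => f (z s)) \o shift s) (h *: 1) - f (z s))) =
       (fun h : R => h^-1 *: ((f \o shift (z s)) (h *: delta_mx 0 i) - f (z s))).
      apply/funext => h' /=; congr (_ *: (f _ - _)).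
      by rewrite /z /GRing.scale/= mulr1 addrA -scalerDl.
    apply: DeriveDef; first by rewrite /derivable e1.
    by rewrite /derive e1.
  have z0 : z 0 = w i by rewrite /z scale0r add0r.
  have z1 : z (y 0 i - x 0 i) = w i.+1.
    apply/rowP => j; rewrite !mxE ltnS eqxx/=.
    have [->|ji] := eqVneq j i; first by rewrite ltnn leqnn mulr1 subrK.
    by rewrite mulr0 add0r [in RHS]leq_eqVlt (negbTE (_ : val j != val i)).
  have key s : `|s| <= `|y 0 i - x 0 i| -> `|partial i f x - partial i f (z s)| < e'.
    move=> ss; apply: hP => //; apply: le_lt_trans xy.
    rewrite /enorm ler_wsqrtr// ler_sum// => j _; rewrite !mxE eqxx/= -[leLHS]real_normK ?num_real//.
    rewrite -[leRHS]real_normK ?num_real// lerXn2r// ?nnegrE//.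
    have [->|ji] := eqVneq j i.
      by rewrite ltnn mulr1 opprD addrCA subrr addr0 normrN [leRHS]distrC.
    by rewrite mulr0 add0r; case: ifPn => // _; rewrite subrr normr0.
  have [c cP ->] : exists2 c, `|c| <= `|y 0 i - x 0 i| &
      f (w i.+1) - f (w i) = partial i f (z c) * (y 0 i - x 0 i).
    rewrite -z1 -z0; move: (y 0 i - x 0 i) => b.
    have cfz a b' : {within `[a, b'], continuous (fun s => f (z s))}.
      apply: continuous_subspaceT => s; apply: differentiable_continuous.
      by apply/derivable1_diffP; case: (zD s).
    have [b0|b0] := leP 0 b.
      have [c] := MVT_segment b0 (fun s _ => zD s) (@cfz 0 b).
      rewrite in_itv/= subr0 => /andP[c0 cb] ->; exists c => //.
      by rewrite !ger0_norm.
    have [c] := MVT_segment (ltW b0) (fun s _ => zD s) (@cfz b 0).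
    rewrite in_itv/= sub0r => /andP[c0 cb] e1; exists c.
      by rewrite !ler0_norm ?lerN2// ltW.
    by rewrite -opprB e1 mulrN opprK.
  have := key c cP; set q := partial i f (z c) => qk.
  rewrite -lerBlDl -mulrBl (le_trans (ler_norm _))// normrM ler_wpM2r//.
  by rewrite distrC ltW.
apply: (@le_trans _ _ (\sum_(i < d) (partial i f x * (y 0 i - x 0 i) + e' * `|y 0 i - x 0 i|))).
  by apply: ler_sum => i _; exact: step.
rewrite big_split/= mulrDr lerD//.
  rewrite mulrC enormB (le_trans _ (cauchy_schwarz _ _))// le_eqVlt; apply/orP; left; apply/eqP.
  by apply: eq_bigr => i _; rewrite !mxE.
rewrite -mulr_sumr [leRHS]mulrC.
apply: (@le_trans _ _ (e' * (d%:R * enorm (x - y)))).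
  rewrite ler_wpM2l ?(ltW e'0)// [leRHS]mulr_natl -[X in _ *+ X]card_ord -sumr_const.
  apply: ler_sum => i _.
  by rewrite enormB (le_trans _ (ler_coord_enorm _ i))// !mxE.
rewrite mulrA ler_wpM2r ?enorm_ge0// /e' mulrAC ler_pdivrMr// ler_pM2l// ler_nat//.
Qed.

End smooth_closure.

(** * Comparison of measures on the line *)

Section density.
Local Open Scope ereal_scope.
Context d (T : measurableType d) (R : realType).
Variables (mu : {measure set T -> \bar R}) (k : T -> R).

(** The proofs [mk] and [k0] are arguments so that a measure structure can be attached to
    [density mk k0]. *)
Definition density (mk : measurable_fun setT k) (k0 : forall x, (0 <= k x)%R)
  (A : set T) : \bar R := \int[mu]_(x in A) (k x)%:E.

Hypotheses (mk : measurable_fun setT k) (k0 : forall x, (0 <= k x)%R).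

Let density0 : density mk k0 set0 = 0.
Proof. by rewrite /density integral_set0. Qed.

Let density_ge0 A : 0 <= density mk k0 A.
Proof. by apply: integral_ge0 => x _; rewrite lee_fin. Qed.

Let density_sigma_additive : semi_sigma_additive (density mk k0).
Proof.
move=> F mF tF mUF; rewrite /density; apply: cvg_toP.
  apply: ereal_nondecreasing_is_cvgn => m n mn.
  apply: lee_sum_nneg_natr => // i _ _.
  by apply: integral_ge0 => x _; rewrite lee_fin.
rewrite ge0_integral_bigcup//=.
- by apply/measurable_EFinP; exact: measurable_funTS.
- by move=> x _; rewrite lee_fin.
Qed.

HB.instance Definition _ := isMeasure.Build _ _ _ (density mk k0)
  density0 density_ge0 density_sigma_additive.

Import HBNNSimple.

(** Monotone convergence from simple functions. The weight k is real-valued, whereas f may take the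
    value +oo, as V does later. *)
Lemma ge0_integral_density (f : T -> \bar R) : measurable_fun setT f ->
  (forall x, 0 <= f x) ->
  \int[density mk k0]_x f x = \int[mu]_x (f x * (k x)%:E).
Proof.
move=> mf f0; pose h := nnsfun_approx measurableT mf.
have hf x : (EFin \o h n) x @[n --> \oo] --> f x by exact: cvg_nnsfun_approx.
have hle n m x : (n <= m)%N -> ((h n x)%:E <= (h m x)%:E :> \bar R).
  by move=> nm; rewrite lee_fin; exact/lefP/nd_nnsfun_approx.
have mkE : measurable_fun setT (fun x => (k x)%:E) by exact/measurable_EFinP.
have mh n : measurable_fun setT (EFin \o h n) by exact/measurable_EFinP/measurable_funP.
transitivity (limn (fun n => \int[density mk k0]_x (h n x)%:E)).
  rewrite -monotone_convergence//.
  - by apply: eq_integral => x _; apply/esym/cvg_lim => //; exact: hf.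
  - by move=> n x _; rewrite lee_fin.
  - by move=> x _ a b ab; exact: hle.
transitivity (limn (fun n => \int[mu]_x ((h n x)%:E * (k x)%:E))); last first.
  rewrite -monotone_convergence//.
  - apply: eq_integral => x _; apply/cvg_lim => //.
    by apply: cvgeZr => //; exact: hf.
  - by move=> n; apply: emeasurable_funM => //; exact: mh.
  - by move=> n x _; rewrite mule_ge0// lee_fin.
  - by move=> x _ a b ab; rewrite lee_wpmul2r ?lee_fin//; exact: hle.
congr (limn _); apply/funext => n.
transitivity (\int[density mk k0]_x
   (\sum_(y \in range (h n)) (y * \1_(h n @^-1` [set y]) x)%:E)).
  by apply: eq_integral => t _; rewrite /= fimfunE -fsumEFin.
have mi r : measurable_fun setT (fun x => (r * \1_(h n @^-1` [set r]) x)%:E).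
  by apply/measurable_EFinP; exact: measurable_funM.
rewrite ge0_integral_fsum//; last by move=> y x _; exact: nnfun_muleindic_ge0.
transitivity (\int[mu]_x (\sum_(y \in range (h n))
    (y * \1_(h n @^-1` [set y]) x)%:E * (k x)%:E)); last first.
  apply: eq_integral => x _.
  rewrite -ge0_mule_fsuml => [|y]; last exact: nnfun_muleindic_ge0.
  by rewrite fsumEFin// -(fimfunE _ x).
rewrite ge0_integral_fsum//; last 2 first.
  - by move=> y; exact: emeasurable_funM.
  - move=> y x _; apply: mule_ge0; last by rewrite lee_fin.
    by rewrite EFinM; exact: nnfun_muleindic_ge0.
apply: eq_fsbigr => r /[!inE] -[t _ ht].
have r0 : (0 <= r)%R by rewrite -ht.
rewrite integralZl_indic_nnsfun// integral_indic// setIT.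
under [RHS]eq_integral do rewrite EFinM -muleA.
rewrite ge0_integralZl//.
- congr (_ * _); rewrite [LHS]integral_mkcond.
  by apply: eq_integral => x _; rewrite epatch_indic muleC.
- by apply: emeasurable_funM => //; apply/measurable_EFinP.
- by move=> x _; rewrite mule_ge0 ?lee_fin.
Qed.

End density.

(** * Domination of measures: from half-open intervals to Borel sets *)

Section ocitv_comparison.
Local Open Scope ereal_scope.
Context (R : realType).
Variables (nu1 nu2 : {measure set (measurableTypeR R) -> \bar R}).

Let ocitv_measurable (A : set R) : ocitv A -> measurable (A : set (measurableTypeR R)).
Proof. by move=> oA; apply: sub_sigma_algebra. Qed.

Let nu : set (ocitv_type R) -> \bar R := nu1.
Let nu_0 : nu set0 = 0. Proof. exact: measure0. Qed.
Let nu_ge0 A : 0 <= nu A. Proof. exact: measure_ge0. Qed.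
Let nu_sigma_additive : semi_sigma_additive nu.
Proof.
move=> F mF tF mUF; apply: (@measure_semi_sigma_additive _ _ _ nu1) => //.
  by move=> i; apply: ocitv_measurable; exact: mF.
by apply: ocitv_measurable; exact: mUF.
Qed.
HB.instance Definition _ := isMeasure.Build _ (ocitv_type R) R nu
  nu_0 nu_ge0 nu_sigma_additive.

(** Being finite, [nu1] is the Caratheodory extension of its values on half-open intervals, so
    [nu1 E] is the infimum of the sums of [nu1] over countable covers of E by such intervals. Every
    such sum also bounds [nu2 E], by subadditivity. *)
Lemma le_measure_ocitv : nu1 setT < +oo ->
  (forall u v : R, (u < v)%R -> nu2 `]u, v]%classic <= nu1 `]u, v]%classic) ->
  forall E, measurable E -> nu2 E <= nu1 E.
Proof.
move=> nu1T le12 E mE.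
have sf : sigma_finite [set: ocitv_type R] nu.
  exists (fun k => `](- k%:R)%R, k%:R%R]%classic).
    apply/esym; rewrite -subTset => /= x _ /=.
    exists (Num.truncn `|x : R|).+1 => //=; rewrite in_itv/=.
    by have := truncnS_gt `|x : R|; rewrite ltr_norml => /andP[-> /ltW ->].
  move=> k; split; first exact: is_ocitv.
 rewrite /nu (le_lt_trans _ nu1T)// le_measure// inE//.
have <- := measure_extension_unique sf (fun X _ => erefl (nu1 X)) mE.
apply: le_ereal_inf_tmp => _ [F [mF EF] <-].
have mF' i : measurable (F i : set (measurableTypeR R)).
  by apply: ocitv_measurable; exact: mF.
apply: (le_trans (measure_sigma_subadditive nu2 mF' mE EF)).
apply: lee_nneseries => // i _.
have /ocitvP[->|[[u v] /= uv ->]] := mF i; last exact: le12.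
by rewrite /nu !measure0.
Qed.

End ocitv_comparison.

(** * Coarea inequality *)

Section limits_of_liminf.
Local Open Scope ereal_scope.
Context {R : realType}.
Implicit Types u v : (\bar R)^nat.

Lemma einfs_le_limn_einf u n : einfs u n <= limn_einf u.
Proof.
rewrite limn_einf_lim; have := @nondecreasing_einfs R u.
by move=> /ereal_nondecreasing_cvgn/cvg_lim -> //; apply: ereal_sup_ubound; exists n.
Qed.

Lemma limn_einf_le_cst u (a : \bar R) n :
  (forall k, (n <= k)%N -> u k <= a) -> limn_einf u <= a.
Proof.
move=> ua; rewrite limn_einf_lim.
have /ereal_nondecreasing_cvgn/cvg_lim -> // := @nondecreasing_einfs R u.
apply: ge_ereal_sup => _ [k _ <-].
apply: (@le_trans _ _ (u (maxn k n))).
  by apply: ereal_inf_lbound; exists (maxn k n) => //=; rewrite leq_maxl.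
by apply: ua; rewrite leq_maxr.
Qed.

End limits_of_liminf.

Lemma measurable_limn_einf d (T : measurableType d) (R : realType)
    (f : (T -> \bar R)^nat) : (forall n, measurable_fun setT (f n)) ->
  measurable_fun setT (fun x => limn_einf (f ^~ x)).
Proof.
move=> mf; apply: (emeasurable_fun_cvg (fun n x => einfs (f ^~ x) n)).
  by move=> n; exact: measurable_fun_einfs.
by move=> x _; rewrite limn_einf_lim; exact: is_cvg_einfs.
Qed.

Section coarea.
Context (R : realType) (d : nat) (mu : probability 'rV[R]_d R).
Variables (g : 'rV[R]_d -> R) (s N : R).
Hypothesis sg : smooth g.
Hypothesis gN : forall x, s <= g x -> enorm x <= N.

Let G x := enorm (grad g x).
Let Q : set 'rV[R]_d := eball (N + 1).
Let level (t : R) := [set x | t <= g x].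
Let LT := measurableTypeR R.

Let G_ge0 x : 0 <= G x. Proof. exact: enorm_ge0. Qed.

Let mg : measurable_fun setT g.
Proof. by apply: continuous_measurable_rV; exact: smooth_continuous. Qed.

Let mG : measurable_fun setT G.
Proof. exact: measurable_grad. Qed.

Let mlevel t : measurable (level t).
Proof. by apply: closed_measurable_rV; apply: closed_ge; exact: smooth_continuous. Qed.

Let G_bounded : exists2 M : R, 0 < M & forall x, Q x -> G x <= M.
Proof.
have [M M0 MP] := compact_ubounded (grad_continuous sg) (@compact_eball R d (N + 1)).
by exists M => // x Qx; rewrite (le_trans (ler_norm _))// MP.
Qed.

(** To first order in h, these are the points outside {g >= t} at distance at most h from it. The
    number e absorbs the linearisation error, and Q, one unit larger than the ball containing {g >=
    s}, holds them all once h is small. *)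
Let shell (e h : R) (t : R) : set 'rV[R]_d :=
  [set x | Q x /\ g x < t <= g x + h * (G x + e)].

Let shellP e h : measurable_fun setT (fun z : 'rV[R]_d * LT =>
  [&& enorm z.1 <= N + 1, g z.1 < (z.2 : R) & (z.2 : R) <= g z.1 + h * (G z.1 + e)]).
Proof.
have m1 (f : 'rV[R]_d -> R) : measurable_fun setT f ->
    measurable_fun setT (fun z : 'rV[R]_d * LT => f z.1).
  by move=> mf; apply: measurableT_comp => //; exact: measurable_fst.
have m2 : measurable_fun setT (fun z : 'rV[R]_d * LT => (z.2 : R)) by exact: measurable_snd.
apply: measurable_and.
  apply: measurable_fun_ler => //; apply: m1.
  by apply: continuous_measurable_rV; exact: enorm_continuous.
apply: measurable_and; first by apply: measurable_fun_ltr => //; exact: m1.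
apply: measurable_fun_ler => //; apply: (m1 (fun x => g x + h * (G x + e))).
by apply: measurable_funD => //; apply: measurable_funM => //; exact: measurable_funD.
Qed.

Let enlargement_shell e : 0 < e -> exists2 h0 : R, 0 < h0 &
  forall h t, 0 < h < h0 -> s < t -> enlargement (level t) h `<=` level t `|` shell e h t.
Proof.
move=> e0; have [M M0 MP] := G_bounded.
have e20 : 0 < e / 2 by rewrite divr_gt0.
have [h1 h10 hP] := smooth_increment (N + 1) sg e20.
(* A point of the level set is found within h k of x for any k > 1; this k satisfies k (G x + e/2)
   <= G x + e as soon as G x <= M. *)
pose k := 1 + e / 2 / (M + e / 2).
have Me : 0 < M + e / 2 by rewrite addr_gt0.
have k1 : 1 < k by rewrite ltrDl divr_gt0.
have k0 : 0 < k by rewrite (lt_trans _ k1).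
exists (Num.min h1 1 / k); first by rewrite divr_gt0// lt_min h10 ltr01.
move=> h t /andP[h0 hh] st x xh.
have [y yt xy] : exists2 y, level t y & enorm (x - y) < h * k.
  by apply: enlargement_lt xh; rewrite ltr_pMr.
move: hh; rewrite ltr_pdivlMr// lt_min => /andP[hh1 hk1].
have Qx : Q x.
  rewrite /Q/eball/= -(subrK y x) addrC (le_trans (ler_enormD _ _))//.
  by rewrite lerD// ?gN ?(le_trans (ltW st))// ltW// (lt_trans xy).
have [tx|tx] := leP t (g x); [by left|right; split => //].
rewrite tx/=; apply: (le_trans yt); rewrite -lerBlDl.
apply: (le_trans (hP x y Qx (lt_trans xy hh1))).
apply: (@le_trans _ _ (h * k * (G x + e / 2))).
  have Ge : 0 <= G x + e / 2 by rewrite addr_ge0 ?G_ge0 ?(ltW e20).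
  exact: ler_wpM2r Ge _ _ (ltW xy).
rewrite -mulrA ler_pM2l// mulrDl mul1r [leRHS](_ : _ = (G x + e / 2) + e / 2); last first.
  by rewrite -addrA -splitr.
rewrite lerD2l mulrAC ler_pdivrMr// ler_pM2l// lerD2r; exact: MP.
Qed.

Let hn (n : nat) : R := n.+1%:R^-1.
Let hn_gt0 n : 0 < hn n. Proof. by rewrite invr_gt0. Qed.
Let hn_small (h0 : R) : 0 < h0 -> exists n0, forall n, (n0 <= n)%N -> hn n < h0.
Proof.
move=> h0P; exists (Num.truncn h0^-1) => n nn.
rewrite /hn invf_plt ?posrE// (lt_le_trans (truncnS_gt _))// ler_nat//.
Qed.

Let mshell e h t : measurable (shell e h t).
Proof.
have := measurable_fun_pair1 (t : LT) (@shellP e h).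
move=> /(_ measurableT [set true] I); rewrite setTI; congr measurable; apply/seteqP; split=> x /=.
  by move=> /and3P[? ? ?]; split=> //; apply/andP.
by move=> [? /andP[? ?]]; apply/and3P.
Qed.

(** The lower limit over h -> 0+ is at most the one along h = 1/(n+1), and Fatou's lemma needs a
    sequence. *)
Let mu_plus_le e t : 0 < e -> s < t ->
  (mu_plus mu (level t) <= limn_einf (fun n => mu (shell e (hn n) t) * (hn n)^-1%:E))%E.
Proof.
move=> e0 st; have [h0 h00 hP] := enlargement_shell e0.
rewrite /mu_plus limf_einfE; apply: ge_ereal_sup => _ [V V0 <-].
have [h1 /= h10 hV] := V0.
have hm0 : 0 < Num.min h0 h1 by rewrite lt_min h00 h10.
have [n0 n0P] := hn_small hm0.
apply: le_trans (einfs_le_limn_einf _ n0).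
apply: le_ereal_inf_tmp => _ [n /= nn <-].
have := n0P _ nn; rewrite lt_min => /andP[nh0 nh1].
apply: ge_ereal_inf; exists ((mu (enlargement (level t) (hn n)) - mu (level t)) * (hn n)^-1%:E)%E.
  exists (hn n) => //; apply: hV => //=.
  by rewrite sub0r normrN gtr0_norm.
rewrite lee_wpmul2r ?lee_fin ?invr_ge0 ?(ltW (hn_gt0 n))//.
rewrite leeBlDl ?fin_num_measure//.
apply: (@le_trans _ _ (mu (level t `|` shell e (hn n) t))).
  rewrite le_measure ?inE//; first exact: measurable_enlargement.
    exact: measurableU.
  by apply: hP => //; rewrite hn_gt0.
exact: measureU2.
Qed.

Let Mg := sval (cid2 G_bounded).
Let Mg0 : 0 < Mg. Proof. exact: (s2valP (cid2 G_bounded)). Qed.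
Let MgP x : Q x -> G x <= Mg. Proof. exact: (s2valP' (cid2 G_bounded)). Qed.

Let mQ : measurable Q. Proof. exact: measurable_eball. Qed.

Let mslab (u v : R) : measurable [set x | Q x /\ u < g x <= v].
Proof.
apply: measurableI => //.
have -> : (fun x => is_true (u < g x <= v)) = g @^-1` `]u, v]%classic.
  by apply/seteqP; split => x /=; rewrite in_itv.
by rewrite -[_ @^-1` _]setTI; exact: mg.
Qed.

(** For fixed x, the levels t whose shell contains x lie in an interval of length h (G x + e)
    starting at g x; it meets (u, v] only if g x lies in the slightly wider slab on the right.
    Exchanging the integrals does the rest. *)
Let shell_tonelli (e h u v : R) : 0 <= e -> 0 < h ->
  (\int[lebesgue_measure]_(t in `]u, v]) mu (shell e h t) <=
   h%:E * \int[mu]_(x in [set x | (u - h * (Mg + e) < g x <= v)%R /\ Q x]) (G x + e)%:E)%E.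
Proof.
move=> e0 h0.
pose A : set ('rV[R]_d * LT) := [set z | [/\ Q z.1, g z.1 < (z.2:R) <= g z.1 + h * (G z.1 + e) & u < (z.2 : R) <= v]].
have mb : measurable_fun setT (fun z : 'rV[R]_d * LT => u < (z.2 : R) <= v).
  have m2 : measurable_fun setT (fun z : 'rV[R]_d * LT => (z.2 : R)) by exact: measurable_snd.
  by apply: measurable_and; [exact: measurable_fun_ltr|exact: measurable_fun_ler].
have mA : measurable A.
  have := measurable_and (@shellP e h) mb.
  move=> /(_ measurableT [set true] I); rewrite setTI; congr measurable.
  apply/seteqP; split=> z /=.
    by move=> /andP[/and3P[? ? ?] ?]; split=> //; apply/andP.
  by move=> [? /andP[? ?] ?]; apply/andP; split=> //; apply/and3P.
pose f (z : 'rV[R]_d * LT) : \bar R := (\1_A z)%:E.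
have mf : measurable_fun setT f by apply/measurable_EFinP; exact: measurable_indic.
have f0 z : (0 <= f z)%E by rewrite lee_fin.
have -> : (\int[lebesgue_measure]_(t in `]u, v]) mu (shell e h t) =
   \int[lebesgue_measure]_t \int[mu]_x f (x, t))%E.
  rewrite integral_mkcond; apply: eq_integral => t _; rewrite patchE.
  transitivity (\int[mu]_x (\1_([set x | A (x, t)]) x)%:E)%E; last by [].
  rewrite integral_indic//; last first.
    have := @measurable_ysection _ _ _ _ _ (t : LT) mA.
    by rewrite /ysection; under eq_set do rewrite in_setE.
  rewrite setIT; case: ifPn.
    rewrite inE/= in_itv/= => tuv; congr (mu _); apply/seteqP; split=> x; rewrite /A/=.
      by move=> [? ?].
    by move=> [? ? _].
  rewrite notin_setE/= in_itv/= => tuv.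
  rewrite (_ : [set x | A (x, t)] = set0) ?measure0//.
  by apply/seteqP; split=> x //; rewrite /A/= => -[_ _ /tuv].
rewrite -(fubini_tonelli f mf f0).
set B := [set x | _ /\ _].
have mB : measurable B.
  have := mslab (u - h * (Mg + e)) v; congr measurable.
  by apply/seteqP; split=> x [? ?].
have mGe : measurable_fun setT (fun x => (G x + e)%:E).
  by apply/measurable_EFinP; apply: measurable_funD.
have Ge0 x : (0 <= (G x + e)%:E)%E by rewrite lee_fin addr_ge0.
rewrite -ge0_integralZl//; last 2 first.
  exact: measurable_funTS.
  by rewrite lee_fin ltW.
rewrite [leRHS]integral_mkcond; apply: ge0_le_integral => //.
- by move=> x _; apply: integral_ge0.
- exact: measurable_fun_fubini_tonelli_F.
- apply/(measurable_restrictT _ mB); apply: measurable_funTS.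
  exact: measurable_funeM.
move=> x _; rewrite patchE.
have -> : (\int[lebesgue_measure]_t f (x, t) = lebesgue_measure ([set t | A (x, t)] : set LT))%E.
  transitivity (\int[lebesgue_measure]_t (\1_([set t | A (x, t)] : set LT) t)%:E)%E; first by [].
  rewrite integral_indic ?setIT//.
  have := @measurable_xsection _ _ _ _ _ x mA.
  by rewrite /xsection; under eq_set do rewrite in_setE.
case: ifPn => [xB|xB].
  apply: (@le_trans _ _ (lebesgue_measure (`]g x, g x + h * (G x + e)]%classic : set R))).
    rewrite le_measure ?inE//=.
      have := @measurable_xsection _ _ _ _ _ x mA.
      by rewrite /xsection; under eq_set do rewrite in_setE.
    by move=> t [_ + _]; rewrite /= in_itv.
  rewrite lebesgue_measure_itv/= lte_fin; case: ifPn => _; last first.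
    by rewrite mule_ge0// lee_fin ltW.
  by rewrite -EFinB addrAC subrr add0r EFinM.
rewrite (_ : [set t | A (x, t)] = set0) ?measure0//.
apply/seteqP; split=> t //; rewrite /A/= => -[Qx /andP[gt tg] /andP[ut tv]].
move: xB; rewrite notin_setE; apply; split=> //.
rewrite (ltW (lt_le_trans gt tv)) andbT ltrBlDr (lt_le_trans ut)// (le_trans tg)//.
by rewrite lerD2l ler_pM2l// lerD2r MgP.
Qed.

(** A measurable minorant of the perimeter stands in for the perimeter as a function of the level.
    It vanishes up to s because superlevel sets are known to be bounded only from s on. *)
Variable rho : R -> R.
Hypothesis mrho : measurable_fun setT (rho : LT -> R).
Hypothesis rho0 : forall t, 0 <= rho t.
Hypothesis rho_s : forall t, t <= s -> rho t = 0.
Hypothesis rho_plus : forall t, s < t -> ((rho t)%:E <= mu_plus mu (level t))%E.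

Let mushell e h : measurable_fun setT (fun t : LT => mu (shell e h t)).
Proof.
pose A : set ('rV[R]_d * LT) := [set z | Q z.1 /\ g z.1 < (z.2:R) <= g z.1 + h * (G z.1 + e)].
have mA : measurable A.
  have := @shellP e h; move=> /(_ measurableT [set true] I); rewrite setTI; congr measurable.
  apply/seteqP; split=> z /=.
    by move=> /and3P[? ? ?]; split=> //; apply/andP.
  by move=> [? /andP[? ?]]; apply/and3P.
have := measurable_fun_ysection mu mA; congr measurable_fun.
by apply/funext => t /=; congr (mu _); apply/seteqP; split=> x; rewrite /ysection/= inE.
Qed.

Let slab (u v : R) := [set x | Q x /\ u < g x <= v].

Let mGE : measurable_fun setT (fun x => (G x)%:E).
Proof. exact/measurable_EFinP. Qed.

(** Fatou's lemma over the levels, then the Tonelli bound. Starting at u' > u leaves room for the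
    slab widened by [hn n * (Mg + e)]; [rho_slab] then removes e and lets u' decrease to u. *)
Let rho_slab1 (u u' v e : R) : u < u' -> 0 < e ->
  (\int[lebesgue_measure]_(t in `]u', v]) (rho t)%:E <= \int[mu]_(x in slab u v) (G x)%:E + e%:E)%E.
Proof.
move=> uu' e0.
pose f n (t : LT) : \bar R := (mu (shell e (hn n) t) * (hn n)^-1%:E)%E.
have mf n : measurable_fun setT (f n).
  by apply: emeasurable_funM => //; exact: measurable_cst.
have hV n : (0 <= (hn n)^-1%:E)%E by rewrite lee_fin invr_ge0 ltW.
have f0 n t : (0 <= f n t)%E by rewrite mule_ge0.
apply: (@le_trans _ _ (\int[lebesgue_measure]_(t in `]u', v]) limn_einf (f ^~ t))%E).
  apply: ge0_le_integral => //.
  - by move=> t _; rewrite lee_fin.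
  - by apply/measurable_EFinP; exact: measurable_funTS.
  - by apply: measurable_funTS; exact: measurable_limn_einf.
  move=> t _; have [ts|st] := leP t s.
    rewrite rho_s//; apply: le_trans (einfs_le_limn_einf _ 0%N).
    by apply: le_ereal_inf_tmp => _ [n _ <-].
  by apply: le_trans (rho_plus st) _; exact: mu_plus_le.
apply: le_trans (fatou _ _ _ _) _ => //.
  by move=> n; exact: measurable_funTS.
have Me : 0 < Mg + e by rewrite addr_gt0.
have [n0 n0P] : exists n0, forall n, (n0 <= n)%N -> hn n < (u' - u) / (Mg + e).
  by apply: hn_small; rewrite divr_gt0// subr_gt0.
apply: (@limn_einf_le_cst _ _ _ n0) => n nn.
rewrite /f ge0_integralZr//; last exact: measurable_funTS.
apply: (@le_trans _ _ (\int[mu]_(x in slab u v) (G x + e)%:E)%E).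
  rewrite lee_pdivrMr//.
  apply: le_trans (shell_tonelli _ _ (ltW e0) (hn_gt0 n)) _.
  rewrite muleC lee_pmul2r ?lte_fin//.
  apply: ge0_subset_integral => //.
  - have := mslab (u' - hn n * (Mg + e)) v; congr measurable.
    by apply/seteqP; split=> x [? ?].
  - exact: mslab.
  - by apply/measurable_EFinP; apply: measurable_funTS; exact: measurable_funD.
  - by move=> x _; rewrite lee_fin addr_ge0// ltW.
  move=> x [/andP[ux xv] Qx]; split=> //; rewrite xv andbT (le_lt_trans _ ux)//.
  have := n0P n nn; rewrite ltr_pdivlMr//; lra.
under eq_integral do rewrite EFinD.
have -> : (\int[mu]_(x in slab u v) ((G x)%:E + e%:E) =
    \int[mu]_(x in slab u v) (G x)%:E + \int[mu]_(x in slab u v) e%:E)%E.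
  apply: ge0_integralD => //; [exact: mslab|by move=> x _; rewrite lee_fin|exact: measurable_funTS|].
  by move=> x _; rewrite lee_fin ltW.
rewrite leeD2l// integral_cst; last exact: mslab.
rewrite -[leRHS]mule1 lee_pmul2l ?lte_fin//.
by apply: probability_le1; exact: mslab.
Qed.

Let rho_slab (u v : R) :
  (\int[lebesgue_measure]_(t in `]u, v]) (rho t)%:E <= \int[mu]_(x in slab u v) (G x)%:E)%E.
Proof.
have H (u' : R) : u < u' ->
    (\int[lebesgue_measure]_(t in `]u', v]) (rho t)%:E <= \int[mu]_(x in slab u v) (G x)%:E)%E.
  by move=> uu'; apply/lee_addgt0Pr => e; exact: rho_slab1.
pose nu := density lebesgue_measure mrho rho0.
pose F n : set LT := `]u + hn n, v]%classic.
have UF : \bigcup_n F n = `]u, v]%classic.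
  apply/seteqP; split=> t /=.
    move=> [n _]; rewrite /F/= !in_itv/= => /andP[h ->].
    by rewrite andbT (lt_trans _ h)// ltrDl.
  rewrite in_itv/= => /andP[ut tv].
  have [n0 n0P] : exists n0, forall n, (n0 <= n)%N -> hn n < t - u.
    by apply: hn_small; rewrite subr_gt0.
  by exists n0 => //; rewrite /F/= in_itv/= tv andbT -ltrBrDl n0P.
have : nu (F n) @[n --> \oo] --> nu (\bigcup_n F n).
  apply: nondecreasing_cvg_mu => //.
    by move=> n; rewrite /F.
  by rewrite UF.
  move=> n m nm; rewrite subsetEset => t; rewrite /F/= !in_itv/= => /andP[h ->].
  rewrite andbT (le_lt_trans _ h)// lerD2l /hn lef_pV2 ?posrE// ler_nat//.
have -> : (\int[lebesgue_measure]_(t in `]u, v]) (rho t)%:E = nu (\bigcup_n F n))%E by rewrite UF.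
move=> /cvg_lim <- //; apply: lime_le.
  apply: ereal_nondecreasing_is_cvgn => n m nm.
  rewrite le_measure ?inE//; rewrite /F// => t/=; rewrite !in_itv/= => /andP[h ->].
  rewrite andbT (le_lt_trans _ h)// lerD2l /hn lef_pV2 ?posrE// ler_nat//.
by apply: nearW => n; apply: H; rewrite ltrDl.
Qed.

(** Cutting off outside Q makes the density bounded and its image measure finite, as
    [le_measure_ocitv] requires. *)
Let GQ x := G x * \1_Q x.
Let mGQ : measurable_fun setT GQ.
Proof. by apply: measurable_funM => //; exact: measurable_indic. Qed.
Let GQ0 x : 0 <= GQ x.
Proof. by rewrite mulr_ge0. Qed.

Let mgLT : measurable_fun setT (g : 'rV[R]_d -> LT).
Proof. exact: mg. Qed.
Let mg_mixin := isMeasurableFun.Build _ _ _ _ _ mgLT.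
Let mg_pack : {mfun 'rV[R]_d >-> LT} := HB.pack g mg_mixin.

(** The slab inequality compares, on half-open intervals of levels, Lebesgue measure with density
    rho and the image under g of mu with density [GQ]. The comparison passes to Borel sets and then
    to the integrals of phi. *)
Lemma coarea_le (phi : R -> \bar R) : measurable_fun setT (phi : LT -> \bar R) ->
  (forall t, 0 <= phi t)%E ->
  (\int[lebesgue_measure]_t (phi t * (rho t)%:E) <=
   \int[mu]_x (phi (g x) * (enorm (grad g x))%:E))%E.
Proof.
move=> mphi phi0.
pose nu2 := density lebesgue_measure mrho rho0.
pose nuG := density mu mGQ GQ0.
pose nu1 := pushforward nuG mg_pack.
have nu1E (E : set LT) : measurable E -> nu1 E = (\int[mu]_(x in (g @^-1` E) `&` Q) (G x)%:E)%E.
  move=> mE; rewrite /nu1 /pushforward /nuG /density/= [RHS]integral_mkcondr.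
  apply: eq_integral => x _; rewrite patchE /GQ indicE.
  by case: ifPn => xQ; rewrite ?mulr1 ?mulr0.
have le12 E : measurable E -> (nu2 E <= nu1 E)%E.
  apply: le_measure_ocitv.
    change (nu1 setT < +oo)%E; rewrite nu1E// preimage_setT setTI.
    apply: (@le_lt_trans _ _ (\int[mu]_(x in Q) Mg%:E)%E).
      apply: ge0_le_integral => //; first by move=> x _; rewrite lee_fin.
      exact: measurable_funTS.
    rewrite integral_cst// (le_lt_trans _ (ltry Mg))//.
    by rewrite -[leRHS]mule1 lee_pmul2l ?lte_fin// probability_le1.
  move=> u v uv; change (nu2 `]u, v]%classic <= nu1 `]u, v]%classic)%E; rewrite nu1E//.
  apply: le_trans (rho_slab u v) _.
  rewrite (_ : slab u v = g @^-1` `]u, v] `&` Q)//.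
  by apply/seteqP; split=> x; rewrite /slab/= in_itv/= => -[].
have -> : (\int[lebesgue_measure]_t (phi t * (rho t)%:E) = \int[nu2]_t phi t)%E.
  by rewrite ge0_integral_density.
apply: (@le_trans _ _ (\int[nu1]_t phi t)%E).
  exact: ge0_le_measure_integral.
rewrite /nu1 ge0_integral_pushforward//.
rewrite preimage_setT ge0_integral_density//; last 2 first.
  exact: measurableT_comp.
  by move=> x; exact: phi0.
apply: ge0_le_integral => //.
- by move=> x _; apply: mule_ge0; [exact: phi0|rewrite lee_fin].
- apply: emeasurable_funM; first exact: measurableT_comp.
  exact/measurable_EFinP.
- by apply: emeasurable_funM => //; exact: measurableT_comp.
- move=> x _ /=; rewrite lee_wpmul2l// lee_fin /GQ ler_piMr//.
Qed.

End coarea.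

(** * Range of a function under a Poincare inequality *)

Section composition.
Context {R : realType} {d : nat}.
Implicit Types (f g : 'rV[R]_d -> R).

Lemma grad_comp (h dh : R -> R) g x : (forall t, is_derive t (1 : R) h (dh t)) -> smooth g ->
  enorm (grad (h \o g) x) = `|dh (g x)| * enorm (grad g x).
Proof.
move=> hD sg; rewrite -enormZ; congr enorm; apply/rowP => i; rewrite !mxE.
by have [_] := is_derive_comp_dir (hD (g x)) (smooth_derivable i x sg).
Qed.

Lemma smooth_expr_step f : smooth_expr f -> smooth_expr (@smooth_step R \o f).
Proof.
move=> sf.
have -> : @smooth_step R \o f = flat 0 \o (cst (flat 0 1) +
    cst (-1) * (flat 0 \o (cst 1 + cst (-1) * f))).
  by apply/funext => x; rewrite /smooth_step /= !fctE !mulN1r.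
apply: SE_flat; apply: SE_add; first exact: SE_cst.
apply: SE_mul; first exact: SE_cst.
apply: SE_flat; apply: SE_add; first exact: SE_cst.
by apply: SE_mul => //; exact: SE_cst.
Qed.

Lemma smooth_expr_sum (I : Type) (r : seq I) (P : pred I) (F : I -> 'rV[R]_d -> R) :
  (forall i, P i -> smooth_expr (F i)) ->
  smooth_expr (fun x => \sum_(i <- r | P i) F i x).
Proof.
move=> sF; elim: r => [|i r IH].
  rewrite (_ : (fun x => _) = cst 0); first exact: SE_cst.
  by apply/funext => x; rewrite big_nil.
have [Pi|Pi] := boolP (P i); last first.
  rewrite (_ : (fun x => _) = (fun x => \sum_(i <- r | P i) F i x))//.
  by apply/funext => x; rewrite big_cons (negbTE Pi).
rewrite (_ : (fun x => _) = F i + (fun x => \sum_(i <- r | P i) F i x)).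
  by apply: SE_add => //; exact: sF.
by apply/funext => x; rewrite big_cons Pi.
Qed.

Lemma is_derive_bigsum (I : Type) (r : seq I) (P : pred I) (F : I -> R -> R) (dF : I -> R) (t : R) :
  (forall i, is_derive t (1 : R) (F i) (dF i)) ->
  is_derive t (1 : R) (fun t => \sum_(i <- r | P i) F i t) (\sum_(i <- r | P i) dF i).
Proof.
move=> D; elim: r => [|i r IH].
  rewrite big_nil (_ : (fun t => _) = cst 0); first exact: is_derive_cst.
  by apply/funext => u; rewrite big_nil.
rewrite big_cons; case: ifPn => Pi.
  rewrite (_ : (fun t => _) = F i + (fun t => \sum_(i <- r | P i) F i t)).
    exact: is_deriveD (D i) IH.
  by apply/funext => u; rewrite big_cons Pi.
rewrite (_ : (fun t => _) = (fun t => \sum_(i <- r | P i) F i t))//.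
by apply/funext => u; rewrite big_cons (negbTE Pi).
Qed.

Lemma measurable_gt_rV f (t : R) : continuous f -> measurable [set x | t < f x].
Proof.
move=> cf; rewrite (_ : [set x | _] = ~` [set x | f x <= t]).
  by apply: measurableC; apply: closed_measurable_rV; exact: closed_le.
by apply/seteqP; split=> x /=; rewrite ltNge => /negP.
Qed.

End composition.

Section poincare_range.
Context (R : realType) (d : nat) (mu : probability 'rV[R]_d R).
Variables (lambda : R) (g : 'rV[R]_d -> R) (s s' N : R).
Hypothesis lambda0 : 0 < lambda.
Hypothesis Poincare : forall f : 'rV[R]_d -> R, smooth f ->
  (\int[mu]_x ((f x - median mu f) ^+ 2)%:E <=
     lambda%:E * \int[mu]_x (enorm (grad f x) ^+ 2)%:E)%E.
Hypothesis sg : smooth g.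
Hypothesis ss' : s < s'.
Hypothesis gN : forall x, s <= g x -> enorm x <= N.
Hypothesis g_half : (mu [set x | (s < g x)%R] <= (1 / 2)%:E)%E.
Hypothesis g_pos : (0 < mu [set x | (s' <= g x)%R])%E.

Let G x := enorm (grad g x).
Let LT := measurableTypeR R.

Let mg : measurable_fun setT g.
Proof. by apply: continuous_measurable_rV; exact: smooth_continuous. Qed.

Let mpre (A : set R) : measurable (A : set LT) -> measurable (g @^-1` A).
Proof. by move=> mA; rewrite -[_ @^-1` _]setTI; exact: mg. Qed.

Let G_bounded : exists2 M : R, 0 < M & forall x, s <= g x -> G x <= M.
Proof.
have [M M0 MP] := compact_ubounded (grad_continuous sg) (@compact_eball R d N).
by exists M => // x Qx; rewrite (le_trans (ler_norm _))// MP//; exact: gN.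
Qed.

Section grid.
Variables (n : nat) (A : pred 'I_n).
Hypothesis n0 : (0 < n)%N.

Let l : R := (s' - s) / n%:R.
Let u (i : nat) : R := s + i%:R * l.
Let l0 : 0 < l. Proof. by rewrite divr_gt0 ?subr_gt0// ltr0n. Qed.

(* [kappa] grows by [smooth_step 1] across each selected cell, and [kappa \o g] has median 0:
   the Poincare inequality then bounds the number of cells by the mass above them. *)
Let kappa (t : R) := \sum_(i < n | A i) smooth_step ((t - u i) / l).
Let dkappa (t : R) := \sum_(i < n | A i) dsmooth_step ((t - u i) / l) / l.
Definition grid_union : set R := [set t | exists2 i : 'I_n, A i & u i < t < u i.+1].

Let kappaD (t : R) : is_derive t 1 kappa (dkappa t).
Proof.
have D (i : 'I_n) : is_derive t 1 (fun t => smooth_step ((t - u i) / l))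
    (dsmooth_step ((t - u i) / l) / l).
  have d1 : is_derive t 1 (fun t => (t - u i) / l) l^-1.
    have := is_deriveZ l^-1 (is_deriveB (is_derive_id t (1:R)) (is_derive_cst (u i) t (1:R))).
    rewrite subr0 /GRing.scale/= mulr1; congr is_derive.
    by apply/funext => x; rewrite !fctE /GRing.scale/= mulrC.
  exact: (@is_derive1_comp _ (@smooth_step R) (fun t => (t - u i) / l) _ _ _
    (is_derive_smooth_step _) d1).
exact: is_derive_bigsum.
Qed.

Let unitE (i : nat) t : (0 < (t - u i) / l < 1) = (u i < t < u i.+1).
Proof.
rewrite ltr_pdivlMr// mul0r subr_gt0 ltr_pdivrMr// mul1r ltrBlDr; congr (_ && (t < _)).
by rewrite /u -natr1; ring.
Qed.

(** The open cells are disjoint, so at most one summand is nonzero and the bound does not grow with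
    the number of selected cells. *)
Let dkappa_bound t : 0 <= dkappa t <= l^-1 /\ (~ grid_union t -> dkappa t = 0).
Proof.
have l'0 : 0 <= l^-1 by rewrite invr_ge0 ltW.
have z (i : 'I_n) : ~~ (u i < t < u i.+1) -> dsmooth_step ((t - u i) / l) / l = 0.
  move=> ti; have [_ ->] := dsmooth_step_bound ((t - u i) / l); first by rewrite mul0r.
  by rewrite unitE.
split; last first.
  move=> tA; rewrite /dkappa big1// => i Ai; apply: z; apply/negP => ti.
  by apply: tA; exists i.
have p (i : 'I_n) : 0 <= dsmooth_step ((t - u i) / l) / l <= l^-1.
  have [/andP[a b] _] := dsmooth_step_bound ((t - u i) / l).
  by rewrite mulr_ge0//= ler_piMl.
apply/andP; split; first by apply: sumr_ge0 => i _; case/andP: (p i).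
have [[i Ai ti]|tA] := pselect (exists2 i : 'I_n, A i & u i < t < u i.+1); last first.
  rewrite /dkappa big1// => i Ai; apply: z; apply/negP => ti.
  by apply: tA; exists i.
rewrite /dkappa (bigD1 i)//= big1 ?addr0; first by case/andP: (p i).
move=> j /andP[_ ji]; apply: z; apply/negP => /andP[uj tj].
move: ti => /andP[ui ti].
have uS (a b : nat) : u a < u b -> (a < b)%N.
  by rewrite ltrD2l ltr_pM2r// ltr_nat.
have := uS _ _ (lt_trans ui tj); have := uS _ _ (lt_trans uj ti).
by rewrite !ltnS => a b; move/eqP: ji; apply; apply/val_inj/eqP; rewrite eqn_leq a b.
Qed.

Let kappa_lo t : t <= s -> kappa t = 0.
Proof.
move=> ts; rewrite /kappa big1// => i _; apply: smooth_step_le0.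
rewrite ler_pdivrMr// mul0r subr_le0 (le_trans ts)// lerDl mulr_ge0//; exact: ltW.
Qed.

Let kappa_hi t : s' <= t -> kappa t = #|A|%:R * smooth_step 1.
Proof.
move=> ts; rewrite /kappa (eq_bigr (fun=> smooth_step 1)).
  by rewrite big_const iter_addr_0 mulr_natl.
move=> i _; apply: smooth_step_ge1.
rewrite ler_pdivlMr// mul1r lerBrDr (le_trans _ ts)//.
have -> : s' = s + n%:R * l by rewrite /l mulrCA divff ?mulr1 ?subrKC// pnatr_eq0 -lt0n.
by rewrite addrCA lerD2l -[X in X + _]mul1r -mulrDl ler_pM2r// nat1r ler_nat.
Qed.

Let kappa_ge0 t : 0 <= kappa t.
Proof. by apply: sumr_ge0 => i _; exact: smooth_step_ge0. Qed.

Let H := kappa \o g.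

Let sH : smooth H.
Proof.
apply: smooth_expr_smooth; apply: smooth_expr_sum => i _.
have -> : (fun x => smooth_step ((g x - u i) / l)) =
   @smooth_step R \o (g + cst (- u i)) * cst l^-1.
  by apply/funext => x.
apply: smooth_expr_step; apply: SE_mul; last exact: SE_cst.
by apply: SE_add; [exact: SE_smooth|exact: SE_cst].
Qed.

(** H is nonnegative, and positive only where g > s, a set of mass at most 1/2. *)
Let median_H : median mu H = 0.
Proof.
have Hlt0 (t : R) : t < 0 -> ~ (mu [set x | (t < H x)%R] <= (1 / 2)%:E)%E.
  move=> t0; rewrite (_ : [set x | _] = setT); last first.
    by apply/seteqP; split=> x //= _; rewrite (lt_le_trans t0)// /H/= kappa_ge0.
  by rewrite probability_setT lee_fin; lra.
have lb0 : lbound [set t : R | (mu [set x | (t < H x)%R] <= (1 / 2)%:E)%E] 0.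
  by move=> t /= tH; rewrite leNgt; apply/negP => /Hlt0.
have H0 : (mu [set x | (0 < H x)%R] <= (1 / 2)%:E)%E.
  apply: le_trans g_half; rewrite le_measure ?inE//.
  - by apply: measurable_gt_rV; exact: smooth_continuous.
  - by apply: measurable_gt_rV; exact: smooth_continuous.
  - move=> x/= Hx; rewrite ltNge; apply/negP => gs.
    by move: Hx; rewrite /H/= kappa_lo// ltxx.
apply/eqP; rewrite eq_le; apply/andP; split.
  by apply: ge_inf => //; exists 0.
by apply: lb_le_inf => //; exists 0.
Qed.

Lemma measurable_grid_union : measurable (grid_union : set (measurableTypeR R)).
Proof.
have -> : grid_union = \bigcup_(i in [set i : 'I_n | A i]) `]u i, u i.+1[%classic.
  apply/seteqP; split=> t.
    by move=> [i Ai ti]; exists i => //=; rewrite in_itv.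
  by move=> [i /= Ai]; rewrite in_itv/= => ti; exists i.
by apply: fin_bigcup_measurable.
Qed.

Lemma grid_poincare (M : R) : 0 < M -> (forall x, s <= g x -> G x <= M) ->
  (((#|A|%:R * l * smooth_step 1) ^+ 2)%:E * mu [set x | (s' <= g x)%R] <=
    (lambda * M ^+ 2)%:E * mu (g @^-1` grid_union))%E.
Proof.
move=> M0 GM; have := Poincare sH; rewrite median_H.
under eq_integral do rewrite subr0.
have mH2 : measurable_fun setT (fun x => (H x ^+ 2)%:E).
  apply/measurable_EFinP; apply: measurable_funX.
  by apply: continuous_measurable_rV; exact: smooth_continuous.
have mD : measurable [set x | s' <= g x].
  by apply: closed_measurable_rV; apply: closed_ge; exact: smooth_continuous.
have low : (((#|A|%:R * smooth_step 1) ^+ 2)%:E * mu [set x | (s' <= g x)%R] <=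
    \int[mu]_x (H x ^+ 2)%:E)%E.
  rewrite -integral_cst//.
  apply: (@le_trans _ _ (\int[mu]_(x in [set x | (s' <= g x)%R]) (H x ^+ 2)%:E)%E).
    rewrite le_eqVlt; apply/orP; left; apply/eqP.
    by apply: eq_integral => x; rewrite inE/= => gx; rewrite /H/= kappa_hi.
  by apply: ge0_subset_integral => // x _; rewrite lee_fin sqr_ge0.
have up : (\int[mu]_x (enorm (grad H x) ^+ 2)%:E <=
    ((l^-1 * M) ^+ 2)%:E * mu (g @^-1` grid_union))%E.
  have mU : measurable (g @^-1` grid_union) by apply: mpre; exact: measurable_grid_union.
  rewrite -integral_cst// [leRHS]integral_mkcond.
  apply: ge0_le_integral => //.
  - by move=> x _; rewrite lee_fin sqr_ge0.
  - by apply/measurable_EFinP; apply: measurable_funX; exact: measurable_grad.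
  - by apply/(measurable_restrictT _ mU).
  - move=> x _; rewrite patchE (grad_comp _ kappaD sg).
    have [/andP[k0 kl] kz] := dkappa_bound (g x).
    case: ifPn => [|]; rewrite ?inE ?notin_setE /= => gx; last first.
      by rewrite kz// normr0 mul0r expr0n.
    rewrite lee_fin lerXn2r ?nnegrE ?mulr_ge0 ?enorm_ge0 ?invr_ge0 ?(ltW l0) ?(ltW M0)//.
    rewrite ger0_norm// ler_pM ?enorm_ge0//.
    have [i Ai /andP[ui _]] := gx.
    by apply: GM; rewrite (le_trans _ (ltW ui))// lerDl mulr_ge0// ltW.
move=> le1.
have := le_trans low (le_trans le1 (lee_wpmul2l _ up)).
rewrite lee_fin (ltW lambda0) => /(_ isT).
rewrite -(fineK (fin_num_measure mu _ mD)).
rewrite -(fineK (fin_num_measure mu _ (mpre measurable_grid_union))).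
set a := fine (mu (g @^-1` _)); set b := fine (mu _).
rewrite -!EFinM !lee_fin => h.
have -> : (#|A|%:R * l * smooth_step 1) ^+ 2 * b = l ^+ 2 * ((#|A|%:R * smooth_step 1) ^+ 2 * b).
  ring.
have -> : lambda * M ^+ 2 * a = l ^+ 2 * (lambda * ((l^-1 * M) ^+ 2 * a)).
  by field; rewrite gt_eqF.
by rewrite ler_pM2l// exprn_gt0.
Qed.

End grid.

(** Select the cells of mesh l that meet C. Their total length is at least that of C, and they lie
    in the 2l-neighbourhood of C, whose preimage decreases to the null set over C. So the right side
    of [grid_poincare] tends to 0. *)
Let compact_range (C : set R) : compact C -> C `<=` `]s, s'[%classic ->
  mu (g @^-1` C) = 0 -> lebesgue_measure (C : set LT) = 0%E.
Proof.
move=> cC Css gC; have [M M0 GM] := G_bounded.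
pose O (r : R) : set R := \bigcup_(c in C) ball c r.
have oO r : 0 < r -> open (O r) by move=> r0; apply: bigcup_open => c _; exact: ball_open.
pose l n := (s' - s) / n.+1%:R.
have l0 n : 0 < l n by rewrite divr_gt0 ?subr_gt0.
pose u n (i : nat) := s + i%:R * l n.
pose On n := O (2 * l n).
pose A n : pred 'I_n.+1 := fun i => `[< exists2 t, C t & u n i <= t <= u n i.+1 >].
have mO n : measurable (O (2 * l n) : set LT).
  by apply: open_measurable; apply: oO; rewrite mulr_gt0.
have mC : measurable (C : set LT) by exact: compact_measurable.
have mD : measurable [set x | s' <= g x].
  by apply: closed_measurable_rV; apply: closed_ge; exact: smooth_continuous.
have uS n i : u n i.+1 = u n i + l n by rewrite /u -natr1; ring.
have CA n : (lebesgue_measure (C : set LT) <= (#|A n|%:R * l n)%:E)%E.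
  pose F (k : nat) : set LT :=
    if insub k is Some i then if A n i then `[u n i, u n i.+1]%classic else set0 else set0.
  have mF k : measurable (F k) by rewrite /F; case: insubP => // i _ _; case: ifP.
  apply: (le_trans (@content_subadditive _ _ _ lebesgue_measure C F n.+1 _ _ _)) => //.
    move=> t Ct; rewrite -bigcup_mkord.
    have := Css t Ct; rewrite /= in_itv/= => /andP[st ts].
    have tl0 : 0 <= (t - s) / l n by rewrite divr_ge0// ?subr_ge0 ltW.
    have tln : (t - s) / l n < n.+1%:R.
      rewrite ltr_pdivrMr// /l mulrCA divff ?mulr1 ?pnatr_eq0// ltrD2r//.
    have /andP[k1 k2] := truncn_itv tl0.
    set k := Num.truncn _ in k1 k2.
    have kn : (k < n.+1)%N by rewrite -(@ltr_nat R) (le_lt_trans k1).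
    have ut : u n k <= t <= u n k.+1.
      rewrite /u -lerBrDl -ler_pdivlMr// k1/= -lerBlDl -ler_pdivrMr//.
      exact: ltW.
    exists k => //; rewrite /F insubT/=.
    have -> : A n (Sub k kn) by apply/asboolP; exists t.
    by rewrite /= in_itv.
  have -> : (\sum_(i < n.+1) lebesgue_measure (F i) = \sum_(i < n.+1) (if A n i then (l n)%:E else 0))%E.
    apply: eq_bigr => i _; rewrite /F valK; case: ifP => _; last by rewrite measure0.
    by rewrite lebesgue_measure_itv/= lte_fin uS ltrDl l0 -EFinB addrAC subrr add0r.
  rewrite -big_mkcond/= sumEFin lee_fin big_const iter_addr_0 mulr_natl//.
have gA n : grid_union (A n) `<=` O (2 * l n).
  move=> t [i /asboolP[c Cc /andP[c1 c2]] /andP[t1 t2]]; exists c => //.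
  move: c1 c2 t1 t2; rewrite -/(l n) -/(u n i) -/(u n i.+1) uS => c1 c2 t1 t2.
  rewrite /ball/= ltr_norml; apply/andP; split; have := l0 n; lra.
have key n : (((fine (lebesgue_measure (C : set LT)) * smooth_step 1) ^+ 2)%:E *
    mu [set x | (s' <= g x)%R] <= (lambda * M ^+ 2)%:E * mu (g @^-1` On n))%E.
  apply: le_trans (_ : _ <= (lambda * M ^+ 2)%:E * mu (g @^-1` grid_union (A n)))%E _.
    apply: le_trans (grid_poincare (A n) _ M0 GM) => //.
    have c1 : 0 <= smooth_step (1 : R) by rewrite ltW// smooth_step1_gt0.
    have AL : 0 <= #|A n|%:R * l n by apply: mulr_ge0 => //; exact: ltW.
    rewrite lee_wpmul2r// lee_fin; apply: lerXn2r; rewrite ?nnegrE.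
    - by apply: mulr_ge0 => //; exact: fine_ge0.
    - exact: mulr_ge0 AL c1.
    rewrite ler_pM2r ?smooth_step1_gt0// -lee_fin fineK ?CA//.
    by rewrite ge0_fin_numE// (le_lt_trans (CA n)) ?ltry.
  apply: lee_wpmul2l; first by rewrite lee_fin mulr_ge0 ?sqr_ge0 ?(ltW lambda0).
  rewrite le_measure ?inE//.
  - by apply: mpre; exact: measurable_grid_union.
  - by apply: mpre; exact: mO.
  - by move=> x /gA.
have IO : \bigcap_n g @^-1` On n = g @^-1` C.
  apply/seteqP; split=> x; last first.
    by move=> Cx n _; exists (g x) => //; apply: ballxx; rewrite mulr_gt0.
  move=> xO; have cC' : closed C by apply: compact_closed => //; exact: Rhausdorff.
  apply: cC' => B /nbhs_ballP[e /= e0 eB].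
  have [n n0] : exists n : nat, 2 * l n < e.
    exists (Num.truncn (2 * (s' - s) / e)).
    rewrite /l mulrA ltr_pdivrMr// -ltr_pdivrMl// mulrC.
    exact: truncnS_gt.
  have [c Cc cx] := xO n I; exists c; split=> //; apply: eB.
  by apply: ball_sym; apply: le_ball cx; exact: ltW.
have lim0 : mu (g @^-1` On n) @[n --> \oo] --> 0%E.
  rewrite -gC -IO; apply: nonincreasing_cvg_mu.
  - by rewrite (le_lt_trans (probability_le1 _ _)) ?ltry//; apply: mpre; exact: mO.
  - by move=> n; apply: mpre; exact: mO.
  - by rewrite IO; exact: mpre.
  - move=> n m nm; rewrite subsetEset => x [c Cc cx]; exists c => //.
    apply: le_ball cx; rewrite ler_pM2l// ler_pM2l ?subr_gt0// lef_pV2 ?posrE//.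
    by rewrite ler_nat.
have : (((fine (lebesgue_measure (C : set LT)) * smooth_step 1) ^+ 2)%:E *
    mu [set x | (s' <= g x)%R] <= 0)%E.
  have c : ((lambda * M ^+ 2)%:E * mu (g @^-1` On n))%E @[n --> \oo] --> ((lambda * M ^+ 2)%:E * 0)%E.
    by apply: cvgeZl.
  rewrite mule0 in c; rewrite -(cvg_lim _ c)//; apply: lime_ge.
    by apply/cvg_ex; exists 0%E.
  by apply: nearW => n; exact: key.
rewrite leNgt => h; apply/eqP; apply: contraT => C0; exfalso.
move/negP: h; apply; rewrite mule_gt0// lte_fin exprn_gt0// mulr_gt0 ?smooth_step1_gt0//.
rewrite fine_gt0// lt0e C0 measure_ge0/= (le_lt_trans (CA 0%N)) ?ltry//.
Qed.

(** Inner regularity with the measure of E itself as allowed defect: a compact part C of E is null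
    by the previous step, so E would have measure less than its own. *)
Lemma poincare_range (E : set R) : measurable (E : set (measurableTypeR R)) ->
  E `<=` `]s, s'[%classic -> mu (g @^-1` E) = 0 -> lebesgue_measure (E : set (measurableTypeR R)) = 0%E.
Proof.
move=> mE Ess gE.
have Efin : (lebesgue_measure (E : set LT) < +oo)%E.
  apply: (@le_lt_trans _ _ (lebesgue_measure (`]s, s'[%classic : set LT))).
    by rewrite le_measure ?inE.
  by rewrite lebesgue_measure_itv/=; case: ifPn => _; rewrite ?ltry// -EFinB ltry.
apply/eqP; rewrite eq_le measure_ge0 andbT leNgt; apply/negP => E0.
have Er : lebesgue_measure (E : set LT) = (fine (lebesgue_measure (E : set LT)))%:E.
  by rewrite fineK// ge0_fin_numE.
have e0 : 0 < fine (lebesgue_measure (E : set LT)) by rewrite fine_gt0// E0.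
have [C [cC CE]] := lebesgue_regularity_inner mE Efin e0.
rewrite -Er; apply/negP; rewrite -leNgt.
have mC : measurable (C : set LT) by exact: compact_measurable.
have C0 : lebesgue_measure (C : set LT) = 0%E.
  apply: compact_range => //; first exact: subset_trans Ess.
  apply/eqP; rewrite eq_le measure_ge0 andbT -gE le_measure ?inE//; try exact: mpre.
  by move=> x /CE.
rewrite -[leRHS]adde0 -C0.
apply: le_trans (measureU2 _ _ mC); last exact: measurableD.
rewrite le_measure ?inE//; first by apply: measurableU => //; exact: measurableD.
by move=> t Et; have [Ct|Ct] := pselect (C t); [right|left].
Qed.

End poincare_range.

(** * Spheres and supports *)

(** Here u may be negative, in which case [Num.sqrt u] is 0; this happens for cells near the equator
    of the sphere. *)
Lemma sqrtrD_le (R : realType) (u v : R) : 0 <= v -> Num.sqrt (u + v) <= Num.sqrt u + Num.sqrt v.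
Proof.
move=> v0; have [u0|u0] := leP 0 u; last first.
  by rewrite (le_trans (_ : _ <= Num.sqrt v))// ?lerDr ?sqrtr_ge0// ler_wsqrtr// gerDr ltW.
rewrite -(@ler_pXn2r _ 2)// ?nnegrE ?addr_ge0 ?sqrtr_ge0//.
rewrite sqr_sqrtr ?addr_ge0// sqrrD !sqr_sqrtr//.
by rewrite -addrA lerD2l lerDr mulrn_wge0// mulr_ge0 ?sqrtr_ge0.
Qed.

(** * Covering a sphere by thin boxes *)

Section sphere.
Context {R : realType} {n : nat}.
Implicit Types x : 'rV[R]_n.+1.

Lemma nneseries_finite (v : nat -> \bar R) (m : nat) : (forall k, (m <= k)%N -> v k = 0%E) ->
  (\sum_(0 <= k <oo) v k = \sum_(0 <= k < m) v k)%E.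
Proof.
move=> v0; apply: cvg_lim => //; apply: cvg_near_cst; near=> N.
rewrite (@big_cat_nat _ _ _ m)//=; last by near: N; exact: nbhs_infty_ge.
rewrite [X in (_ + X)%E]big_nat_cond [X in (_ + X)%E]big1 ?adde0//.
by move=> k /andP[/andP[mk _] _]; exact: v0.
Unshelve. all: by end_near. Qed.

Lemma lebesgue_outer_ge0 d (S : set 'rV[R]_d) : (0 <= lebesgue_outer S)%E.
Proof.
apply: le_ereal_inf_tmp => _ [a [b [ab _ ->]]].
by apply: nneseries_ge0 => k _ _; rewrite lee_fin prodr_ge0// => i _; rewrite subr_ge0.
Qed.

Variables (r : R) (N : nat).
Hypothesis r0 : 0 < r.

Let h : R := 2 * r / N.+1%:R.
(** The uncertainty on the square of the first coordinate: each of the n others moves by at most h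
    in its cell and stays in [-r, r], so its square moves by at most 2 r h. *)
Let w : R := n%:R * (2 * r * h).
(* The sphere is covered by boxes over a grid of mesh [h] in the last [n] coordinates, with one
   box for each sign of the first coordinate. *)
Let I := (bool * {ffun 'I_n -> 'I_N.+1})%type.
Let z (j : {ffun 'I_n -> 'I_N.+1}) (i : 'I_n) : R := - r + (j i)%:R * h.
Let p j : R := r ^+ 2 - \sum_(i < n) z j i ^+ 2.
Let lo j : R := Num.sqrt (p j - w).
Let hi j : R := Num.sqrt (p j + w).
Let a (k : I) : 'rV[R]_n.+1 := \row_i
  (if unlift ord0 i is Some i' then z k.2 i' else if k.1 then lo k.2 else - hi k.2).
Let b (k : I) : 'rV[R]_n.+1 := \row_i
  (if unlift ord0 i is Some i' then z k.2 i' + h else if k.1 then hi k.2 else - lo k.2).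

Let h0 : 0 < h. Proof. by rewrite divr_gt0// mulr_gt0. Qed.
Let w0 : 0 <= w. Proof. by rewrite mulr_ge0// mulr_ge0 ?(ltW h0)// mulr_ge0// ltW. Qed.
Let lohi j : lo j <= hi j.
Proof. by rewrite ler_wsqrtr// lerD2l ge0_cp. Qed.

Let ab k i : a k 0 i <= b k 0 i.
Proof.
rewrite !mxE; case: unlift => [i'|]; first by rewrite lerDl ltW.
by case: k.1; rewrite ?lerN2 lohi.
Qed.

Let vol k : \prod_(i < n.+1) (b k 0 i - a k 0 i) <= Num.sqrt (2 * w) * h ^+ n.
Proof.
rewrite big_ord_recl !mxE unlift_none (eq_bigr (fun=> h)); last first.
  by move=> i _; rewrite !mxE liftK addrAC subrr add0r.
rewrite big_const card_ord iter_mulr_1 ler_wpM2r// ?exprn_ge0 ?(ltW h0)//.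
suff : hi k.2 - lo k.2 <= Num.sqrt (2 * w) by case: k.1; rewrite ?opprK// addrC.
have W : 0 <= 2 * w by exact: mulr_ge0.
rewrite lerBlDl (le_trans _ (sqrtrD_le _ W))//.
by rewrite ler_wsqrtr//; lra.
Qed.

Let cover x : enorm x = r -> exists k, box (a k) (b k) x.
Proof.
move=> xr.
have xir i : - r <= x 0 i <= r by rewrite -ler_norml -xr ler_coord_enorm.
have xN i : 0 <= (x 0 i + r) / h by rewrite divr_ge0 ?(ltW h0)//; case/andP: (xir i); lra.
have xN' i : (x 0 i + r) / h <= N.+1%:R.
  rewrite ler_pdivrMr// /h mulrCA divff ?mulr1 ?pnatr_eq0//; case/andP: (xir i); lra.
have zx i : exists j : 'I_N.+1, - r + j%:R * h <= x 0 i <= - r + j%:R * h + h.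
  have /andP[t1 t2] := truncn_itv (xN i).
  set t := Num.truncn _ in t1 t2.
  have [tN|tN] := ltnP t N.+1.
    exists (Ordinal tN) => /=; move: t1 t2.
    rewrite ler_pdivlMr// ltr_pdivrMr// -natr1; lra.
  exists ord_max => /=.
  have := xN' i; move: t1; rewrite ler_pdivlMr// ler_pdivrMr// => t1 t3.
  have : N.+1%:R * h <= x 0 i + r by rewrite (le_trans _ t1)// ler_pM2r// ler_nat.
  have := h0; move: t3; rewrite -natr1 => t3 h0' t4; apply/andP; split; lra.
have [j jP] := choice zx.
pose jj : {ffun 'I_n -> 'I_N.+1} := [ffun i => j (lift ord0 i)].
have zP i : z jj i <= x 0 (lift ord0 i) <= z jj i + h by rewrite /z ffunE; exact: jP.
have zr i : - r <= z jj i <= r.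
  have /andP[+ _] := zP i; have /andP[_] := xir (lift ord0 i).
  have : 0 <= z jj i + r by rewrite /z addrAC addNr add0r mulr_ge0// ltW.
  by move=> ? ? ?; apply/andP; split; lra.
have x0p : `|x 0 ord0 ^+ 2 - p jj| <= w.
  have : enorm x ^+ 2 = r ^+ 2 by rewrite xr.
  rewrite sqr_enorm big_ord_recl => E.
  have -> : x 0 ord0 ^+ 2 = r ^+ 2 - \sum_(i < n) x 0 (lift ord0 i) ^+ 2 by rewrite -E addrK.
  rewrite /p opprD opprK addrACA subrr add0r addrC -sumrB.
  apply: (le_trans (ler_norm_sum _ _ _)).
  have -> : w = \sum_(i < n) 2 * r * h by rewrite sumr_const card_ord /w mulr_natl.
  apply: ler_sum => i _; rewrite subr_sqr mulrC normrM distrC.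
  have /andP[z1 z2] := zP i; have /andP[z3 z4] := zr i; have /andP[z5 z6] := xir (lift ord0 i).
  rewrite ler_pM//.
    by rewrite ler_norml; apply/andP; split; lra.
  by rewrite ler_norml; apply/andP; split; lra.
have x0 : lo jj <= `|x 0 ord0| <= hi jj.
  move: x0p; rewrite ler_norml => /andP[q1 q2].
  by rewrite -sqrtr_sqr /lo /hi !ler_wsqrtr//; lra.
exists (0 <= x 0 ord0, jj) => i; rewrite !mxE.
case: unliftP => [i' ->|->]; first exact: zP.
rewrite /=; case: ifPn => [xp|]; first by rewrite ger0_norm in x0.
rewrite -ltNge => xn; move: x0; rewrite ltr0_norm// => /andP[? ?].
by apply/andP; split; lra.
Qed.

(** There are 2 (N+1)^n boxes of volume at most sqrt(2 w) h^n, and (N+1) h = 2 r; the radicand in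
    the bound is 2 w. *)
Lemma lebesgue_outer_sphere_le (S : set 'rV[R]_n.+1) : (forall x, S x -> enorm x = r) ->
  (lebesgue_outer S <= (2 * (2 * r) ^+ n * Num.sqrt (8 * n%:R * r ^+ 2 / N.+1%:R))%:E)%E.
Proof.
move=> Sr.
pose m := #|{: I}|.
(* Past the last box the sequence is padded with the degenerate box at the origin, of volume 0. *)
pose aa (k : nat) : 'rV[R]_n.+1 := if insub k is Some i then a (enum_val (i : 'I_m)) else 0.
pose bb (k : nat) : 'rV[R]_n.+1 := if insub k is Some i then b (enum_val (i : 'I_m)) else 0.
pose v k : \bar R := (\prod_(i < n.+1) (bb k 0 i - aa k 0 i))%:E.
apply: (@le_trans _ _ (\sum_(0 <= k <oo) v k)%E).
  apply: ge_ereal_inf; exists (\sum_(0 <= k <oo) v k)%E => //.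
  exists aa, bb; split => //.
    by move=> k i; rewrite /aa /bb; case: insubP.
  move=> x /Sr /cover[k kx]; exists (enum_rank k) => //.
  by rewrite /aa /bb valK enum_rankK.
rewrite (@nneseries_finite _ m); last first.
  move=> k mk; rewrite /v /aa /bb insubF ?ltnNge ?mk//.
  by rewrite big_ord_recl subrr mul0r.
have -> : 2 * (2 * r) ^+ n * Num.sqrt (8 * n%:R * r ^+ 2 / N.+1%:R) =
    \sum_(0 <= k < m) (Num.sqrt (2 * w) * h ^+ n).
  rewrite big_mkord sumr_const card_ord /m card_prod card_bool card_ffun !card_ord.
  rewrite -[RHS]mulr_natl natrM natrX.
  have hN : 2 * r = N.+1%:R * h by rewrite /h mulrCA divff ?mulr1 ?pnatr_eq0.
  have -> : 8 * n%:R * r ^+ 2 / N.+1%:R = 2 * w by rewrite /w /h; field; rewrite ?pnatr_eq0.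
  by rewrite hN exprMn; ring.
rewrite -sumEFin; rewrite !big_mkord; apply: lee_sum => k _; rewrite lee_fin.
by rewrite /v /aa /bb valK; exact: vol.
Qed.

End sphere.

Lemma lebesgue_outer_sphere (R : realType) (d : nat) (r : R) (S : set 'rV[R]_d) :
  (0 < d)%N -> 0 < r -> (forall x, S x -> enorm x = r) -> lebesgue_outer S = 0%E.
Proof.
case: d S => // n S _ r0 Sr; apply/eqP; rewrite eq_le lebesgue_outer_ge0 andbT.
apply/lee_addgt0Pr => e e0; rewrite add0e.
pose c : R := 2 * (2 * r) ^+ n.
have c0 : 0 < c by rewrite mulr_gt0// exprn_gt0// mulr_gt0.
pose D : R := 8 * n%:R * r ^+ 2.
have D0 : 0 <= D by rewrite mulr_ge0 ?sqr_ge0// mulr_ge0.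
pose N := Num.truncn (D * (c / e) ^+ 2).
apply: (le_trans (lebesgue_outer_sphere_le N r0 Sr)); rewrite lee_fin -/c -/D.
rewrite -ler_pdivlMl// -[leRHS]ger0_norm; last by rewrite mulr_ge0// ?invr_ge0 ltW.
rewrite -sqrtr_sqr ler_wsqrtr// ler_pdivrMr//.
have := ltW (truncnS_gt (D * (c / e) ^+ 2)).
rewrite -/N => /(ler_wpM2l (_ : 0 <= (c^-1 * e) ^+ 2)) => /(_ (sqr_ge0 _)).
apply: le_trans; rewrite le_eqVlt; apply/orP; left; apply/eqP.
by field; rewrite !gt_eqF.
Qed.

Lemma sphere_null (R : realType) (d : nat) (mu : probability 'rV[R]_d R) (r : R) :
  (0 < d)%N -> mu `<< lebesgue_outer -> 0 < r -> mu [set x | enorm x = r] = 0%E.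
Proof.
move=> d0 mu_ac r0.
have mS : measurable [set x : 'rV[R]_d | enorm x = r].
  rewrite (_ : [set x | _] = [set x | enorm x <= r] `&` [set x | r <= enorm x]).
    apply: measurableI; first exact: measurable_eball.
    by apply: closed_measurable_rV; apply: closed_ge; exact: enorm_continuous.
  apply/seteqP; split=> x /=; first by move=> ->; split.
  by move=> [? ?]; apply/eqP; rewrite eq_le; apply/andP.
apply: (mu_ac [set x | enorm x = r]) => // A mA Ar.
by apply: (lebesgue_outer_sphere d0 r0) => x /Ar.
Qed.

(** Every point beyond radius r has a null neighbourhood; finitely many of them cover each compact
    annulus [K n], and the annuli exhaust the complement of the ball. *)
Lemma supp_null (R : realType) (d : nat) (mu : probability 'rV[R]_d R) (r : R) :
  supp mu `<=` eball r -> mu (~` eball r) = 0%E.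
Proof.
move=> sr; pose K (n : nat) := [set x : 'rV[R]_d | r + n.+1%:R^-1 <= enorm x] `&` eball n%:R.
have cE := @enorm_continuous R d.
have mK n : measurable (K n).
  apply: measurableI; last exact: measurable_eball.
  by apply: closed_measurable_rV; exact: closed_ge.
have K0 n : mu (K n) = 0%E.
  have cK : compact (K n).
    apply: (subclosed_compact _ (@compact_eball R d n%:R)); last by move=> x [].
    by apply: closedI; [exact: closed_ge|exact: closed_eball].
  have /choice[U UP] : forall x : 'rV[R]_d, exists U : set 'rV[R]_d,
      K n x -> [/\ open U, U x & mu U = 0%E].
    move=> x; have [Kx|] := pselect (K n x); last by exists setT.
    have : ~ supp mu x.
      move=> /sr; rewrite /eball/=; case: Kx => /= + _; have : 0 < n.+1%:R^-1 :> R by rewrite invr_gt0.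
      by move=> i0 h1 /(le_trans h1); rewrite gerDl leNgt i0.
    move=> /existsNP[U /not_implyP[oU /not_implyP[Ux /negP U0]]]; exists U => _; split=> //.
    by apply/eqP; rewrite eq_le measure_ge0 andbT leNgt.
  move: cK; rewrite compact_cover => /(_ _ (K n) U)[|x Kx|D DK KD].
  - by move=> x /UP[].
  - by exists x => //; have [] := UP x Kx.
  apply/eqP; rewrite eq_le measure_ge0 andbT.
  have DU x : [set` D] x -> [/\ open (U x), U x x & mu (U x) = 0%E].
    by move=> /DK /set_mem /UP.
  have := @content_sub_fsum _ _ _ mu _ [set` D] (K n) U (@finite_fset _ D) _ (mK n) KD.
  move=> /(_ _)/le_trans; apply; first by move=> x /DU[oU _ _]; exact: open_measurable_rV.
  by rewrite fsbig1// => x /DU[].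
have UK : ~` eball r `<=` \bigcup_n K n.
  move=> x /negP; rewrite -ltNge => rx.
  pose n1 := Num.truncn (enorm x - r)^-1; pose n2 := Num.truncn (enorm x).
  exists (maxn n1 n2.+1) => //; split; rewrite /eball/=; last first.
    by rewrite (le_trans (ltW (truncnS_gt _)))// ler_nat leq_maxr.
  rewrite -lerBrDl invf_ple ?posrE ?subr_gt0// (le_trans (ltW (truncnS_gt _)))//.
  by rewrite ler_nat ltnS leq_maxl.
apply/eqP; rewrite eq_le measure_ge0 andbT.
have mE : measurable (~` (eball r : set 'rV[R]_d)) by apply: measurableC; exact: measurable_eball.
apply: le_trans (measure_sigma_subadditive mu mK mE UK) _.
by rewrite eseries0// => i _ _; rewrite /= K0.
Qed.

(** Its use is to keep [isop] out of the branch where it is 0 by convention. *)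
Lemma radius_supp_lt (R : realType) (d : nat) (mu : probability 'rV[R]_d R) (r : R) :
  (0 < mu (~` eball r))%E -> (r%:E < Defs.radius (supp mu))%E.
Proof.
move=> h; rewrite ltNge; apply/negP => rr; move: h; rewrite supp_null ?ltxx//.
move=> x sx; rewrite /eball/= leNgt; apply/negP => rx.
have /ereal_inf_ltP[_ [r' /= sr' <-]] : (Defs.radius (supp mu) < (enorm x)%:E)%E.
  by rewrite (le_lt_trans rr)// lte_fin.
by rewrite lte_fin ltNge => /negP; apply; exact: sr'.
Qed.

(** * Costs and admissible functions *)

Section costs.
Context {R : realType}.
Variables (A q : R).
Hypotheses (A0 : 0 < A) (q2 : 2 <= q).
Implicit Types (s t y z : R).

Let q0 : 0 < q. Proof. by rewrite (lt_le_trans _ q2). Qed.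
Let c : \bar R -> \bar R := cost_conj A q.
Let p t : R := A `^ (2 - q) * (t `^ q / q).
Let k : R := A ^+ 2 * ((q - 2) / (2 * q)).

Let k0 : 0 <= k.
Proof. by rewrite mulr_ge0 ?sqr_ge0// divr_ge0 ?subr_ge0// mulr_ge0// ltW. Qed.

Let k_le : k <= A ^+ 2 / 2.
Proof.
rewrite ler_wpM2l ?sqr_ge0// ler_pdivrMr ?mulr_gt0//.
by rewrite mulrA mulVf ?pnatr_eq0// mul1r gerBl.
Qed.

Let p0 t : 0 <= p t.
Proof. by rewrite mulr_ge0 ?powR_ge0// divr_ge0 ?powR_ge0// ltW. Qed.

Let costE t : 0 <= t -> cost A q t = if t <= A then t ^+ 2 / 2 else p t + k.
Proof. by move=> t0; rewrite /cost ger0_norm. Qed.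

Let p_scale t l : 0 <= t -> 0 <= l -> p (l * t) = l `^ q * p t.
Proof. by move=> t0 l0; rewrite /p powRM//; ring. Qed.

Let pA : p A = A ^+ 2 / q.
Proof.
by rewrite /p mulrA -powRD ?subrK ?powR_mulrn ?(ltW A0)//; apply/implyP => _; rewrite gt_eqF.
Qed.

Let p_sqr t : A <= t -> t ^+ 2 / q <= p t.
Proof.
move=> At; have -> : t = (t / A) * A by rewrite divfK// gt_eqF.
have tA : 1 <= t / A by rewrite ler_pdivlMr// mul1r.
have tA0 : 0 <= t / A by rewrite (le_trans _ tA).
rewrite p_scale ?(ltW A0)// pA exprMn -mulrA ler_wpM2r//.
  by rewrite divr_ge0 ?sqr_ge0// ltW.
by rewrite -powR_mulrn// ler_powR.
Qed.

Lemma cost0 : cost A q 0 = 0.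
Proof. by rewrite costE// (ltW A0) expr0n mul0r. Qed.

(** Both branches rely on q >= 2: 1/2 >= 1/q on the first, (t/A)^q >= (t/A)^2 on the second. *)
Lemma cost_sqr t : 0 <= t -> t ^+ 2 / q <= cost A q t.
Proof.
move=> t0; rewrite costE//; case: ifPn => [_|].
  by rewrite ler_wpM2l ?sqr_ge0// lef_pV2 ?posrE.
by rewrite -ltNge => /ltW /p_sqr h; rewrite (le_trans h)// lerDl.
Qed.

Lemma cost_double : exists2 M : R, 1 <= M & forall t, 0 <= t -> cost A q (2 * t) <= M * cost A q t.
Proof.
pose Q : R := 2 `^ q.
have Q1 : 1 <= Q by rewrite -(powRr0 2); apply: ler_powR; [rewrite ler1n|exact: ltW].
exists (8 * (Q + 1)); first by lra.
move=> t t0; have t20 : 0 <= 2 * t by rewrite mulr_ge0.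
have [tA|tA] := leP t A.
  rewrite (costE t0) tA (costE t20); have t2 := sqr_ge0 t.
  case: ifPn => [_|]; first by nra.
  (* The crossing case t <= A < 2 t: the power branch at 2 t is compared with its value at A, and
     A^2 <= 4 t^2. *)
  rewrite -ltNge => t2A.
  have pp : p (2 * t) <= Q * (A ^+ 2 / q).
    rewrite p_scale//; apply: ler_wpM2l; first exact: powR_ge0.
    rewrite -pA /p ler_wpM2l ?powR_ge0// ler_wpM2r ?invr_ge0 ?(ltW q0)//.
    by rewrite ge0_ler_powR ?nnegrE ?(ltW q0) ?(ltW A0).
  have A2 : A ^+ 2 <= 4 * t ^+ 2.
    by rewrite (_ : 4 * t ^+ 2 = (2 * t) ^+ 2); [rewrite lerXn2r ?nnegrE ?(ltW A0) ?(ltW t2A)|ring].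
  have qq : A ^+ 2 / q <= A ^+ 2 / 2 by rewrite ler_wpM2l ?sqr_ge0// lef_pV2 ?posrE.
  have := k_le; have A20 := sqr_ge0 A.
  have : Q * (A ^+ 2 / q) <= Q * (A ^+ 2 / 2) by rewrite ler_wpM2l// (le_trans _ Q1).
  nra.
have tA' : (t <= A) = false by apply/negbTE; rewrite -ltNge.
have t2A' : (2 * t <= A) = false.
  by apply/negbTE; rewrite -ltNge (lt_le_trans tA)// ler_peMl// ler1n.
rewrite (costE t0) tA' (costE t20) t2A'.
rewrite p_scale// -/Q.
have h1 : 0 <= Q * p t by rewrite mulr_ge0// (le_trans _ Q1).
have h2 : 0 <= Q * k by rewrite mulr_ge0// (le_trans _ Q1).
have := p0 t; have := k0; nra.
Qed.

Local Open Scope ereal_scope.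

Lemma cost_conj_ge0 x : 0 <= c x.
Proof.
apply: ereal_sup_ubound; exists 0%R => //=.
by rewrite mule0 cost0 oppr0 adde0.
Qed.

Lemma cost_conj_pinfty : c +oo = +oo.
Proof.
apply/eqP; rewrite -leye_eq; apply: ereal_sup_ubound; exists 1%R => //=.
by rewrite mule1.
Qed.

(** Conjugation reverses [cost_sqr], and the conjugate of t^2 / q is q y^2 / 4. *)
Lemma cost_conj_le y : c y%:E <= (q * y ^+ 2 / 4)%:E.
Proof.
apply: ge_ereal_sup => _ [z /= z0 <-].
rewrite -EFinM -EFinB lee_fin lerBlDr.
apply: (@le_trans _ _ (q * y ^+ 2 / 4 + z ^+ 2 / q)%R); last by rewrite lerD2l cost_sqr.
rewrite -subr_ge0; have -> : (q * y ^+ 2 / 4 + z ^+ 2 / q - y * z = q^-1 * (q * y / 2 - z) ^+ 2)%R.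
  by field; rewrite gt_eqF.
by rewrite mulr_ge0 ?sqr_ge0// invr_ge0 ltW.
Qed.

Lemma cost_conj_fin y : c y%:E \is a fin_num.
Proof. by rewrite ge0_fin_numE ?cost_conj_ge0// (le_lt_trans (cost_conj_le y)) ?ltry. Qed.

Let cs s := conjugate c s%:E.

Let cs_cost s : (0 <= s)%R -> cs s <= (cost A q s)%:E.
Proof.
move=> s0; apply: ge_ereal_sup => _ [y /= y0 <-].
rewrite leeBlDr; last exact: cost_conj_fin.
rewrite -leeBlDl//; apply: ereal_sup_ubound; exists s => //=.
by rewrite -!EFinM mulrC.
Qed.

Let cs_le : {homo cs : s t / (s <= t)%R >-> s <= t}.
Proof.
move=> s t st; apply: ge_ereal_sup => _ [y /= y0 <-].
apply: le_ereal_sup_tmp; exists (t%:E * y%:E - c y%:E); first by exists y.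
by rewrite leeB// -!EFinM lee_fin ler_wpM2r.
Qed.

Let c0E : c 0 = 0.
Proof.
apply/eqP; rewrite eq_le cost_conj_ge0 andbT.
by rewrite (le_trans (cost_conj_le 0))// lee_fin expr0n mulr0 mul0r.
Qed.

Let cs_ge0 s : 0 <= cs s.
Proof. by apply: ereal_sup_ubound; exists 0%R => //=; rewrite mule0 c0E oppe0 adde0. Qed.

Let cs_fin s : cs s \is a fin_num.
Proof.
rewrite ge0_fin_numE ?cs_ge0//.
have [s0|s0] := leP 0%R s; first by rewrite (le_lt_trans (cs_cost s0)) ?ltry.
by rewrite (le_lt_trans (cs_le (ltW s0)))// (le_lt_trans (cs_cost (lexx 0%R))) ?ltry.
Qed.

(** The biconjugate of [cost], real-valued on real arguments. It lies between t^2 / q and [cost],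
    and inherits monotonicity and doubling. *)
Definition conj_cost s : R := fine (conjugate (cost_conj A q) s%:E).

Lemma conj_costE s : conjugate (cost_conj A q) s%:E = (conj_cost s)%:E.
Proof. by rewrite /conj_cost fineK// cs_fin. Qed.

Lemma conj_cost_ge0 s : (0 <= conj_cost s)%R.
Proof. by rewrite fine_ge0// cs_ge0. Qed.

Lemma le_conj_cost : {homo conj_cost : s t / (s <= t)%R}.
Proof. by move=> s t st; rewrite -lee_fin -!conj_costE cs_le. Qed.

Lemma conj_cost_le s : (0 <= s)%R -> (conj_cost s <= cost A q s)%R.
Proof. by move=> s0; rewrite -lee_fin -conj_costE cs_cost. Qed.

(** The supremum is tested at y = 2 s / q, the maximiser of s y - q y^2 / 4. *)
Lemma conj_cost_sqr s : (0 <= s)%R -> (s ^+ 2 / q <= conj_cost s)%R.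
Proof.
move=> s0; rewrite -lee_fin -conj_costE; apply: le_ereal_sup_tmp.
exists (s%:E * (2 * s / q)%:E - c (2 * s / q)%:E).
  by exists (2 * s / q)%R => //=; rewrite divr_ge0 ?mulr_ge0// ltW.
rewrite leeBrDr ?cost_conj_fin//.
apply: (@le_trans _ _ ((s ^+ 2 / q)%:E + (q * (2 * s / q) ^+ 2 / 4)%:E)); first by rewrite leeD2l// cost_conj_le.
rewrite -EFinD -EFinM lee_fin le_eqVlt; apply/orP; left; apply/eqP.
by field; rewrite gt_eqF.
Qed.

(** Doubling passes through two conjugations: cost(2 t) <= M cost(t) gives M c(2 y / M) <= c(y), and
    this returns the same M for the biconjugate. *)
Lemma conj_cost_double : exists2 M : R, (1 <= M)%R &
  forall s, (0 <= s)%R -> (conj_cost (2 * s) <= M * conj_cost s)%R.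
Proof.
have [M M1 MP] := cost_double; exists M => // s s0.
have M0 : (0 < M)%R by rewrite (lt_le_trans _ M1).
rewrite -lee_fin EFinM -!conj_costE.
apply: ge_ereal_sup => _ [y /= y0 <-].
apply: (@le_trans _ _ (M%:E * (s%:E * (2 * y / M)%:E - c (2 * y / M)%:E))); last first.
  rewrite lee_pmul2l ?lte_fin//; apply: ereal_sup_ubound; exists (2 * y / M)%R => //=.
  by rewrite divr_ge0 ?mulr_ge0// ltW.
have cM : M%:E * c (2 * y / M)%:E <= c y%:E.
  rewrite -lee_pdivlMl//; apply: ge_ereal_sup => _ [z /= z0 <-].
  rewrite lee_pdivlMl//; apply: (@le_trans _ _ (y%:E * (2 * z)%:E - (cost A q (2 * z))%:E)).
    change ((M * (2 * y / M * z - cost A q z))%:E <= (y * (2 * z) - cost A q (2 * z))%:E).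
    rewrite lee_fin mulrBr lerB ?MP//.
    by rewrite le_eqVlt; apply/orP; left; apply/eqP; field; rewrite gt_eqF.
  by apply: ereal_sup_ubound; exists (2 * z)%R => //=; rewrite mulr_ge0.
move: cM; rewrite -/c -(fineK (cost_conj_fin (2 * y / M)%R)) -(fineK (cost_conj_fin y)).
set a := fine _; set b := fine _ => cM.
change ((2 * s * y - b)%:E <= (M * (s * (2 * y / M) - a))%:E).
have -> : (M * (s * (2 * y / M) - a) = 2 * s * y - M * a)%R by field; rewrite gt_eqF.
by rewrite lee_fin lerB.
Qed.

Lemma conj_young x s : 0 <= x -> (0 <= s)%R -> x * s%:E <= c x + (conj_cost s)%:E.
Proof.
move=> x0 s0; case: x x0 => [y||//]; last first.
  by rewrite cost_conj_pinfty addye ?leey.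
rewrite lee_fin => y0; rewrite -conj_costE -leeBlDl ?cost_conj_fin//.
by apply: ereal_sup_ubound; exists y => //=; rewrite muleC.
Qed.

(** Write x s = 2^(-n) (x 2^n s): Young's inequality leaves 2^(-n) in front of c(x), and n doublings
    cost M^n on the other term. *)
Lemma conj_young_eps (e : R) : (0 < e)%R -> exists2 C : R, (0 < C)%R &
  forall x s, 0 <= x -> (0 <= s)%R -> x * s%:E <= e%:E * c x + (C * conj_cost s)%:E.
Proof.
move=> e0; have [M M1 MP] := conj_cost_double.
have M0 : (0 < M)%R by rewrite (lt_le_trans _ M1).
pose n := Num.truncn e^-1.
have n2 : (2 ^- n <= e)%R.
  rewrite invf_ple ?posrE ?exprn_gt0// (le_trans (ltW (truncnS_gt _)))// -/n.
  by rewrite -natrX ler_nat; exact: ltn_expl.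
exists (2 ^- n * M ^+ n)%R; first by rewrite mulr_gt0 ?invr_gt0 ?exprn_gt0.
move=> x s x0 s0.
have it m : (conj_cost (2 ^+ m * s) <= M ^+ m * conj_cost s)%R.
  elim: m => [|m IH]; first by rewrite !expr0 !mul1r.
  rewrite !exprS -!mulrA (le_trans (MP _ _))// ?mulr_ge0 ?exprn_ge0//.
  by rewrite ler_wpM2l// ltW.
have s'0 : (0 <= 2 ^+ n * s)%R by rewrite mulr_ge0// exprn_ge0.
have -> : x * s%:E = (2 ^- n)%:E * (x * (2 ^+ n * s)%:E).
  by rewrite muleCA -EFinM mulrA mulVf ?mul1r// expf_neq0// pnatr_eq0.
have n0 : (0 <= 2 ^- n :> R)%R by rewrite invr_ge0 exprn_ge0.
apply: (le_trans (lee_wpmul2l _ (conj_young x0 s'0))); first by rewrite lee_fin.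
rewrite ge0_muleDr ?lee_fin ?cost_conj_ge0 ?conj_cost_ge0//.
rewrite leeD ?lee_wpmul2r ?lee_fin ?cost_conj_ge0//.
by rewrite -mulrA ler_wpM2l.
Qed.

End costs.

(** * Slopes and growth of admissible functions *)

Section growth.
Context {R : realType}.
Variable F : R -> R.
Hypothesis F_adm : admissible F.
Implicit Types y z t : R.

Lemma adm_concaveE t y z : 0 <= t <= 1 -> 0 < y -> 0 < z ->
  t * F y + (1 - t) * F z <= F (t * y + (1 - t) * z).
Proof.
move=> /andP[t0 t1] y0 z0.
have := adm_concave F_adm (Itv01 t0 t1); move=> /(_ y z).
rewrite !inE/= !in_itv/= !andbT => /(_ y0 z0).
move=> h; have : - F (t * y + (1 - t) * z) <= t * (- F y) + (1 - t) * (- F z) by exact: h.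
lra.
Qed.

Lemma adm_le y z : 0 < y -> y <= z -> F y <= F z.
Proof.
move=> y0 yz; have := adm_incr F_adm; move=> /(_ y z).
by rewrite !in_itv/= !andbT => /(_ y0 (lt_le_trans y0 yz) yz).
Qed.

Lemma adm_ge0 y : 1 <= y -> 0 <= F y.
Proof. by move=> y1; rewrite -(adm_one F_adm); exact: adm_le. Qed.


(** Concavity at the point 1 between z and y, where F vanishes, cleared of denominators. *)
Lemma adm_slope y z : 0 < z -> z < 1 -> 1 < y -> (y - 1) * F z + (1 - z) * F y <= 0.
Proof.
move=> z0 z1 y1; have yz : 0 < y - z by rewrite subr_gt0 (lt_trans z1).
have yz0 : y - z != 0 by rewrite gt_eqF.
have t01 : 0 <= (y - 1) / (y - z) <= 1.
  apply/andP; split; first by rewrite divr_ge0 ?subr_ge0// ltW// (lt_trans z1).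
  by rewrite ler_pdivrMr// mul1r lerB// ltW.
have := adm_concaveE t01 z0 (lt_trans ltr01 y1).
have -> : (y - 1) / (y - z) * z + (1 - (y - 1) / (y - z)) * y = 1 by field.
rewrite (adm_one F_adm) => h.
have -> : (y - 1) * F z + (1 - z) * F y = (y - z) * ((y - 1) / (y - z) * F z + (1 - (y - 1) / (y - z)) * F y).
  by field.
by rewrite pmulr_rle0.
Qed.

(** p is the supremum of the slopes F(y) / (y - 1) over y > 1, which every slope over z < 1 bounds
    from above by [adm_slope]; it is nonnegative because F(2) is. *)
Lemma adm_supergradient : exists2 p : R, 0 <= p & forall y, 0 < y -> F y <= p * (y - 1).
Proof.
pose E := [set F y / (y - 1) | y in [set y | 1 < y]].
have E0 : E !=set0 by exists (F 2 / (2 - 1)), 2 => //=; lra.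
have h0 : (0 : R) < 1/2 by lra.
have h1 : (1/2 : R) < 1 by lra.
have ubE z : 0 < z -> z < 1 -> ubound E (F z / (z - 1)).
  move=> z0 z1 _ [y /= y1 <-]; have := adm_slope z0 z1 y1 => h.
  rewrite ler_pdivrMr ?subr_gt0// mulrAC.
  rewrite ler_ndivlMr ?subr_lt0//; lra.
exists (sup E) => [|y y0].
  apply: le_trans (_ : F 2 / (2 - 1) <= _); last first.
    by apply: ub_le_sup; [exists (F (1/2) / (1/2 - 1)); exact: ubE|exists 2 => //=; lra].
  by rewrite divr_ge0// ?adm_ge0//; lra.
have [y1|y1|->] := ltgtP y 1; last by rewrite (adm_one F_adm) subrr mulr0.
  by rewrite -ler_ndivlMr ?subr_lt0//; apply: ge_sup => //; exact: ubE.
rewrite -ler_pdivrMr ?subr_gt0//; apply: ub_le_sup; last by exists y.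
by exists (F (1/2) / (1/2 - 1)); exact: ubE.
Qed.

(** Concavity between 1 and 2 y, taken at y, gives the factor (2 y - 1) / (y - 1), at most 3 once y
    >= 2. *)
Lemma adm_double y : 2 <= y -> F (2 * y) <= 3 * F y.
Proof.
move=> y2; have d0 : 0 < 2 * y - 1 by lra.
have t01 : 0 <= y / (2 * y - 1) <= 1.
  by apply/andP; split; [rewrite divr_ge0//; lra|rewrite ler_pdivrMr//; lra].
have y20 : 0 < 2 * y by lra.
have := adm_concaveE t01 ltr01 y20.
have d1 : 2 * y - 1 != 0 by rewrite gt_eqF.
have -> : y / (2 * y - 1) * 1 + (1 - y / (2 * y - 1)) * (2 * y) = y by field.
have -> : 1 - y / (2 * y - 1) = (y - 1) / (2 * y - 1) by field.
rewrite (adm_one F_adm) mulr0 add0r mulrAC ler_pdivrMr// => h.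
have F0 : 0 <= F (2 * y) by apply: adm_ge0; lra.
have F0' : 0 <= F y by apply: adm_ge0; lra.
nra.
Qed.

(** F is at least 1 at some Y >= 3, and concavity on [1, Y] with F(1) = 0 brings positivity down to
    2. *)
Lemma adm_two_gt0 : 0 < F 2.
Proof.
have /cvgryPge/(_ 1) [M [_ MP]] := adm_infty F_adm.
pose Y := Num.max 3 (M + 1).
have Y3 : 3 <= Y by rewrite le_max lexx.
have FY : 1 <= F Y by apply: MP; rewrite lt_max ltrDl ltr01 orbT.
have d0 : 0 < Y - 1 by lra.
have t01 : 0 <= (Y - 2) / (Y - 1) <= 1.
  by apply/andP; split; [rewrite divr_ge0//; lra|rewrite ler_pdivrMr//; lra].
have Y0 : 0 < Y by lra.
have := adm_concaveE t01 ltr01 Y0.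
have d1 : Y - 1 != 0 by rewrite gt_eqF.
have -> : (Y - 2) / (Y - 1) * 1 + (1 - (Y - 2) / (Y - 1)) * Y = 2 by field.
rewrite (adm_one F_adm) mulr0 add0r; apply: lt_le_trans.
have -> : 1 - (Y - 2) / (Y - 1) = (Y - 1)^-1 by field.
by rewrite mulr_gt0 ?invr_gt0// (lt_le_trans _ FY).
Qed.

(** Near 0 by the limit of y F(y), between h and 1 by monotonicity, beyond 1 by sign. It serves to
    make the left-hand integrand of the theorem integrable. *)
Lemma adm_lower : exists2 b : R, 0 <= b & forall y, 0 < y -> - b <= y * F y.
Proof.
have /cvgrPdist_le/(_ 1 ltr01) [h /= h0 hP] := adm_zero F_adm.
have F1 y : 0 < y -> y < 1 -> F y <= 0 by move=> y0 y1; rewrite -(adm_one F_adm) adm_le// ltW.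
exists (1 + `|F (h / 2)|); first by rewrite addr_ge0.
move=> y y0; have [yh|yh] := ltP y h.
  have := hP y; rewrite /= sub0r normrN gtr0_norm// => /(_ yh y0).
  rewrite sub0r normrN ler_norml => /andP[+ _]; apply: le_trans.
  by rewrite lerN2 lerDl.
have [y1|y1] := leP 1 y.
  apply: (@le_trans _ _ 0); first by rewrite oppr_le0 addr_ge0.
  by rewrite mulr_ge0 ?adm_ge0 ?(ltW y0).
have : F (h / 2) <= F y by apply: adm_le; [rewrite divr_gt0|lra].
have := F1 y y0 y1; have := ler_norm (- F (h / 2)); rewrite normrN; nra.
Qed.

Lemma le_Phi (x : \bar R) y : 0 <= y -> (x * y%:E - (y * F y)%:E + y%:E <= Phi F x)%E.
Proof. by move=> y0; apply: ereal_sup_ubound; exists y. Qed.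

Lemma measurable_adm_fun d (T : measurableType d) (f : T -> R) :
  measurable_fun setT f -> (forall x, 0 <= f x) ->
  measurable_fun setT (fun x => f x * F (f x)).
Proof.
(* [F] may tend to [-oo] at 0, whereas [exp F] extends to a monotone function on the line. *)
move=> mf f0; pose h y := if 0 < y then expR (F y) else 0.
have mh : measurable_fun setT h.
  apply: nondecreasing_measurable => // y z yz; rewrite /h.
  case: ifPn => [y0|_]; last by case: ifP => // _; exact: expR_ge0.
  by rewrite (lt_le_trans y0 yz) ler_expR adm_le.
apply: (@eq_measurable_fun _ _ _ _ _ (fun x => f x * ln (h (f x)))) => [x _|].
  have := f0 x; rewrite le_eqVlt => /predU1P[<-|fx0]; first by rewrite !mul0r.
  by rewrite /h fx0 expRK.
apply: measurable_funM => //; apply: measurableT_comp; last exact: measurableT_comp.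
exact: measurable_ln.
Qed.


End growth.

(** * Quantiles of the radius *)

Section monotone_limits.
Context d (T : measurableType d) (R : realType).
Variables (mu : {measure set T -> \bar R}) (G : (set T)^nat).
Hypothesis mG : forall n, measurable (G n).

Lemma measure_bigcup_le (e : \bar R) : (forall n m, (n <= m)%N -> G n `<=` G m) ->
  (forall n, mu (G n) <= e)%E -> (mu (\bigcup_n G n) <= e)%E.
Proof.
move=> nG Ge.
have h : mu (G n) @[n --> \oo] --> mu (\bigcup_n G n).
  apply: nondecreasing_cvg_mu => //; first exact: bigcupT_measurable.
  by move=> n m nm; apply/subsetPset; exact: nG.
rewrite -(cvg_lim _ h)//; apply: lime_le; first by apply/cvg_ex; exists (mu (\bigcup_n G n)).
by apply: nearW => n; exact: Ge.
Qed.

Lemma measure_bigcap_ge (e : \bar R) : (mu (G 0%N) < +oo)%E ->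
  (forall n m, (n <= m)%N -> G m `<=` G n) ->
  (forall n, e <= mu (G n))%E -> (e <= mu (\bigcap_n G n))%E.
Proof.
move=> G0 nG Ge.
have h : mu (G n) @[n --> \oo] --> mu (\bigcap_n G n).
  apply: nonincreasing_cvg_mu => //; first exact: bigcapT_measurable.
  by move=> n m nm; apply/subsetPset; exact: nG.
rewrite -(cvg_lim _ h)//; apply: lime_ge; first by apply/cvg_ex; exists (mu (\bigcap_n G n)).
by apply: nearW => n; exact: Ge.
Qed.

End monotone_limits.

Section quantile.
Context {R : realType} {d : nat} (mu : probability 'rV[R]_d R).
Hypotheses (hd : (0 < d)%N) (mu_ac : mu `<< lebesgue_outer).
Variable rad : R.
Hypothesis rad0 : 0 < rad.

(** The mass of balls is right-continuous by intersection and left-continuous because spheres are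
    null, so the infimum of the radii with mass at least z has mass exactly z. *)
Lemma eball_quantile z : (mu (eball rad) < z%:E)%E -> z < 1 ->
  exists r, rad < r /\ mu (eball r) = z%:E.
Proof.
move=> zrad z1; pose E := [set r | (z%:E <= mu (eball r))%E].
have le_mu r r' : r <= r' -> (mu (eball r) <= mu (eball r'))%E.
  move=> rr'; apply: le_measure; rewrite ?inE; try exact: measurable_eball.
  by move=> x /le_trans; apply.
have E0 : E !=set0.
  apply: contrapT => /nonemptyPn E0.
  have : (mu (\bigcup_n eball n%:R) <= z%:E)%E.
    apply: measure_bigcup_le => [n|n m nm x /= xn|n]; first exact: measurable_eball.
      by apply: (le_trans xn); rewrite ler_nat.
    rewrite leNgt; apply/negP => h; have : E n%:R by exact: ltW.
    by rewrite E0.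
  rewrite (_ : \bigcup_n _ = setT) ?probability_setT ?lee_fin ?leNgt ?z1//.
  apply/seteqP; split=> // x _; exists (Num.truncn (enorm x)).+1 => //=.
  exact: ltW (truncnS_gt _).
have lbE : lbound E rad.
  move=> r /= zr; rewrite leNgt; apply/negP => /ltW/le_mu.
  by move=> /(le_trans zr); rewrite leNgt zrad.
have hE : has_inf E by split=> //; exists rad.
pose r0 := inf E.
have zr0 : (z%:E <= mu (eball r0))%E.
  have -> : eball r0 = \bigcap_n eball (r0 + n.+1%:R^-1) :> set 'rV[R]_d.
    apply/seteqP; split=> [x /= xr n _ /=|x h /=].
      by apply: (le_trans xr); rewrite lerDl invr_ge0.
    apply/ler_addgt0Pr => e e0; have := h (Num.truncn e^-1) I => /= /le_trans; apply.
    rewrite lerD2l invf_ple ?posrE//; exact: ltW (truncnS_gt _).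
  apply: measure_bigcap_ge => [n||n m nm x /= xn|n].
  - exact: measurable_eball.
  - by rewrite (le_lt_trans (probability_le1 _ _)) ?ltry//; exact: measurable_eball.
  - by apply: (le_trans xn); rewrite lerD2l lef_pV2 ?posrE// ler_nat.
  - have e0 : 0 < n.+1%:R^-1 :> R by rewrite invr_gt0.
    have [r Er rr] := inf_adherent e0 hE.
    exact: le_trans Er (le_mu _ _ (ltW rr)).
have r0rad : rad < r0.
  rewrite ltNge; apply/negP => /le_mu /(le_trans zr0).
  by rewrite leNgt zrad.
exists r0; split=> //; apply/eqP; rewrite eq_le zr0 andbT.
have mo : measurable [set x : 'rV[R]_d | enorm x < r0].
  rewrite (_ : [set x | _] = ~` [set x | r0 <= enorm x]); last first.
    by apply/seteqP; split=> x /=; rewrite ltNge => /negP.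
  by apply: measurableC; apply: closed_measurable_rV; apply: closed_ge; exact: enorm_continuous.
have ms : measurable [set x : 'rV[R]_d | enorm x = r0].
  rewrite (_ : [set x | _] = eball r0 `\` [set x | enorm x < r0]).
    by apply: measurableD => //; exact: measurable_eball.
  apply/seteqP; split=> x /=; first by rewrite /eball/= => ->; rewrite ltxx lexx.
  by move=> [xr /negP]; rewrite -leNgt => rx; apply/eqP; rewrite eq_le rx xr.
have -> : eball r0 = [set x | enorm x < r0] `|` [set x | enorm x = r0] :> set 'rV[R]_d.
  apply/seteqP; split=> x /=; rewrite /eball/=; first by rewrite le_eqVlt => /predU1P[->|->]; [right|left].
  by move=> [/ltW//|->].
apply: (le_trans (measureU2 _ _ _)) => //=.
rewrite (_ : mu [set x | enorm x = r0] = 0%E) ?adde0; last first.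
  by apply: sphere_null => //; rewrite (lt_trans rad0).
have -> : [set x : 'rV[R]_d | enorm x < r0] = \bigcup_n eball (r0 - n.+1%:R^-1).
  apply/seteqP; split=> [x /= xr|x [n _ /= /le_lt_trans]]; last first.
    by apply; rewrite gtrBl invr_gt0.
  exists (Num.truncn (r0 - enorm x)^-1) => //=.
  rewrite /eball/= lerBrDr -lerBrDl invf_ple ?posrE ?subr_gt0//.
  exact: ltW (truncnS_gt _).
apply: measure_bigcup_le => [n|n m nm x /= xn|n].
- exact: measurable_eball.
- by apply: (le_trans xn); rewrite lerD2l lerN2 lef_pV2 ?posrE// ler_nat.
- rewrite leNgt; apply/negP => /ltW h.
  have : r0 <= r0 - n.+1%:R^-1 by apply: ge_inf => //; exists rad.
  by rewrite lerBrDr gerDl leNgt invr_gt0 ltr0n.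
Qed.

(** Several radii may carry the same mass; equal arguments get the same one, so monotonicity
    survives the choice. The value [rad] for small z extends monotonicity to all z < 1. *)
Definition quantile z : R :=
  if (mu (eball rad) < z%:E)%E then xget 0 [set r | rad < r /\ mu (eball r) = z%:E] else rad.

Lemma quantileP z : (mu (eball rad) < z%:E)%E -> z < 1 ->
  rad < quantile z /\ mu (eball (quantile z)) = z%:E.
Proof.
move=> zrad z1; rewrite /quantile zrad.
by have := xgetPex 0 (eball_quantile zrad z1).
Qed.

Lemma le_quantile z z' : z <= z' -> z' < 1 -> quantile z <= quantile z'.
Proof.
move=> zz' z'1; have [zrad|zrad] := boolP (mu (eball rad) < z%:E)%E; last first.
  rewrite {1}/quantile (negbTE zrad).
  have [z'rad|z'rad] := boolP (mu (eball rad) < z'%:E)%E; last by rewrite /quantile (negbTE z'rad).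
  by have [/ltW] := quantileP z'rad z'1.
have z'rad : (mu (eball rad) < z'%:E)%E by rewrite (lt_le_trans zrad)// lee_fin.
have [_ qz] := quantileP zrad (le_lt_trans zz' z'1).
have [_ qz'] := quantileP z'rad z'1.
move: zz'; rewrite le_eqVlt => /predU1P[->//|zz'].
rewrite leNgt; apply/negP => /ltW qq.
have : (mu (eball (quantile z')) <= mu (eball (quantile z)))%E.
  apply: le_measure; rewrite ?inE; try exact: measurable_eball.
  by move=> x /le_trans; apply.
by rewrite qz qz' lee_fin leNgt zz'.
Qed.

End quantile.

(** * Inversion of Young's inequality *)

Section perspective.
Context {R : realType}.
Variables (A q C : R).
Hypotheses (A0 : 0 < A) (q2 : 2 <= q) (C0 : 0 < C).

(* The inverse of the dual Young bound: the largest [i] with [i t <= w + C c*(t)] for all [t]. *)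
Definition young_inv (w : R) : R :=
  inf [set (Num.max w 0 + C * conj_cost A q t) / t | t in [set t : R | 0 < t]].

Let w0 (w t : R) : 0 < t -> 0 <= (Num.max w 0 + C * conj_cost A q t) / t.
Proof.
move=> t0; rewrite divr_ge0 ?(ltW t0)// addr_ge0 ?le_max ?lexx ?orbT//.
by rewrite mulr_ge0 ?(ltW C0)//; exact: conj_cost_ge0.
Qed.

Let has_inf_young w : has_inf [set (Num.max w 0 + C * conj_cost A q t) / t | t in [set t : R | 0 < t]].
Proof.
split; first by exists ((Num.max w 0 + C * conj_cost A q 1) / 1); exists 1 => //=.
by exists 0 => _ [t /= t0 <-]; exact: w0.
Qed.

Lemma young_inv_le w t : 0 <= t -> young_inv w * t <= Num.max w 0 + C * conj_cost A q t.
Proof.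
rewrite le_eqVlt => /predU1P[<-|t0].
  rewrite mulr0 addr_ge0 ?le_max ?lexx ?orbT//.
  by rewrite mulr_ge0 ?(ltW C0)//; exact: conj_cost_ge0.
rewrite -ler_pdivlMr//; apply: ge_inf; last by exists t.
by have [] := has_inf_young w.
Qed.

Lemma young_inv_ge w i : (forall t, 0 < t -> i * t <= Num.max w 0 + C * conj_cost A q t) ->
  i <= young_inv w.
Proof.
move=> iP; apply: lb_le_inf; first by have [] := has_inf_young w.
by move=> _ [t /= t0 <-]; rewrite ler_pdivlMr// iP.
Qed.

(** Monotone on the whole line thanks to [Num.max w 0], hence measurable. *)
Lemma le_young_inv : {homo young_inv : w w' / w <= w'}.
Proof.
move=> w w' ww'; apply: young_inv_ge => t t0.
apply: (le_trans (young_inv_le w (ltW t0))); rewrite lerD2r.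
by rewrite ge_max !le_max ww' lexx !orbT.
Qed.

(** By the quadratic lower bound on the conjugate cost and w + (C/q) t^2 >= 2 t sqrt(w C / q).
    Positivity permits division by this quantity. *)
Lemma young_inv_gt0 w : 0 < w -> 0 < young_inv w.
Proof.
move=> w1; have q0 : 0 < q by rewrite (lt_le_trans _ q2).
have Cq : 0 < C / q by rewrite divr_gt0.
apply: (@lt_le_trans _ _ (2 * Num.sqrt w * Num.sqrt (C / q))).
  by rewrite !mulr_gt0// sqrtr_gt0.
apply: young_inv_ge => t t0.
have h1 := conj_cost_sqr A0 q2 (ltW t0).
apply: (@le_trans _ _ (w + C / q * t ^+ 2)).
  have := sqr_ge0 (Num.sqrt w - Num.sqrt (C / q) * t).
  rewrite sqrrB exprMn !sqr_sqrtr ?(ltW w1) ?(ltW Cq)//; lra.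
apply: lerD; first by rewrite le_max lexx.
by rewrite mulrAC -mulrA ler_wpM2l// ltW.
Qed.

End perspective.

(** * One dyadic layer *)

Section perimeter.
Context {R : realType} {d : nat} (mu : probability 'rV[R]_d R).

Lemma mu_plus_ge0 (S : set 'rV[R]_d) : measurable S -> (0 <= mu_plus mu S)%E.
Proof.
move=> mS; rewrite /mu_plus limf_einfE; apply: le_ereal_sup_tmp.
exists (ereal_inf [set ((mu (enlargement S h) - mu S) * (h^-1)%:E)%E | h in [set h : R | 0 < h]]).
  exists [set h : R | 0 < h] => //=; exact: nbhs_right_gt.
apply: le_ereal_inf_tmp => _ [h /= h0 <-].
rewrite mule_ge0 ?lee_fin ?invr_ge0 ?(ltW h0)//.
rewrite sube_ge0 ?fin_num_measure//; last exact: measurable_enlargement.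
apply: le_measure; rewrite ?inE//; first exact: measurable_enlargement.
by apply: sub_enlargement; exact: ltW.
Qed.

Lemma isop_ge (F : R -> R) (r : R) (S : set 'rV[R]_d) : measurable S ->
  mu S = (1 - mu (eball r))%E -> (0 < mu S)%E ->
  ((fine (mu S) * F (1 / fine (mu S)))%:E / mu_plus mu S <= isop mu F r)%E.
Proof.
move=> mS SE S0; rewrite /isop.
have -> : (Defs.radius (supp mu) <= r%:E)%E = false.
  apply/negbTE; rewrite -ltNge; apply: radius_supp_lt.
  by rewrite probability_setC -?SE//; exact: measurable_eball.
by apply: ereal_sup_ubound; exists S.
Qed.

Lemma isop_ge0 (F : R -> R) (r : R) (S : set 'rV[R]_d) : measurable S ->
  mu S = (1 - mu (eball r))%E -> (0 < mu S)%E ->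
  0 <= F (1 / fine (mu S)) -> (0 <= isop mu F r)%E.
Proof.
move=> mS SE S0 F0; apply: le_trans (isop_ge F mS SE S0).
by rewrite mule_ge0 ?inve_ge0 ?mu_plus_ge0// lee_fin mulr_ge0// fine_ge0.
Qed.

(** The isoperimetric function read as a lower bound on the perimeter. A zero perimeter is
    impossible: the quotient inside [isop] would be +oo, above i. *)
Lemma isop_mu_plus (F : R -> R) (r i y : R) (S : set 'rV[R]_d) : measurable S ->
  mu S = (1 - mu (eball r))%E -> (0 < mu S)%E ->
  0 < y <= fine (mu S) * F (1 / fine (mu S)) -> 0 < i -> (isop mu F r <= i%:E)%E ->
  ((y / i)%:E <= mu_plus mu S)%E.
Proof.
move=> mS SE S0 /andP[y0 yF] i0 /(le_trans (isop_ge F mS SE S0)).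
set Y := _ * _ in yF *; have Y0 : 0 < Y := lt_le_trans y0 yF.
have := mu_plus_ge0 mS; case: (mu_plus mu S) => [p||]; rewrite ?lee_fin ?leey//.
rewrite le_eqVlt => /predU1P[<-|p0].
  by rewrite inve0 gt0_muley ?lte_fin// leye_eq.
rewrite inver gt_eqF// -EFinM !lee_fin !ler_pdivrMr//; lra.
Qed.

End perimeter.

Lemma measurable_fun_inv d (T : measurableType d) (R : realType) (D : set T) (f : T -> R) :
  measurable_fun D f -> (forall x, 0 <= f x) -> measurable_fun D (fun x => (f x)^-1).
Proof.
move=> mf f0; apply: (@eq_measurable_fun _ _ _ _ _ (fun x => f x `^ (-1))).
  by move=> x _; rewrite powR_inv1.
exact: (measurableT_comp (measurable_powR (-1))).
Qed.

Lemma markov_le d (T : measurableType d) (R : realType) (mu : probability T R) (g : T -> R)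
    (t : R) (S : set T) :
  measurable_fun setT g -> (forall x, 0 <= g x) -> (\int[mu]_x (g x)%:E <= 1)%E ->
  measurable S -> (forall x, S x -> t <= g x) -> 0 < t -> fine (mu S) <= t^-1.
Proof.
move=> mg g0 g1 mS Sg t0; rewrite -[leRHS]mul1r ler_pdivlMr// mulrC -lee_fin EFinM.
rewrite fineK ?fin_num_measure//; apply: le_trans g1; rewrite -integral_cst//.
apply: (@le_trans _ _ (\int[mu]_(x in S) (g x)%:E)%E).
  apply: ge0_le_integral => //; first by move=> x _; rewrite lee_fin ltW.
  by apply/measurable_EFinP; exact: measurable_funTS.
apply: ge0_subset_integral => //; first exact/measurable_EFinP.
by move=> x _; rewrite lee_fin.
Qed.

Lemma measurable_set_itv d (T : measurableType d) (R : realType) (g : T -> R)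
    (i : interval R) (P : pred T) :
  measurable_fun setT g -> (forall x, P x = (g x \in i)) -> measurable [set x | P x].
Proof.
move=> mg PE; rewrite (_ : [set x | P x] = setT `&` g @^-1` [set` i]).
  by apply: mg => //; exact: measurable_itv.
by rewrite setTI; apply/seteqP; split=> x /=; rewrite PE.
Qed.

Section levels.
Context d (T : measurableType d) (R : realType) (mu : probability T R).
Variable g : T -> R.
Hypothesis mg : measurable_fun setT g.
Let LT := measurableTypeR R.
Let B : set (T * LT) := [set z | g z.1 = z.2].

Let mB : measurable B.
Proof.
have m1 : measurable_fun setT (fun z : T * LT => g z.1) by exact: measurableT_comp.
have m2 : measurable_fun setT (fun z : T * LT => (z.2 : R)) by exact: measurable_snd.
have := measurable_fun_eqr m1 m2 => /(_ measurableT [set true] I).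
by rewrite setTI; congr measurable; apply/seteqP; split=> z /= /eqP.
Qed.

(** Masses of levels are masses of sections of the graph of g; Tonelli's theorem on this graph, each
    point lying on a single level, shows that almost every level is null. *)
Let levelE t : mu (g @^-1` [set t]) = (mu \o ysection B) t.
Proof. by rewrite /=; congr (mu _); apply/seteqP; split=> x; rewrite /ysection/= inE. Qed.

Lemma measurable_level_measure : measurable_fun setT (fun t : LT => mu (g @^-1` [set t])).
Proof. under eq_fun do rewrite levelE; exact: measurable_fun_ysection. Qed.

Lemma level_null (E : set LT) : measurable E ->
  (forall t, E t -> 0 < mu (g @^-1` [set t]))%E -> lebesgue_measure E = 0%E.
Proof.
move=> mE E0.
have I0 : (\int[lebesgue_measure]_(t in (setT : set LT)) mu (g @^-1` [set t]) = 0)%E.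
  pose f (z : T * LT) : \bar R := (\1_B z)%:E.
  have mf : measurable_fun setT f by apply/measurable_EFinP; exact: measurable_indic.
  have f0 z : (0 <= f z)%E by rewrite lee_fin.
  transitivity (\int[lebesgue_measure]_t \int[mu]_x f (x, t))%E.
    apply: eq_integral => t _.
    transitivity (\int[mu]_x (\1_(g @^-1` [set t]) x)%:E)%E; last by [].
    by rewrite integral_indic ?setIT// -[X in measurable X]setTI; exact: mg.
  rewrite -(fubini_tonelli f mf f0) integral0_eq// => x _.
  transitivity (\int[lebesgue_measure]_(t in (setT : set LT)) (\1_([set g x] : set LT) t)%:E)%E.
    by apply: eq_integral => t _; rewrite /f !indicE; congr ((nat_of_bool _)%:R%:E); apply/idP/idP; rewrite !inE => ->.
  have ms : measurable ([set g x] : set LT) by exact: measurable_set1.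
  by apply: (etrans (integral_indic _ measurableT ms)); rewrite setIT; exact: lebesgue_measure_set1.
have m0 := measurable_level_measure.
have : (\int[lebesgue_measure]_(t in E) `|mu (g @^-1` [set t])| = 0)%E.
  apply/eqP; rewrite eq_le integral_ge0 ?andbT// -I0.
  under eq_integral do rewrite gee0_abs//.
  by apply: ge0_subset_integral.
move=> /(ae_eq_integral_abs _ mE (measurable_funTS m0))[M [mM M0 EM]].
apply: (subset_measure0 _ _ _ M0) => // t Et; apply: EM => /= /(_ Et) h.
by have := E0 t Et; rewrite h ltxx.
Qed.

End levels.

(** * The estimate for the levels between s and 2 s *)

Section layer.
Context {R : realType} {d : nat} (mu : probability 'rV[R]_d R).
Hypotheses (hd : (0 < d)%N) (mu_ac : mu `<< lebesgue_outer).
Variables (F : R -> R) (A q K rad lambda : R).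
Hypotheses (F_adm : admissible F) (A0 : 0 < A) (q2 : 2 <= q) (K2 : 2 <= K).
Hypotheses (rad0 : 0 < rad) (radE : mu (eball rad) = ((K - 1) / K)%:E).
Hypothesis lambda0 : 0 < lambda.
Hypothesis Poincare : forall f : 'rV[R]_d -> R, smooth f ->
  (\int[mu]_x ((f x - median mu f) ^+ 2)%:E <=
     lambda%:E * \int[mu]_x (enorm (grad f x) ^+ 2)%:E)%E.

Let c := cost_conj A q.
Let V (r : R) : \bar R := Phi F (4%:E * c (isop mu F r))%E.
Hypothesis HV : mu.-integrable (~` eball rad) (fun x => V (enorm x)).

Variables (g : 'rV[R]_d -> R) (s N : R).
Hypotheses (sg : smooth g) (g0 : forall x, 0 <= g x) (g1 : (\int[mu]_x (g x)%:E <= 1)%E).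
Hypotheses (Ks : K <= s) (gN : forall x, s <= g x -> enorm x <= N).

Let a : R := fine (mu [set x | s < g x]).
Let a' : R := fine (mu [set x | 2 * s < g x]).
Hypothesis a'0 : 0 < a'.

Let LT := measurableTypeR R.
Let K0 : 0 < K. Proof. by rewrite (lt_le_trans _ K2). Qed.
Let s0 : 0 < s. Proof. exact: lt_le_trans Ks. Qed.
Let cg : continuous g. Proof. exact: smooth_continuous. Qed.

Let mgt t : measurable [set x | t < g x].
Proof. exact: measurable_gt_rV. Qed.

Let mge t : measurable [set x | t <= g x].
Proof. by apply: closed_measurable_rV; exact: closed_ge. Qed.

Let muf (S : set 'rV[R]_d) : measurable S -> (fine (mu S))%:E = mu S.
Proof. by move=> mS; rewrite fineK// fin_num_measure. Qed.

Let m t : R := fine (mu [set x | t <= g x]).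
Let mE t : (m t)%:E = mu [set x | t <= g x]. Proof. exact: muf. Qed.

Let mgS : measurable_fun setT g.
Proof. exact: continuous_measurable_rV. Qed.

Let m_anti t t' : t <= t' -> m t' <= m t.
Proof.
move=> tt'; rewrite -lee_fin !mE le_measure ?inE//.
by move=> x /=; exact: le_trans.
Qed.

Let m_markov t : 0 < t -> m t <= t^-1.
Proof. by move=> t0; apply: (markov_le mgS g0 g1). Qed.

Let m_gt t : s < t -> m t <= a.
Proof.
move=> st; rewrite -lee_fin mE muf// le_measure ?inE//.
by move=> x /=; exact: lt_le_trans.
Qed.

Let m_lt t : t <= 2 * s -> a' <= m t.
Proof.
move=> ts; rewrite -lee_fin mE muf// le_measure ?inE//.
by move=> x /= /ltW; exact: le_trans.
Qed.

Let a'a : a' <= a.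
Proof. by rewrite (le_trans (m_lt (lexx _)))// m_gt//; have := s0; lra. Qed.

Let a1 : a <= K^-1.
Proof.
apply: (@le_trans _ _ (m s)); last first.
  by rewrite (le_trans (m_markov s0))// lef_pV2 ?posrE.
rewrite -lee_fin mE muf// le_measure ?inE//; by move=> x /= /ltW.
Qed.

Let Fa m' : 0 < m' -> m' <= a -> F 2 <= F (1 / a) /\ F (1 / a) <= F (1 / m').
Proof.
move=> m0 ma; have a0 : 0 < a := lt_le_trans m0 ma.
split; apply: adm_le => //; rewrite ?divr_gt0// !div1r.
  by rewrite (le_trans K2)// -[K]invrK lef_pV2 ?posrE ?invr_gt0.
by rewrite lef_pV2 ?posrE.
Qed.

Let quant := quantile mu rad.
(** The radius of the ball with complementary mass. The cap at 2 s keeps the argument at most 1 - a'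
    < 1, so r is monotone, hence measurable, on the whole line. *)
Let r t := quant (1 - m (Num.min t (2 * s))).

Let z1 t : 1 - m (Num.min t (2 * s)) < 1.
Proof.
rewrite gtrBl (lt_le_trans a'0)//; apply: m_lt.
by rewrite ge_min lexx orbT.
Qed.

Let mr : measurable_fun setT (r : LT -> R).
Proof.
apply: nondecreasing_measurable => // t t' tt'; apply: le_quantile => //.
rewrite lerD2l lerN2; apply: m_anti.
by rewrite le_min !ge_min tt' lexx !orbT.
Qed.

(** Markov's inequality gives m t <= 1/t < 1/K, which places r t beyond [rad], where V is under
    control. *)
Let rP t : s < t -> t < 2 * s -> rad < r t /\ mu (eball (r t)) = (1 - mu [set x | (t <= g x)%R])%E.
Proof.
move=> st ts; rewrite /r min_l ?(ltW ts)//.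
rewrite -mE -EFinB; apply: quantileP => //; last by have := m_lt (ltW ts); have := a'0; lra.
rewrite radE lte_fin mulrBl mul1r divff ?gt_eqF// ltrD2l ltrN2.
have t0 : 0 < t by rewrite (lt_trans s0).
rewrite (le_lt_trans (m_markov t0))// ltf_pV2 ?posrE//.
exact: le_lt_trans st.
Qed.

(** Recovered from the measurability of V(|x|) by restriction to a coordinate ray. *)
Let mV : measurable_fun setT (V \_ `]rad, +oo[ : LT -> \bar R).
Proof.
apply/(measurable_restrictT _ _).1 => //.
pose v : LT -> 'rV[R]_d := fun t => t *: delta_mx 0 (Ordinal hd).
have ev t : rad < t -> enorm (v t) = t.
  move=> rt; rewrite /v enormZ gtr0_norm ?(lt_trans rad0)//.
  rewrite /enorm (bigD1 (Ordinal hd))//= mxE !eqxx expr1n big1 ?addr0 ?sqrtr1 ?mulr1// => i /negbTE ni.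
  by rewrite mxE ni andbF expr0n.
have mv : measurable_fun setT v.
  apply: (@measurability _ _ _ _ setT v (@open 'rV[R]_d)) => // _ [U oU <-].
  rewrite setTI; apply: (@open_measurable R) => //.
  apply: open_comp => // t _; exact: scalel_continuous.
have mVe := measurable_int _ HV.
apply: (@eq_measurable_fun _ _ _ _ _ ((fun x => V (enorm x)) \o v)).
  by move=> t; rewrite inE/= in_itv/= andbT => rt; rewrite ev.
apply: measurable_comp mVe _; first by apply: measurableC; exact: measurable_eball.
  by move=> y [t /= + <-]; rewrite in_itv/= andbT => rt; apply/negP; rewrite -ltNge ev.
exact: measurable_funTS.
Qed.

Let Vr := V \_ `]rad, +oo[.

Let V0 t : (0 <= V t)%E.
Proof.
by apply: le_trans (le_Phi F _ (lexx 0)); rewrite mule0 mul0r oppe0 !adde0.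
Qed.

Let Vr0 t : (0 <= Vr t)%E.
Proof. by rewrite /Vr patchE; case: ifP. Qed.

Definition tail_int : R := fine (\int[mu]_(x in ~` eball rad) V (enorm x)).

Let tail_intE : (\int[mu]_(x in ~` eball rad) V (enorm x) = tail_int%:E)%E.
Proof. by rewrite /tail_int fineK// integrable_fin_num//; apply: measurableC; exact: measurable_eball. Qed.

Let mu_tail : (\int[mu]_x Vr (enorm x) = tail_int%:E)%E.
Proof.
rewrite -tail_intE [RHS]integral_mkcond; apply: eq_integral => x _.
rewrite /Vr !patchE; congr (if _ then _ else _).
by apply/idP/idP; rewrite !inE/= in_itv/= andbT ltNge => /negP.
Qed.

(** Levels carrying mass are discarded so that extreme levels contribute nothing in [law_le];
    [level_null] shows that almost every level is kept. *)
Let E0 := [set t | (s < t < 2 * s)%R /\ mu (g @^-1` [set t]) = 0%E].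

Let mE0 : measurable (E0 : set LT).
Proof.
rewrite (_ : E0 = `]s, 2 * s[%classic `&` ((fun t : LT => mu (g @^-1` [set t])) @^-1` [set 0%E])).
  apply: measurableI => //; rewrite -[X in measurable X]setTI.
  by apply: measurable_level_measure.
by apply/seteqP; split=> t; rewrite /E0/= in_itv.
Qed.

Let mgE (E : set LT) : measurable E -> measurable (g @^-1` E).
Proof. by move=> mE'; rewrite -[X in measurable X]setTI; exact: mgS. Qed.

Let ball t : R := fine (mu (eball t)).
Let ballE t : (ball t)%:E = mu (eball t). Proof. by rewrite muf//; exact: measurable_eball. Qed.

Let shell_measurable (u v : R) : measurable [set x : 'rV[R]_d | u < enorm x <= v].
Proof.
have ce : measurable_fun setT (@enorm R d) by apply: continuous_measurable_rV; exact: enorm_continuous.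
by apply: (measurable_set_itv (i := `]u, v]) ce) => x; rewrite in_itv.
Qed.

Let mco u v : measurable [set x | u <= g x < v].
Proof. by apply: (measurable_set_itv (i := `[u, v[) mgS) => x; rewrite in_itv. Qed.

(** The left side is m p - m p', which is the mass of the ball of radius r p' minus that of radius r
    p; the first lies in B_v and the second contains B_u. *)
Let slab_le u v p p' : s < p -> p < p' -> p' < 2 * s -> u < r p -> r p' <= v ->
  (mu [set x | (p <= g x < p')%R] <= mu [set x | (u < enorm x <= v)%R])%E.
Proof.
move=> sp pp' p's urp rpv.
have mslab := mco p p'.
have [_ bp] := rP sp (lt_trans pp' p's).
have [_ bp'] := rP (lt_trans sp pp') p's.
have /eqP : m p = fine (mu [set x | p <= g x < p']) + m p'.
  apply/EFin_inj; rewrite EFinD !mE muf// -measureU//.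
    congr (mu _); apply/seteqP; split=> x /=.
      by move=> ->; have [] := ltP (g x) p'; [left|right].
    by move=> [/andP[]//|]; exact: le_trans (ltW pp').
  by apply/seteqP; split=> x //= -[/andP[_ +]]; rewrite ltNge => /negP.
have le_ball w w' : w <= w' -> ball w <= ball w'.
  move=> ww'; rewrite -lee_fin !ballE le_measure ?inE; try exact: measurable_eball.
    by [].
  by move=> x /le_trans; apply.
have uv : u <= v.
  rewrite (le_trans (ltW urp))// (le_trans _ rpv)//; apply: le_quantile => //.
  by rewrite lerD2l lerN2; apply: m_anti; rewrite le_min !ge_min (ltW pp') lexx !orbT.
have : ball v = fine (mu [set x : 'rV[R]_d | u < enorm x <= v]) + ball u.
  apply/EFin_inj; rewrite EFinD !ballE muf// -measureU//.
  - congr (mu _); apply/seteqP; split=> x; rewrite /eball/=.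
      by move=> ->; rewrite andbT; have [] := ltP u (enorm x); [left|right].
    by move=> [/andP[]//|]; move/le_trans; apply.
  - exact: measurable_eball.
  - by apply/seteqP; split=> x //= -[/andP[+ _]]; rewrite /eball/= ltNge => /negP.
have : ball (r p) = 1 - m p by apply/EFin_inj; rewrite EFinB ballE mE.
have : ball (r p') = 1 - m p' by apply/EFin_inj; rewrite EFinB ballE mE.
have := le_ball _ _ (ltW urp); have := le_ball _ _ rpv.
rewrite -(muf mslab) -(muf (shell_measurable u v)) lee_fin; by move=> h1 h2 h3 h4 h5 /eqP h6; lra.
Qed.

(** The set T of levels lies between its infimum and its supremum. Each slab [D n] strictly inside
    is contained in one whose ends p, p' belong to T, where [slab_le] applies; the two extreme
    levels are null by the choice of [E0]. *)
Let law_le u v : u < v ->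
  (mu (g @^-1` (E0 `&` r @^-1` `]u, v])) <= mu [set x | (u < enorm x <= v)%R])%E.
Proof.
move=> uv; pose T := E0 `&` r @^-1` `]u, v].
have mT : measurable (T : set LT).
  by apply: measurableI => //; rewrite -[X in measurable X]setTI; exact: mr.
have [T0|/set0P T0] := eqVneq T set0.
  by rewrite -/T T0 preimage_set0 measure0.
have Tb t : T t -> s < t < 2 * s by move=> [[]].
have hi : has_inf T by split=> //; exists s => t /Tb/andP[/ltW].
have hs : has_sup T by split=> //; exists (2 * s) => t /Tb/andP[_ /ltW].
pose t1 := inf T; pose t2 := sup T.
pose D n := [set x | t1 + n.+1%:R^-1 <= g x < t2 - n.+1%:R^-1].
pose Z t := g @^-1` (E0 `&` [set t]).
have mZ t : measurable (Z t) by apply: mgE; exact: measurableI.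
have Z0 t : mu (Z t) = 0%E.
  have [[_ Et]|Et] := pselect (E0 t).
    apply: (subset_measure0 _ _ _ Et) => //; last by move=> x [].
    by apply: mgE.
  by rewrite (_ : Z t = set0) ?measure0//; apply/seteqP; split=> x //=; rewrite /Z/= => -[+ gx]; rewrite gx.
have e0 n : 0 < n.+1%:R^-1 :> R by rewrite invr_gt0.
have mD n : measurable (D n) by exact: mco.
have DU : (mu (\bigcup_n D n) <= mu [set x | (u < enorm x <= v)%R])%E.
  apply: measure_bigcup_le => // [n k nk x /andP[x1 x2]|n].
    have : k.+1%:R^-1 <= n.+1%:R^-1 :> R by rewrite lef_pV2 ?posrE// ler_nat.
    by move=> kn; apply/andP; split; [apply: le_trans x1; rewrite lerD2l|apply: lt_le_trans x2 _; rewrite lerD2l lerN2].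
  have [p Tp pt] := inf_adherent (e0 n) hi.
  have [p' Tp' pt'] := sup_adherent (e0 n) hs.
  have [pp'|p'p] := ltP p p'; last first.
    rewrite (_ : D n = set0) ?measure0//; apply/seteqP; split=> x //= /andP[x1 x2].
    by move: x1 x2 pt pt' p'p; rewrite -/t1 -/t2; move: (n.+1%:R^-1) => e; lra.
  apply: (@le_trans _ _ (mu [set x | (p <= g x < p')%R])).
    apply: le_measure; rewrite ?inE//.
    move=> x /= /andP[x1 x2]; apply/andP; split.
      by rewrite (le_trans _ x1)// ltW.
    by rewrite (lt_trans x2).
  have /andP[sp _] := Tb _ Tp; have /andP[_ p's] := Tb _ Tp'.
  have [_] := Tp; rewrite /= in_itv/= => /andP[urp _].
  have [_] := Tp'; rewrite /= in_itv/= => /andP[_ rpv].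
  exact: slab_le.
have sub : g @^-1` T `<=` (\bigcup_n D n `|` Z t1) `|` Z t2.
  move=> x /= Tx; have tx1 : t1 <= g x by apply: ge_inf => //; have [] := hi.
  have tx2 : g x <= t2 by apply: ub_le_sup => //; have [] := hs.
  have [x1|x1] := eqVneq (g x) t1; first by left; right; split=> //; have [] := Tx.
  have [x2|x2] := eqVneq (g x) t2; first by right; split=> //; have [] := Tx.
  have h1 : 0 < g x - t1 by rewrite subr_gt0 lt_neqAle eq_sym x1.
  have h2 : 0 < t2 - g x by rewrite subr_gt0 lt_neqAle x2.
  left; left; exists (Num.truncn (Num.min (g x - t1) (t2 - g x))^-1) => //.
  set k := Num.truncn _; have : k.+1%:R^-1 < Num.min (g x - t1) (t2 - g x).
    by rewrite invf_plt ?posrE ?lt_min ?h1 ?h2// truncnS_gt.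
  rewrite lt_min /D/= => /andP[]; move: (k.+1%:R^-1) => e k1 k2; apply/andP; split; lra.
have mDU : measurable (\bigcup_n D n) by apply: bigcupT_measurable.
apply: (@le_trans _ _ (mu ((\bigcup_n D n `|` Z t1) `|` Z t2))).
  apply: le_measure; rewrite ?inE//; first exact: mgE.
  by apply: measurableU => //; exact: measurableU.
have c1 : (mu ((\bigcup_n D n `|` Z t1) `|` Z t2) <= mu (\bigcup_n D n `|` Z t1) + mu (Z t2))%E.
  by apply: measureU2 => //; exact: measurableU.
have c2 : (mu (\bigcup_n D n `|` Z t1) <= mu (\bigcup_n D n) + mu (Z t1))%E by apply: measureU2.
rewrite Z0 adde0 in c1; rewrite Z0 adde0 in c2.
exact: le_trans c1 (le_trans c2 DU).
Qed.

Let mrg : measurable_fun setT (r \o g : 'rV[R]_d -> LT).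
Proof. exact: measurableT_comp. Qed.

Let k (x : 'rV[R]_d) : R := \1_E0 (g x).

Let mk : measurable_fun setT k.
Proof.
apply: (measurableT_comp _ (mgS : measurable_fun setT (g : _ -> LT))).
exact: measurable_indic.
Qed.

Let k0 x : 0 <= k x. Proof. by rewrite /k indicE. Qed.

Let menorm : measurable_fun setT (@enorm R d : 'rV[R]_d -> LT).
Proof. by apply: continuous_measurable_rV; exact: enorm_continuous. Qed.

Let mVrg : measurable_fun setT (fun x => Vr (r (g x))).
Proof. exact: (measurableT_comp mV mrg). Qed.

Let mVk : measurable_fun setT (fun x => Vr (r (g x)) * (k x)%:E)%E.
Proof. by apply: emeasurable_funM => //; exact/measurable_EFinP. Qed.

Let Vk0 x : (0 <= Vr (r (g x)) * (k x)%:E)%E.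
Proof. by rewrite mule_ge0 ?lee_fin ?k0 ?Vr0. Qed.

(** The law of r(g) restricted to [E0] is dominated by the law of |x|, on half-open intervals by
    [law_le] and then on Borel sets. *)
Let tail_le : (\int[mu]_x (Vr (r (g x)) * (k x)%:E) <= tail_int%:E)%E.
Proof.
pose nuk := density mu mk k0.
have [rg_mixin nm_mixin] := (isMeasurableFun.Build _ _ _ _ _ mrg, isMeasurableFun.Build _ _ _ _ _ menorm).
pose rg_pack : {mfun 'rV[R]_d >-> LT} := HB.pack (r \o g) rg_mixin.
pose nm_pack : {mfun 'rV[R]_d >-> LT} := HB.pack (@enorm R d) nm_mixin.
pose nu2 := pushforward nuk rg_pack.
pose nu1 := pushforward mu nm_pack.
have nu2E (E : set LT) : measurable E -> nu2 E = mu (g @^-1` (E0 `&` r @^-1` E)).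
  move=> mE1; rewrite /nu2 /pushforward /nuk /density/=.
  have m1 : measurable ((r \o g) @^-1` E) by rewrite -[X in measurable X]setTI; exact: mrg.
  transitivity (\int[mu]_(x in (r \o g) @^-1` E) (\1_(g @^-1` E0) x)%:E)%E; first by [].
  by rewrite integral_indic//; exact: mgE.
have le12 (E : set LT) : measurable E -> (nu2 E <= nu1 E)%E.
  apply: le_measure_ocitv.
    change (mu (@enorm R d @^-1` setT) < +oo)%E.
    by rewrite preimage_setT probability_setT ltry.
  move=> u v uv; change (nu2 `]u, v]%classic <= mu (@enorm R d @^-1` `]u, v]))%E.
  rewrite nu2E//; apply: le_trans (law_le uv) _.
  by rewrite le_eqVlt; apply/orP; left; apply/eqP; congr (mu _); apply/seteqP; split=> x /=; rewrite in_itv.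
have -> : (\int[mu]_x (Vr (r (g x)) * (k x)%:E) = \int[nu2]_t Vr t)%E.
  rewrite /nu2 (ge0_integral_pushforward (mrg : measurable_fun setT rg_pack) _ measurableT mV); last by move=> t _; exact: Vr0.
  rewrite preimage_setT; apply: esym; apply: ge0_integral_density; first exact: mVrg.
  by move=> x; exact: Vr0.
have <- : (\int[nu1]_t Vr t = tail_int%:E)%E.
  by rewrite /nu1 (ge0_integral_pushforward (menorm : measurable_fun setT nm_pack) _ measurableT mV) ?preimage_setT -?mu_tail// => t _; exact: Vr0.
apply: ge0_le_measure_integral; [exact: le12|exact: measurableT|exact: Vr0|exact: mV].
Qed.

Let B := [set t | E0 t /\ Vr (r t) = +oo%E].

Let mVrr : measurable_fun setT (Vr \o r : LT -> \bar R).
Proof. exact: (measurableT_comp mV mr). Qed.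

Let mB : measurable (B : set LT).
Proof.
rewrite (_ : B = E0 `&` (Vr \o r) @^-1` [set +oo%E])//; apply: measurableI => //.
rewrite -[X in measurable X]setTI; exact: mVrr.
Qed.

Let mu_B : mu (g @^-1` B) = 0%E.
Proof.
apply/eqP; rewrite eq_le measure_ge0 andbT leNgt; apply/negP => B0.
have := tail_le; apply/negP; rewrite -ltNge (lt_le_trans (ltry _))//.
have mgB := mgE mB.
apply: (@le_trans _ _ (\int[mu]_(x in g @^-1` B) cst +oo%E x)%E).
  by rewrite integral_cst// gt0_mulye.
apply: (@le_trans _ _ (\int[mu]_(x in g @^-1` B) (Vr (r (g x)) * (k x)%:E))%E).
  rewrite le_eqVlt; apply/orP; left; apply/eqP; apply: eq_integral => x; rewrite inE => -[Eg ->].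
  by rewrite /k indicE mem_set// mule1.
exact: ge0_subset_integral.
Qed.

Let E := E0 `\` B.

Let mE1 : measurable (E : set LT). Proof. exact: measurableD. Qed.

(** Two sets are removed from (s, 2 s): the levels with mass, null by [level_null], and those where
    V is infinite, null by [poincare_range], which applies since a <= 1/K <= 1/2 and a' > 0. *)
Let leb_E : lebesgue_measure (E : set LT) = s%:E.
Proof.
have lI : lebesgue_measure (`]s, 2 * s[%classic : set LT) = s%:E.
  rewrite lebesgue_measure_itv/= lte_fin; have := s0 => s00; rewrite ifT; last by lra.
  by rewrite -EFinB; congr (_%:E); lra.
have B0 : lebesgue_measure (B : set LT) = 0%E.
  apply: (@poincare_range _ _ mu lambda g s (2 * s) N) => //.
  - by have := s0; lra.
  - rewrite -muf// lee_fin -/a (le_trans a1)// div1r lef_pV2 ?posrE//.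
  - by rewrite -mE lte_fin (lt_le_trans a'0)// m_lt.
  - by move=> t [[]]; rewrite /= in_itv.
pose I : set LT := `]s, 2 * s[%classic.
have mI : measurable I by exact: measurable_itv.
have L0 : lebesgue_measure (I `\` E0) = 0%E.
  apply: (@level_null _ _ _ mu g mgS); first exact: measurableD.
  move=> t [It nE]; rewrite lt0e measure_ge0 andbT; apply/eqP => mt0.
  by apply: nE; split=> //; move: It; rewrite /I/= in_itv.
apply/eqP; rewrite eq_le -{1}lI le_measure ?inE//=; last first.
  by move=> t [[st _] _]; rewrite /= in_itv.
rewrite -lI; apply: (@le_trans _ _ (lebesgue_measure ((E `|` B) `|` (I `\` E0) : set LT))).
  rewrite le_measure ?inE//.
    by apply: measurableU; [exact: measurableU|exact: measurableD].
  move=> t It; have [E0t|E0t] := pselect (E0 t); last by right; split.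
  by left; have [Bt|Bt] := pselect (B t); [right|left; split].
have c1 : (lebesgue_measure ((E `|` B) `|` (I `\` E0) : set LT) <=
    lebesgue_measure (E `|` B : set LT) + lebesgue_measure (I `\` E0))%E.
  by apply: measureU2; [exact: measurableU|exact: measurableD].
have c2 : (lebesgue_measure (E `|` B : set LT) <= lebesgue_measure (E : set LT) + lebesgue_measure (B : set LT))%E.
  exact: measureU2.
rewrite L0 adde0 in c1; rewrite B0 adde0 in c2.
exact: le_trans c1 c2.
Qed.

Variables (e C : R).
Hypotheses (e0 : 0 < e) (C0 : 0 < C).
Hypothesis young : forall (x : \bar R) t, (0 <= x)%E -> 0 <= t ->
  (x * t%:E <= e%:E * c x + (C * conj_cost A q t)%:E)%E.

(** A lower bound for m t F(1 / m t) uniform over the layer, where a' <= m t <= a. *)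
Let Y := a' * F (1 / a).
Let a0 : 0 < a. Proof. exact: lt_le_trans a'a. Qed.
Let Fa0 : 0 < F (1 / a).
Proof. by have [h _] := Fa a0 (lexx _); apply: lt_le_trans h; exact: adm_two_gt0. Qed.
Let Y0 : 0 < Y. Proof. exact: mulr_gt0. Qed.

(** An upper bound for e c(I_F): the supremum defining V, tested at y = 1/a and multiplied by a,
    gives 4 c(I_F) <= a V + F(1/a) - 1. *)
Let w t := e / 4 * (a * fine (Vr (r t)) + F (1 / a)).

Let w0 t : 0 < w t.
Proof.
rewrite /w mulr_gt0 ?divr_gt0// ltr_wpDl// mulr_ge0 ?(ltW a0)//.
by rewrite fine_ge0// Vr0.
Qed.

Let nu t := young_inv A q C (w t).

Let nu0 t : 0 < nu t. Proof. exact: young_inv_gt0. Qed.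

Let VrE t : E t -> Vr (r t) = V (r t) /\ Vr (r t) = (fine (Vr (r t)))%:E.
Proof.
move=> [[/andP[st ts] Et] Bt]; have [rr _] := rP st ts; split.
  by rewrite /Vr patchE mem_set//= in_itv/= rr.
rewrite fineK// ge0_fin_numE ?Vr0// ltey; apply/eqP => h; apply: Bt; split=> //.
by split=> //; rewrite st ts.
Qed.

(** An infinite I_F would make V infinite, against the choice of E. A finite one satisfies Young's
    inequality for every slope u, which is the condition defining [young_inv]. *)
Let isop_nu t : E t -> (isop mu F (r t) <= (nu t)%:E)%E.
Proof.
move=> Et; have [VE Vfin] := VrE Et; have [[/andP[st ts] _] _] := Et.
have [_ muE] := rP st ts.
have S0 : mu [set x | (t <= g x)%R] = (1 - mu (eball (r t)))%E.
  by rewrite muE -mE -!EFinB; congr (_%:E); lra.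
have m0 : 0 < m t by rewrite (lt_le_trans a'0)// m_lt// ltW.
have Fm : 0 <= F (1 / m t).
  by have [h1 h2] := Fa m0 (m_gt st); rewrite (le_trans _ h2)// ltW.
have I0 : (0 <= isop mu F (r t))%E by apply: (isop_ge0 (mge t)) => //; rewrite -mE lte_fin.
have : (4%:E * c (isop mu F (r t)) * (1 / a)%:E - (1 / a * F (1 / a))%:E + (1 / a)%:E <= (fine (Vr (r t)))%:E)%E.
  by rewrite -Vfin VE; apply: le_Phi; rewrite divr_ge0// ltW.
case: (isop mu F (r t)) I0 => [i||//]; last first.
  by rewrite /c cost_conj_pinfty gt0_muley// gt0_mulye ?lte_fin ?divr_gt0// addye// addye// leye_eq.
have ciE : c i%:E = (fine (c i%:E))%:E by rewrite fineK//; exact: cost_conj_fin.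
rewrite lee_fin => i0; rewrite ciE; set ci := fine _ => h.
have {}h : 4 * ci * (1 / a) - 1 / a * F (1 / a) + 1 / a <= fine (Vr (r t)) by rewrite -lee_fin.
have wci : e * ci <= w t.
  have : a * (4 * ci * (1 / a) - 1 / a * F (1 / a) + 1 / a) <= a * fine (Vr (r t)) by rewrite ler_wpM2l// ltW.
  rewrite (_ : a * _ = 4 * ci - F (1 / a) + 1); last by field; rewrite gt_eqF.
  move=> h1; have : e * (4 * ci) <= e * (a * fine (Vr (r t)) + F (1 / a)) by rewrite ler_wpM2l ?(ltW e0)//; lra.
  by rewrite /w; lra.
apply: young_inv_ge => // u u0; have := @young i%:E u i0 (ltW u0).
rewrite ciE -/ci => h1.
have {}h1 : i * u <= e * ci + C * conj_cost A q u by rewrite -lee_fin.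
by apply: (le_trans h1); rewrite lerD2r (le_trans wci)// le_max lexx.
Qed.

Let rho t := Y * (nu t)^-1 * \1_E t.

Let rho_plus t : s < t -> ((rho t)%:E <= mu_plus mu [set x | (t <= g x)%R])%E.
Proof.
move=> st; rewrite /rho indicE; have [|tE] := boolP (t \in E); last first.
  by rewrite mulr0; apply: mu_plus_ge0.
rewrite inE mulr1 => Et; have [[/andP[_ ts] _] _] := Et; have [_ muE] := rP st ts.
have S0 : mu [set x | (t <= g x)%R] = (1 - mu (eball (r t)))%E.
  by rewrite muE -mE -!EFinB; congr (_%:E); lra.
have m0 : 0 < m t by rewrite (lt_le_trans a'0)// m_lt// ltW.
have [h1 h2] := Fa m0 (m_gt st).
apply: (isop_mu_plus (mge t) S0) (isop_nu Et) => //; first by rewrite -mE lte_fin.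
rewrite Y0/= -/(m t) /Y; apply: ler_pM => //; [exact: ltW|exact: ltW|].
by apply: m_lt; exact: ltW.
Qed.

Let mnu : measurable_fun setT (nu : LT -> R).
Proof.
apply: (measurableT_comp (f := young_inv A q C : LT -> R)).
  by apply: nondecreasing_measurable => //; exact: le_young_inv.
apply: measurable_funM => //; apply: measurable_funD => //; apply: measurable_funM => //.
by apply: measurableT_comp mVrr; exact: fine_measurable.
Qed.

Let mindE : measurable_fun setT (\1_E : LT -> R).
Proof. exact: measurable_indic. Qed.

Let mrho : measurable_fun setT (rho : LT -> R).
Proof.
apply: measurable_funM => //; apply: measurable_funM => //.
by apply: measurable_fun_inv => // t; exact: ltW.
Qed.

Definition layer_cost : \bar R :=
  (\int[mu]_(x in [set x | (s < g x < 2 * s)%R]) (g x * conj_cost A q (enorm (grad g x) / g x))%:E)%E.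

Let mann : measurable [set x | s < g x < 2 * s].
Proof. by apply: (measurable_set_itv (i := `]s, 2 * s[) mgS) => x; rewrite in_itv. Qed.

Let phi (t : R) : \bar R := (nu t * \1_E t)%:E.

Let D x : \bar R := ((g x * conj_cost A q (enorm (grad g x) / g x))%:E * (\1_[set x | (s < g x < 2 * s)%R] x)%:E)%E.

Let mD : measurable_fun setT D.
Proof.
apply: emeasurable_funM; apply/measurable_EFinP; last exact: measurable_indic.
apply: measurable_funM => //.
apply: (measurableT_comp (f := conj_cost A q : LT -> R)).
  by apply: nondecreasing_measurable => //; exact: le_conj_cost.
apply: measurable_funM; first exact: measurable_grad.
exact: measurable_fun_inv.
Qed.

Let D0 x : (0 <= D x)%E.
Proof. by rewrite /D -EFinM lee_fin !mulr_ge0// conj_cost_ge0. Qed.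

(** Young's inequality is applied to the logarithmic gradient |grad g| / g; the factor g <= 2 s
    turns the e/4 of w into e/2. *)
Let phi_le x : (phi (g x) * (enorm (grad g x))%:E <=
  (s * (e / 2) * a)%:E * (Vr (r (g x)) * (k x)%:E) +
  (s * (e / 2) * F (1 / a))%:E * (\1_[set x | (s < g x)%R] x)%:E + C%:E * D x)%E.
Proof.
have se0 : 0 <= s * (e / 2) by rewrite mulr_ge0 ?divr_ge0// ltW.
rewrite /phi indicE; have [|gE] := boolP (g x \in E); last first.
  rewrite mulr0 mul0e !adde_ge0// mule_ge0// lee_fin ?mulr_ge0//; exact: ltW.
rewrite inE mulr1 => Ex; have [_ Vfin] := VrE Ex; have [[/andP[sx xs] E0x] _] := Ex.
have xann : [set x | s < g x < 2 * s] x by rewrite /= sx xs.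
rewrite Vfin /k /D !indicE !mem_set//=.
rewrite !mule1 -!EFinM -!EFinD lee_fin.
have gx0 : 0 < g x by rewrite (lt_trans s0).
set G := enorm (grad g x); have G0 : 0 <= G by exact: enorm_ge0.
have Gg : 0 <= G / g x by rewrite divr_ge0// ltW.
have := young_inv_le A0 q2 C0 (w (g x)) Gg; rewrite -/(nu (g x)) max_l ?(ltW (w0 _))// => h.
have -> : nu (g x) * G = g x * (nu (g x) * (G / g x)) by field; rewrite gt_eqF.
apply: (le_trans (ler_wpM2l (ltW gx0) h)); rewrite mulrDr.
have : g x * w (g x) <= 2 * s * w (g x) by rewrite ler_wpM2r// ltW.
by rewrite /w; lra.
Qed.

(** The coarea inequality with phi = nu and rho = Y / nu on E: the left side is Y times the length s
    of E. *)
Lemma layer_bound : ((s * (a' * F (1 / a)))%:E <=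
  (s * (e / 2) * (a * tail_int + a * F (1 / a)))%:E + C%:E * layer_cost)%E.
Proof.
have se0 : 0 <= s * (e / 2) by rewrite mulr_ge0 ?divr_ge0// ltW.
have mphi : measurable_fun setT (phi : LT -> \bar R) by apply/measurable_EFinP; apply: measurable_funM => //; exact: mnu.
have phi0 t : (0 <= phi t)%E by rewrite lee_fin mulr_ge0// ltW.
have rho0 t : 0 <= rho t by rewrite /rho !mulr_ge0// ?invr_ge0 ltW.
have rho_s t : t <= s -> rho t = 0.
  move=> ts; rewrite /rho indicE; have [|_] := boolP (t \in E); last by rewrite mulr0.
  by rewrite inE => -[[/andP[+ _] _] _]; rewrite ltNge ts.
have := coarea_le sg gN mrho rho0 rho_s rho_plus mphi phi0.
have -> : (\int[lebesgue_measure]_t (phi t * (rho t)%:E) = (s * Y)%:E)%E.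
  transitivity (\int[lebesgue_measure]_(t in (setT : set LT)) (Y%:E * (\1_E t)%:E))%E.
    apply: eq_integral => t _; rewrite /phi /rho -!EFinM; congr (_%:E).
    rewrite indicE; case: (t \in E); last by rewrite !mulr0.
    by rewrite !mulr1 mulrCA mulfV ?mulr1// gt_eqF.
  rewrite ge0_integralZl//; last 2 first.
    exact/measurable_EFinP.
    by rewrite lee_fin ltW.
  transitivity (Y%:E * s%:E)%E; last by rewrite -EFinM mulrC.
  congr (_ * _)%E; apply: (etrans (integral_indic _ measurableT mE1)).
  by rewrite setIT; exact: leb_E.
move=> h; apply: (le_trans h).
have mi1 : measurable_fun setT (fun x => (\1_[set x | (s < g x)%R] x : R)%:E).
  by apply/measurable_EFinP; exact: measurable_indic.
apply: (@le_trans _ _ (\int[mu]_x ((s * (e / 2) * a)%:E * (Vr (r (g x)) * (k x)%:E) +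
  (s * (e / 2) * F (1 / a))%:E * (\1_[set x | (s < g x)%R] x)%:E + C%:E * D x))%E).
  apply: ge0_le_integral => //.
  - by move=> x _; rewrite mule_ge0// lee_fin enorm_ge0.
  - apply: emeasurable_funM; first exact: (measurableT_comp mphi mgS).
    by apply/measurable_EFinP; exact: measurable_grad.
  - apply: emeasurable_funD; last exact: measurable_funeM.
    by apply: emeasurable_funD; exact: measurable_funeM.
rewrite ge0_integralD//; last 4 first.
  by move=> x _; rewrite adde_ge0// mule_ge0// lee_fin ?mulr_ge0//; exact: ltW.
  by apply: emeasurable_funD; exact: measurable_funeM.
  by move=> x _; rewrite mule_ge0// lee_fin ltW.
  exact: measurable_funeM.
rewrite ge0_integralD//; last 4 first.
  by move=> x _; rewrite mule_ge0// lee_fin mulr_ge0//; exact: ltW.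
  exact: measurable_funeM.
  by move=> x _; rewrite mule_ge0// lee_fin mulr_ge0//; exact: ltW.
  exact: measurable_funeM.
rewrite !ge0_integralZl//; try by rewrite lee_fin ?mulr_ge0//; exact: ltW.
have -> : (\int[mu]_x (\1_[set x | (s < g x)%R] x)%:E = a%:E)%E.
  by apply: (etrans (integral_indic _ measurableT (mgt s))); rewrite setIT /a muf.
apply: leeD; last first.
  rewrite lee_wpmul2l ?lee_fin ?(ltW C0)// /layer_cost [leRHS]integral_mkcond le_eqVlt.
  apply/orP; left; apply/eqP; apply: eq_integral => x _.
  by rewrite /D patchE indicE; case: (_ \in _); rewrite ?mule1 ?mule0.
rewrite mulrDr !mulrA EFinD leeD//; last by rewrite -EFinM lee_fin; lra.
by rewrite [X in (_ <= X)%E]EFinM lee_wpmul2l// lee_fin !mulr_ge0// ltW.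
Qed.

End layer.

(** * Cutoff *)

Section cutoff.
Context {R : realType} {d : nat}.
Variables (f : 'rV[R]_d -> R) (t : R).
Hypotheses (sf : smooth f) (t0 : 0 < t).
Implicit Type x : 'rV[R]_d.

Definition damping (u : R) x : R := 1 + u * (f x ^+ 2 + enorm x ^+ 2).

Lemma damping_ge1 u x : 0 <= u -> 1 <= damping u x.
Proof. by move=> u0; rewrite lerDl mulr_ge0// addr_ge0 ?sqr_ge0. Qed.

(* Makes superlevel sets bounded without increasing the logarithmic gradient by more than [sqrt u]. *)
Definition damped (u : R) x : R := f x * (damping u x)^-1.

Let D0 x : 0 < damping t x. Proof. by rewrite (lt_le_trans ltr01)// damping_ge1// ltW. Qed.

Let dampingE : damping t = cst 1 + cst t * (f * f + \sum_(j < d) (fun x => x 0 j) * (fun x => x 0 j)).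
Proof.
apply/funext => x; rewrite /damping sqr_enorm !fctE; congr (1 + t * (_ + _)).
by rewrite fct_sumE; apply: eq_bigr => j _; rewrite expr2.
Qed.

Let is_derive_damping i x : is_derive x (delta_mx 0 i : 'rV[R]_d) (damping t)
  (2 * t * (f x * partial i f x + x 0 i)).
Proof.
rewrite dampingE; have fi := smooth_derivable i x sf.
have si := is_derive_sum (fun j => is_deriveM (is_derive_coord i j x) (is_derive_coord i j x)).
have := is_deriveD (is_derive_cst (1 : R) x (delta_mx 0 i))
   (is_deriveM (is_derive_cst t x (delta_mx 0 i)) (is_deriveD (is_deriveM fi fi) si)).
move=> H; apply: (is_derive_eq H).
rewrite (eq_bigr (fun j => if j == i then 2 * x 0 i else 0)); last first.
  move=> j _; rewrite /GRing.scale/=; case: eqVneq => [->|ji].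
    by rewrite mulr1; ring.
  by rewrite !mulr0 addr0.
by rewrite -big_mkcond/= big_pred1_eq scaler0 addr0 add0r /GRing.scale/=; ring.
Qed.

(** With D the damping, the gradient is D^(-1) (1 - 2 t f^2 / D) grad f - (2 t f / D^2) x. The
    bracket lies in [-1, 1] since t f^2 <= D, and 2 sqrt(t) |x| <= 1 + t |x|^2 <= D bounds the
    relative size of the second term by sqrt(t). *)
Lemma grad_damped x : f x != 0 ->
  enorm (grad (damped t) x) / `|damped t x| <= enorm (grad f x) / `|f x| + Num.sqrt t.
Proof.
move=> fx0; set D := damping t x; have Dx : 0 < D := D0 x.
have part i : partial i (damped t) x =
    (D^-1 * (1 - 2 * t * f x ^+ 2 / D)) * partial i f x - (2 * t * f x / D ^+ 2) * x 0 i.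
  have dV : derivable (fun y => (damping t y)^-1) x (delta_mx 0 i).
    by apply: derivableV; [rewrite gt_eqF|have [] := is_derive_damping i x].
  have DV : is_derive x (delta_mx 0 i : 'rV[R]_d) (fun y => (damping t y)^-1)
      (- D ^- 2 * (2 * t * (f x * partial i f x + x 0 i))).
    apply: DeriveDef => //; rewrite deriveV ?gt_eqF//; last by have [] := is_derive_damping i x.
    by have [_ ->] := is_derive_damping i x.
  have [_] := is_deriveM (smooth_derivable i x sf) DV.
  rewrite /partial => ->; rewrite /GRing.scale/= -/D.
  by field; rewrite gt_eqF.
have -> : grad (damped t) x =
    (D^-1 * (1 - 2 * t * f x ^+ 2 / D)) *: grad f x - (2 * t * f x / D ^+ 2) *: x.
  by apply/rowP => i; rewrite !mxE part.
rewrite /damped -/D normrM normfV (gtr0_norm Dx).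
have f0 : 0 < `|f x| by rewrite normr_gt0.
rewrite ler_pdivrMr ?divr_gt0// [leRHS]mulrDl.
apply: (le_trans (ler_enormD _ _)); rewrite enormN !enormZ; apply: lerD.
  rewrite normrM normfV (gtr0_norm Dx).
  have -> : enorm (grad f x) / `|f x| * (`|f x| / D) = D^-1 * 1 * enorm (grad f x).
    by field; rewrite !gt_eqF.
  rewrite ler_wpM2r ?enorm_ge0// ler_wpM2l ?invr_ge0 ?(ltW Dx)// ler_norml.
  have u0 : 0 <= 2 * t * f x ^+ 2 / D by rewrite divr_ge0 ?(ltW Dx)// mulr_ge0 ?sqr_ge0// mulr_ge0// ltW.
  have : 2 * t * f x ^+ 2 / D <= 2.
    rewrite ler_pdivrMr// /D /damping.
    by have : 0 <= t * enorm x ^+ 2; [rewrite mulr_ge0 ?sqr_ge0// ltW|lra].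
  by move=> u1; apply/andP; split; lra.
rewrite normrM normfV (ger0_norm (sqr_ge0 D)) normrM (gtr0_norm (mulr_gt0 _ t0))//.
have -> : 2 * t * `|f x| / D ^+ 2 * enorm x = (2 * t * enorm x / D) * (`|f x| / D).
  by field; rewrite gt_eqF.
rewrite ler_wpM2r ?divr_ge0 ?(ltW Dx)// ler_pdivrMr//.
have st : Num.sqrt t ^+ 2 = t by rewrite sqr_sqrtr// ltW.
have s0 : 0 <= Num.sqrt t by exact: sqrtr_ge0.
have : 2 * Num.sqrt t * enorm x <= 1 + t * enorm x ^+ 2.
  by have := sqr_ge0 (Num.sqrt t * enorm x - 1); rewrite sqrrB exprMn st; lra.
move=> h; have {}h : 2 * Num.sqrt t * enorm x <= D.
  by rewrite (le_trans h)// /D /damping lerD2l ler_wpM2l ?(ltW t0)// lerDr sqr_ge0.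
have -> : 2 * t * enorm x = Num.sqrt t * (2 * Num.sqrt t * enorm x) by rewrite -[in LHS]st; ring.
by rewrite ler_wpM2l.
Qed.

Lemma smooth_damped : smooth (damped t).
Proof.
apply: smooth_expr_smooth; rewrite (_ : damped t = f * (fun x => (damping t x)^-1))//.
apply: SE_mul; first exact: SE_smooth.
apply: SE_inv; first by move=> x; rewrite gt_eqF.
have -> : damping t = cst 1 + cst t * (f * f + (fun x => \sum_(j < d) ((fun y : 'rV[R]_d => y 0 j) * (fun y : 'rV[R]_d => y 0 j)) x)).
  apply/funext => x; rewrite /damping sqr_enorm !fctE; congr (1 + t * (_ + _)).
apply: SE_add; first exact: SE_cst.
apply: SE_mul; first exact: SE_cst.
apply: SE_add; first by apply: SE_mul; exact: SE_smooth.
by apply: smooth_expr_sum => j _; apply: SE_mul; exact: SE_coord.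
Qed.

Lemma sqr_damped_le x : damped t x ^+ 2 <= f x ^+ 2.
Proof.
have D1 := damping_ge1 x (ltW t0).
rewrite exprMn exprVn ler_pdivrMr ?exprn_gt0// ler_peMr ?sqr_ge0//.
by rewrite exprn_ege1.
Qed.

Lemma le_sqr_damped t' x : 0 <= t' -> t' <= t -> damped t x ^+ 2 <= damped t' x ^+ 2.
Proof.
move=> t'0 tt'; rewrite !exprMn ler_wpM2l ?sqr_ge0//.
have D1 := damping_ge1 x t'0; have D1' : 0 < damping t' x by rewrite (lt_le_trans ltr01).
rewrite lerXn2r ?nnegrE ?invr_ge0 ?(ltW D1') ?(ltW (D0 x))//.
by rewrite lef_pV2 ?posrE// lerD2l ler_wpM2r// addr_ge0 ?sqr_ge0.
Qed.

(** By the inequality (a + b)^2 >= 4 a b, D^2 >= 4 t f^2 (1 + t |x|^2); with f^2 >= e D^2 the factor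
    f^2 cancels. The term f^2 inside the damping is what makes this work for unbounded f. *)
Lemma damped_bounded e : 0 < e -> exists N : R, forall x, e <= damped t x ^+ 2 -> enorm x <= N.
Proof.
move=> e0; exists (Num.sqrt (4 * t ^+ 2 * e)^-1) => x ex.
have h1 : e * damping t x ^+ 2 <= f x ^+ 2.
  by move: ex; rewrite exprMn exprVn ler_pdivlMr ?exprn_gt0.
have h2 : 4 * (t * f x ^+ 2) * (1 + t * enorm x ^+ 2) <= damping t x ^+ 2.
  by have := sqr_ge0 (1 + t * enorm x ^+ 2 - t * f x ^+ 2); rewrite /damping; lra.
have f0 : 0 < f x ^+ 2 by rewrite (lt_le_trans _ h1)// mulr_gt0// exprn_gt0.
have h3 : e * (4 * t * (1 + t * enorm x ^+ 2)) * f x ^+ 2 <= 1 * f x ^+ 2.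
  have : e * (4 * (t * f x ^+ 2) * (1 + t * enorm x ^+ 2)) <= e * damping t x ^+ 2 by rewrite ler_wpM2l// ltW.
  by rewrite mul1r; lra.
rewrite ler_pM2r// in h3.
rewrite -[leLHS]ger0_norm ?enorm_ge0// -sqrtr_sqr ler_sqrt ?invr_ge0 ?mulr_ge0 ?sqr_ge0 ?(ltW e0) ?(ltW t0)//.
rewrite -[leRHS]mul1r ler_pdivlMr ?mulr_gt0 ?exprn_gt0//.
have h4 : 0 < e * (4 * t) by rewrite !mulr_gt0.
lra.
Qed.

End cutoff.

Section cutoff_limit.
Context {R : realType} {d : nat}.
Variables (f : 'rV[R]_d -> R).

Lemma damped_cvg (s : R) x : 0 < s -> s < f x ^+ 2 ->
  exists n : nat, s < damped f n.+1%:R^-1 x ^+ 2.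
Proof.
move=> s0 sf; pose D := f x ^+ 2 + enorm x ^+ 2.
have f0 : 0 < f x ^+ 2 := lt_trans s0 sf.
have D0 : 0 < D by rewrite ltr_pwDl// sqr_ge0.
pose r := Num.sqrt s; have r0 : 0 < r by rewrite sqrtr_gt0.
have r2 : r ^+ 2 = s by rewrite sqr_sqrtr// ltW.
have rf : r < `|f x|.
  by rewrite -(ltr_pXn2r (_ : 0 < 2)%N) ?nnegrE ?(ltW r0)// r2 real_normK ?num_real.
exists (Num.truncn (r * D / (`|f x| - r))).
set n := Num.truncn _; have n0 : 0 < n.+1%:R :> R by [].
have h : r * D < n.+1%:R * (`|f x| - r) by rewrite -ltr_pdivrMr ?subr_gt0// truncnS_gt.
have P0 : 0 < damping f n.+1%:R^-1 x by rewrite (lt_le_trans ltr01)// damping_ge1.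
rewrite -r2 -(@real_normK _ (damped _ _ _)) ?num_real// ltr_pXn2r ?nnegrE ?(ltW r0)//.
rewrite /damped normrM normfV (gtr0_norm P0) ltr_pdivlMr// /damping -/D mulrDr mulr1.
rewrite mulrCA -ltrBrDl mulrC ltr_pdivrMr// mulrC; lra.
Qed.

End cutoff_limit.

(** * Summation over the layers *)

Section dyadic.
Context {R : realType} {d : nat} (mu : probability 'rV[R]_d R).
Hypotheses (hd : (0 < d)%N) (mu_ac : mu `<< lebesgue_outer).
Variables (F : R -> R) (A q K rad lambda : R).
Hypotheses (F_adm : admissible F) (A0 : 0 < A) (q2 : 2 <= q) (K2 : 2 <= K).
Hypotheses (rad0 : 0 < rad) (radE : mu (eball rad) = ((K - 1) / K)%:E).
Hypothesis lambda0 : 0 < lambda.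
Hypothesis Poincare : forall f : 'rV[R]_d -> R, smooth f ->
  (\int[mu]_x ((f x - median mu f) ^+ 2)%:E <=
     lambda%:E * \int[mu]_x (enorm (grad f x) ^+ 2)%:E)%E.
Hypothesis HV : mu.-integrable (~` eball rad)
  (fun x => Phi F (4%:E * cost_conj A q (isop mu F (enorm x)))%E).

Let K0 : 0 < K. Proof. by rewrite (lt_le_trans _ K2). Qed.

Let superlevel (g : 'rV[R]_d -> R) (s : R) : R := fine (mu [set x | s < g x]).

Let superlevel_ge0 g s : 0 <= superlevel g s. Proof. by rewrite fine_ge0. Qed.

Lemma layer_cost_ge0 g s : (forall x, 0 <= g x) -> (0 <= layer_cost mu A q g s)%E.
Proof. by move=> g0; apply: integral_ge0 => x _; rewrite lee_fin mulr_ge0// conj_cost_ge0. Qed.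

(** [layer_bound] is multiplied by r = F(s) / F(1/a), at most 1 because Markov's inequality gives
    1/a >= s; this replaces F(1/a) by F(s). By the choice of e the error is s F(s) a / 12, and
    passing from s F(s) to 2 s F(2 s) costs 2 times 3, which leaves 1/2. *)
Lemma layer_step : exists2 C : R, 0 < C & forall (g : 'rV[R]_d -> R) (s N : R),
  smooth g -> (forall x, 0 <= g x) -> (\int[mu]_x (g x)%:E <= 1)%E -> K <= s ->
  (forall x, s <= g x -> enorm x <= N) ->
  ((2 * s * F (2 * s) * superlevel g (2 * s))%:E <=
   (s * F s * superlevel g s / 2)%:E + C%:E * layer_cost mu A q g s)%E.
Proof.
pose M := tail_int mu F A q rad.
have M0 : 0 <= M.
  rewrite fine_ge0// integral_ge0// => x _.
  by apply: le_trans (le_Phi F _ (lexx 0)); rewrite mule0 mul0r oppe0 !adde0.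
have F20 := adm_two_gt0 F_adm.
pose e := (6 * (M / F 2 + 1))^-1.
have MF : 0 <= M / F 2 by rewrite divr_ge0// ltW.
have e0 : 0 < e by rewrite invr_gt0 mulr_gt0// ltr_wpDl.
have [C C0 young] := conj_young_eps A0 q2 e0.
exists (6 * C); first by rewrite mulr_gt0.
move=> g s N sg g0 g1 Ks gN.
have s0 : 0 < s := lt_le_trans K0 Ks.
have s2 : 2 <= s := le_trans K2 Ks.
have L0 := @layer_cost_ge0 g s g0.
have Fs0 : 0 < F s by rewrite (lt_le_trans F20)// adm_le.
have [a'0|a'0] := eqVneq (superlevel g (2 * s)) 0.
  rewrite a'0 mulr0 adde_ge0//; last by rewrite mule_ge0// lee_fin mulr_ge0// ltW.
  by rewrite lee_fin divr_ge0// !mulr_ge0// ltW.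
have a'1 : 0 < superlevel g (2 * s) by rewrite lt_neqAle eq_sym a'0 superlevel_ge0.
have := layer_bound hd mu_ac F_adm A0 q2 K2 rad0 radE lambda0 Poincare HV sg g0 g1 Ks gN a'1 e0 C0 young.
rewrite -/(superlevel g s) -/(superlevel g (2 * s)) -/M.
set a := superlevel g s; set a' := superlevel g (2 * s) in a'1 *.
have mS t : measurable [set x | t < g x] by apply: measurable_gt_rV; exact: smooth_continuous.
have aa' : a' <= a.
  apply: fine_le; rewrite ?fin_num_measure// le_measure ?inE//.
  by move=> x /=; apply: le_lt_trans; rewrite ler_peMl ?(ltW s0)// ler1n.
have a0 : 0 < a := lt_le_trans a'1 aa'.
have mg : measurable_fun setT g by apply: continuous_measurable_rV; exact: smooth_continuous.
have sa : s <= 1 / a.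
  rewrite div1r -[s]invrK lef_pV2 ?posrE ?invr_gt0//.
  by apply: (markov_le mg g0 g1) => // x /ltW.
have Fsa : F s <= F (1 / a) by apply: adm_le.
have F2s : F 2 <= F s by apply: adm_le.
set phi := F (1 / a) in Fsa *; have phi0 : 0 < phi := lt_le_trans Fs0 Fsa.
case: (layer_cost mu A q g s) L0 => [L||//]; last first.
  by move=> _ _; rewrite gt0_muley ?lte_fin ?mulr_gt0// addey// leey.
rewrite -!EFinM -!EFinD !lee_fin => L0 h.
pose r := F s / phi; have r0 : 0 <= r by rewrite divr_ge0// ltW.
have r1 : r <= 1 by rewrite ler_pdivrMr// mul1r.
have rF : r <= F s / F 2 by rewrite ler_wpM2l ?(ltW Fs0)// lef_pV2 ?posrE// (le_trans F2s).
have rphi : r * phi = F s by rewrite divfK// gt_eqF.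
have se0 : 0 <= s * (e / 2) * a by rewrite !mulr_ge0 ?divr_ge0// ltW.
have h1 : s * a' * F s <= s * (e / 2) * a * (M * (F s / F 2) + F s) + C * L.
  rewrite -rphi.
  have -> : s * a' * (r * phi) = r * (s * (a' * phi)) by ring.
  apply: (le_trans (ler_wpM2l r0 h)).
  have -> : r * (s * (e / 2) * (a * M + a * phi) + C * L) =
    s * (e / 2) * a * (M * r + r * phi) + r * (C * L) by ring.
  apply: lerD; last by rewrite ler_piMl// mulr_ge0// ltW.
  rewrite ler_wpM2l// lerD2r ler_wpM2l//.
  by rewrite rphi.
have h2 : s * (e / 2) * a * (M * (F s / F 2) + F s) = s * F s * a / 12.
  rewrite /e; field; rewrite ?gt_eqF//.
  by rewrite ltr_wpDl.
rewrite h2 in h1.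
have F3 : F (2 * s) <= 3 * F s by exact: adm_double.
have : 2 * s * a' * F (2 * s) <= 2 * s * a' * (3 * F s).
  by rewrite ler_wpM2l// !mulr_ge0// ltW.
lra.
Qed.

Let s_ k : R := K * 2 ^+ k.

Definition super_cost (g : 'rV[R]_d -> R) : \bar R :=
  (\int[mu]_(x in [set x | (K < g x)%R]) (g x * conj_cost A q (enorm (grad g x) / g x))%:E)%E.

Lemma dyadic_sum : exists2 C : R, 0 < C & forall (g : 'rV[R]_d -> R) (N : R),
  smooth g -> (forall x, 0 <= g x) -> (\int[mu]_x (g x)%:E <= 1)%E ->
  (forall x, K <= g x -> enorm x <= N) ->
  forall n, ((\sum_(k < n.+1) s_ k * F (s_ k) * superlevel g (s_ k))%:E <=
     (2 * (K * F K * superlevel g K))%:E + C%:E * super_cost g)%E.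
Proof.
have [C C0 step] := layer_step; exists (2 * C); first by rewrite mulr_gt0.
move=> g N sg g0 g1 gN n.
pose T k := s_ k * F (s_ k) * superlevel g (s_ k).
have sK k : K <= s_ k by rewrite /s_ ler_peMr ?(ltW K0)// exprn_ege1// ler1n.
have T0 k : 0 <= T k.
  have := sK k => Kk; rewrite /T !mulr_ge0 ?(le_trans _ Kk) ?(ltW K0)//.
  by apply: adm_ge0 => //; rewrite (le_trans _ Kk)// (le_trans _ K2)// ler1n.
have sS k : s_ k.+1 = 2 * s_ k by rewrite /s_ exprS; ring.
have step' k : ((T k.+1)%:E <= (T k / 2)%:E + C%:E * layer_cost mu A q g (s_ k))%E.
  by rewrite /T sS; apply: (step g (s_ k) N) => // x; move=> h; apply: gN; exact: le_trans h.
(* The extra T m closes the induction: 2 T_(m+1) is at most T_m plus 2 C times the cost of the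
   layer. *)
have main m : ((\sum_(k < m.+1) T k + T m)%:E <= (2 * T 0)%:E + (2 * C)%:E *
    \sum_(k < m) layer_cost mu A q g (s_ k))%E.
  elim: m => [|m IH].
    by rewrite big_ord0 mule0 adde0 lee_fin big_ord_recl big_ord0; lra.
  rewrite big_ord_recr/= [X in (_ * X)%E]big_ord_recr/=.
  rewrite ge0_muleDr ?layer_cost_ge0//; last by apply: sume_ge0 => k _; exact: layer_cost_ge0.
  rewrite addeA; apply: le_trans (leeD2r _ IH).
  have := step' m; have := @layer_cost_ge0 g (s_ m) g0.
  case: (layer_cost mu A q g (s_ m)) => [L||//]; last first.
    by move=> _ _; rewrite gt0_muley ?lte_fin ?mulr_gt0// addey// leey.
  by rewrite -!EFinM -!EFinD !lee_fin => _ h; lra.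
have T00 : T 0%N = K * F K * superlevel g K by rewrite /T /s_ expr0 mulr1.
apply: (@le_trans _ _ (\sum_(k < n.+1) T k + T n)%:E); first by rewrite lee_fin lerDl.
apply: (le_trans (main n)); rewrite T00 leeD2l// lee_wpmul2l ?lee_fin ?mulr_ge0 ?(ltW C0)//.
have mS t : measurable [set x | t < g x] by apply: measurable_gt_rV; exact: smooth_continuous.
have mA u v : measurable [set x | u < g x < v].
  have mg : measurable_fun setT g by apply: continuous_measurable_rV; exact: smooth_continuous.
  by apply: (measurable_set_itv (i := `]u, v[) mg) => x; rewrite in_itv.
pose D x := (g x * conj_cost A q (enorm (grad g x) / g x))%:E.
have D0 x : (0 <= D x)%E by rewrite lee_fin mulr_ge0// conj_cost_ge0.
have mD : measurable_fun setT D.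
  have mg : measurable_fun setT g by apply: continuous_measurable_rV; exact: smooth_continuous.
  apply/measurable_EFinP; apply: measurable_funM => //.
  apply: (measurableT_comp (f := conj_cost A q : measurableTypeR R -> R)).
    by apply: nondecreasing_measurable => //; exact: le_conj_cost.
  apply: measurable_funM; first exact: measurable_grad.
  exact: measurable_fun_inv.
(* The open layers are disjoint and lie above K, so their costs add up to at most the cost of the
   whole. *)
apply: (@le_trans _ _ (\int[mu]_(x in [set x | (K < g x < s_ n)%R]) D x)%E); last first.
  by apply: ge0_subset_integral => //; [exact: measurable_funTS|move=> x /= /andP[]].
elim: n => [|n IH]; first by rewrite big_ord0 integral_ge0.
rewrite big_ord_recr/=; apply: (le_trans (leeD2r _ IH)).
rewrite /layer_cost -sS -ge0_integral_setU//.
- apply: ge0_subset_integral => //; first exact: measurableU.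
    exact: measurable_funTS.
  move=> x [] /= /andP[x1 x2]; apply/andP; split=> //.
    by rewrite (lt_le_trans x2)// sS ler_peMl ?ler1n// (le_trans _ (sK n))// ltW.
  exact: le_lt_trans x1.
- exact: measurable_funTS.
- apply/disj_setPS => x [] /= /andP[_ x1] /andP[x2 _].
  by have := lt_trans x1 x2; rewrite ltxx.
Qed.

Let sK k : K <= s_ k.
Proof. by rewrite /s_ ler_peMr ?(ltW K0)// exprn_ege1// ler1n. Qed.

Let s_gt0 k : 0 < s_ k. Proof. exact: lt_le_trans (sK k). Qed.

Let Fs0 k : 0 <= F (s_ k).
Proof. by apply: adm_ge0 => //; rewrite (le_trans _ (sK k))// (le_trans _ K2)// ler1n. Qed.

Definition weight_cost (f : 'rV[R]_d -> R) (m : R) : \bar R :=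
  (\int[mu]_(x in [set x | (K * m <= f x ^+ 2)%R])
     (f x ^+ 2 / m * conj_cost A q (enorm (grad f x) / `|f x|))%:E)%E.

(** The logarithmic gradient doubles under squaring, so it is at most 2 (p + sqrt t). Doubling of
    the cost is used for this 2 and again for p + sqrt t <= 2 max(p, sqrt t). The condition sqrt t
    <= A puts sqrt t on the quadratic branch, where its cost is at most t. *)
Lemma super_cost_damped : exists2 C : R, 0 < C & forall (f : 'rV[R]_d -> R) (m t : R),
  smooth f -> 0 < m -> 0 < t -> Num.sqrt t <= A -> (\int[mu]_x (f x ^+ 2)%:E = m%:E)%E ->
  (super_cost (fun x => damped f t x ^+ 2 / m)%R <= C%:E * (weight_cost f m + t%:E))%E.
Proof.
have [M M1 MP] := conj_cost_double A0 q2.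
have M0 : 0 < M by rewrite (lt_le_trans _ M1).
exists (M * M); first by rewrite mulr_gt0.
move=> f m t sf m0 t0 tA fm.
pose g x := damped f t x ^+ 2 / m; pose y x := f x ^+ 2 / m.
pose p x := enorm (grad f x) / `|f x|.
have sft := smooth_damped sf t0.
have mf : measurable_fun setT f by apply: continuous_measurable_rV; exact: smooth_continuous.
have mft : measurable_fun setT (damped f t) by apply: continuous_measurable_rV; exact: smooth_continuous.
have g0 x : 0 <= g x by rewrite divr_ge0 ?sqr_ge0// ltW.
have y0 x : 0 <= y x by rewrite divr_ge0 ?sqr_ge0// ltW.
have gy x : g x <= y x by rewrite ler_wpM2r ?invr_ge0 ?(ltW m0)// sqr_damped_le.
have mg : measurable_fun setT g by apply: measurable_funM => //; exact: measurable_funX.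
have my : measurable_fun setT y by apply: measurable_funM => //; exact: measurable_funX.
have p0 x : 0 <= p x by rewrite divr_ge0// enorm_ge0.
have mcs : measurable_fun setT (conj_cost A q : measurableTypeR R -> R).
  by apply: nondecreasing_measurable => //; exact: le_conj_cost.
have mp : measurable_fun setT p.
  apply: measurable_funM; first exact: measurable_grad.
  by apply: measurable_fun_inv => //; exact: measurableT_comp.
have mycs : measurable_fun setT (fun x => (y x * conj_cost A q (p x))%:E).
  by apply/measurable_EFinP; apply: measurable_funM => //; exact: (measurableT_comp mcs).
have mgcs : measurable_fun setT (fun x => (g x * t)%:E).
  by apply/measurable_EFinP; apply: measurable_funM.
have cs0 u : 0 <= conj_cost A q u by exact: conj_cost_ge0.
have gradg x : enorm (grad g x) = 2 * `|damped f t x| / m * enorm (grad (damped f t) x).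
  have hD u : is_derive u (1 : R) (fun u : R => u ^+ 2 / m) (2 * u / m).
    apply: is_derive_eq; rewrite /GRing.scale/=; ring.
  have := grad_comp x hD sft; rewrite /comp -/g => ->.
  move: (damped f t x) => v.
  by rewrite !normrM normfV (gtr0_norm m0) (ger0_norm (ler0n _ 2)).
have ptw x : K < g x -> g x * conj_cost A q (enorm (grad g x) / g x) <=
    M * M * (y x * conj_cost A q (p x) + g x * t).
  move=> Kg; have gx0 : 0 < g x := lt_trans K0 Kg.
  have ft0 : 0 < `|damped f t x|.
    rewrite normr_gt0; apply/eqP => h; move: gx0.
    by rewrite /g h expr0n mul0r ltxx.
  have fx0 : f x != 0 by apply/eqP => h; move: ft0; rewrite /damped h mul0r normr0 ltxx.
  have -> : enorm (grad g x) / g x = 2 * (enorm (grad (damped f t) x) / `|damped f t x|).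
    rewrite gradg /g -[damped f t x ^+ 2]real_normK ?num_real//.
    by field; rewrite !gt_eqF.
  have h1 := grad_damped sf t0 fx0; rewrite -/(p x) in h1.
  set w := Num.sqrt t in h1 tA; have w0 : 0 <= w by exact: sqrtr_ge0.
  have pw : p x + w <= 2 * Num.max (p x) w.
    have : p x <= Num.max (p x) w by rewrite le_max lexx.
    have : w <= Num.max (p x) w by rewrite le_max lexx orbT.
    lra.
  have mx0 : 0 <= Num.max (p x) w by rewrite le_max w0 orbT.
  have mxle : conj_cost A q (Num.max (p x) w) <= conj_cost A q (p x) + conj_cost A q w.
    by case: (leP (p x) w) => _; [rewrite lerDr|rewrite lerDl].
  have csw : conj_cost A q w <= t.
    apply: (le_trans (conj_cost_le A0 q2 w0)).
    rewrite /cost ger0_norm// tA sqr_sqrtr ?(ltW t0)//; have := t0; lra.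
  have h2 : conj_cost A q (2 * (enorm (grad (damped f t) x) / `|damped f t x|)) <=
      M * (M * (conj_cost A q (p x) + t)).
    apply: (@le_trans _ _ (conj_cost A q (2 * (p x + w)))).
      by apply: le_conj_cost => //; rewrite ler_pM2l.
    apply: (le_trans (MP _ (addr_ge0 (p0 x) w0))); rewrite ler_pM2l//.
    apply: (@le_trans _ _ (conj_cost A q (2 * Num.max (p x) w))); first exact: le_conj_cost.
    by apply: (le_trans (MP _ mx0)); rewrite ler_pM2l// (le_trans mxle)// lerD2l.
  apply: (le_trans (ler_wpM2l (g0 x) h2)).
  have -> : g x * (M * (M * (conj_cost A q (p x) + t))) = M * M * (g x * conj_cost A q (p x) + g x * t) by ring.
  rewrite ler_wpM2l ?mulr_ge0 ?(ltW M0)// lerD2r ler_wpM2r//.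
have mS : measurable [set x | K < g x].
  by apply: (measurable_set_itv (i := `]K, +oo[) mg) => x; rewrite in_itv/= andbT.
have mS' : measurable [set x | K * m <= f x ^+ 2].
  by apply: (measurable_set_itv (i := `[K, +oo[) my) => x; rewrite in_itv/= andbT ler_pdivlMr.
rewrite (_ : super_cost _ = super_cost g)// /super_cost.
apply: (@le_trans _ _ (\int[mu]_(x in [set x | (K < g x)%R])
    ((M * M)%:E * ((y x * conj_cost A q (p x))%:E + (g x * t)%:E)))%E).
  apply: ge0_le_integral => //.
  - by move=> x _; rewrite lee_fin mulr_ge0.
  - apply: measurable_funTS; apply/measurable_EFinP; apply: measurable_funM => //.
    apply: (measurableT_comp mcs); apply: measurable_funM; last exact: measurable_fun_inv.
    rewrite (_ : (fun x => _) = (fun x => 2 * `|damped f t x| / m * enorm (grad (damped f t) x))); last by apply/funext => x; exact: gradg.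
    apply: measurable_funM; last exact: measurable_grad.
    apply: measurable_funM => //; apply: measurable_funM => //; exact: measurableT_comp.
  - apply: measurable_funTS; apply: measurable_funeM; exact: emeasurable_funD.
rewrite ge0_integralZl//; last 3 first.
- by apply: measurable_funTS; exact: emeasurable_funD.
- by move=> x _; rewrite adde_ge0// lee_fin mulr_ge0// ltW.
- by rewrite lee_fin mulr_ge0// ltW.
rewrite lee_wpmul2l ?lee_fin ?mulr_ge0 ?(ltW M0)// ge0_integralD//; last 4 first.
- by move=> x _; rewrite lee_fin mulr_ge0.
- exact: measurable_funTS.
- by move=> x _; rewrite lee_fin mulr_ge0// ltW.
- exact: measurable_funTS.
apply: leeD.
  apply: ge0_subset_integral => //; first exact: measurable_funTS.
    by move=> x _; rewrite lee_fin mulr_ge0.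
  by move=> x /= Kg; rewrite -ler_pdivlMr// (le_trans (ltW Kg))// gy.
apply: (@le_trans _ _ (\int[mu]_x ((t / m)%:E * (f x ^+ 2)%:E))%E).
  apply: (@le_trans _ _ (\int[mu]_x (g x * t)%:E)%E).
    by apply: ge0_subset_integral => // x _; rewrite lee_fin mulr_ge0// ltW.
  apply: ge0_le_integral => //.
  - by move=> x _; rewrite lee_fin mulr_ge0// ltW.
  - by apply: measurable_funeM; apply/measurable_EFinP; exact: measurable_funX.
  - move=> x _; rewrite -EFinM lee_fin (_ : t / m * f x ^+ 2 = y x * t); last by rewrite /y; ring.
    by rewrite ler_wpM2r// ltW.
rewrite ge0_integralZl//.
- by rewrite fm -EFinM divfK// gt_eqF.
- by apply/measurable_EFinP; exact: measurable_funX.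
- by move=> x _; rewrite lee_fin sqr_ge0.
- by rewrite lee_fin divr_ge0// ltW.
Qed.

(** For y in (s_n, 2 s_n], y F(y) <= 2 s_n F(2 s_n) <= 6 s_n F(s_n). The separate term pays for the
    level y = K, which lies in none of these half-open layers. *)
Lemma tail_integral (g : 'rV[R]_d -> R) (e : \bar R) :
  measurable_fun setT g -> (forall x, 0 <= g x) ->
  (forall n, (\sum_(k < n) s_ k * F (s_ k) * superlevel g (s_ k))%:E <= e)%E ->
  (\int[mu]_(x in [set x | (K <= g x)%R]) (g x * F (g x))%:E <=
    (K * F K * fine (mu [set x | (K <= g x)%R]))%:E + 6%:E * e)%E.
Proof.
move=> mg g0 He; pose u x := (g x * F (g x))%:E.
have mu' : measurable_fun setT u by apply/measurable_EFinP; exact: measurable_adm_fun.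
have mpre (i : interval R) : measurable (g @^-1` [set` i]).
  by rewrite -[X in measurable X]setTI; apply: mg => //; exact: measurable_itv.
have mK : measurable [set x | K <= g x].
  by apply: (measurable_set_itv (i := `[K, +oo[) mg) => x; rewrite in_itv/= andbT.
have mS t : measurable [set x | t < g x].
  by apply: (measurable_set_itv (i := `]t, +oo[) mg) => x; rewrite in_itv/= andbT.
have u0 x : K <= g x -> (0 <= u x)%E.
  by move=> Kg; rewrite lee_fin mulr_ge0// adm_ge0// (le_trans _ Kg)// (le_trans _ K2)// ler1n.
have sS k : s_ k.+1 = 2 * s_ k by rewrite /s_ exprS; ring.
have le_s i j : (i <= j)%N -> s_ i <= s_ j.
  by move=> ij; rewrite /s_ ler_wpM2l ?(ltW K0)// ler_weXn2l// ler1n.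
pose G n := g @^-1` `[K, s_ n].
have GK n x : G n x -> K <= g x by rewrite /G/= in_itv/= => /andP[].
have main n : (\int[mu]_(x in G n) u x <= (K * F K * fine (mu [set x | (K <= g x)%R]))%:E +
    (6 * \sum_(k < n) s_ k * F (s_ k) * superlevel g (s_ k))%:E)%E.
  elim: n => [|n IH].
    rewrite big_ord0 mulr0 adde0.
    apply: (@le_trans _ _ (\int[mu]_(x in G 0%N) cst (K * F K)%:E x)%E).
      rewrite le_eqVlt; apply/orP; left; apply/eqP; apply: eq_integral => x; rewrite inE /G/= in_itv/= /s_ expr0 mulr1.
      by move=> h; rewrite /u (_ : g x = K)//; apply/eqP; rewrite eq_le andbC.
    rewrite integral_cst; last exact: mpre.
    rewrite [leRHS]EFinM fineK ?fin_num_measure// lee_wpmul2l ?lee_fin//.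
      by have := Fs0 0; rewrite /s_ expr0 mulr1 => h; rewrite mulr_ge0// ltW.
    by rewrite le_measure ?inE//; [exact: mpre|exact: GK].
  have GS : G n.+1 = G n `|` g @^-1` `]s_ n, s_ n.+1].
    apply/seteqP; split=> x; rewrite /G/= !in_itv/=.
      by move=> /andP[-> gs]; have [h|h] := leP (g x) (s_ n); [left|right; rewrite gs].
    case=> /andP[h1 h2]; apply/andP; split=> //; first by rewrite (le_trans h2)// le_s.
    by rewrite (le_trans (sK n))// ltW.
  have mG' := mpre `]s_ n, s_ n.+1].
  rewrite GS ge0_integral_setU//; last 4 first.
  - exact: mpre.
  - exact: measurable_funTS.
  - move=> x [/GK/u0//|]; rewrite /= in_itv/= => /andP[h _].
    by apply: u0; rewrite (le_trans (sK n))// ltW.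
  - apply/disj_setPS => x [] /=; rewrite !in_itv/= => /andP[_ h1] /andP[h2 _].
    by have := lt_le_trans h2 h1; rewrite ltxx.
  rewrite big_ord_recr/= mulrDr [X in (_ <= _ + X)%E]EFinD [leRHS]addeA; apply: leeD => //.
  apply: (@le_trans _ _ (\int[mu]_(x in g @^-1` `]s_ n, s_ n.+1]) cst (s_ n.+1 * F (s_ n.+1))%:E x)%E).
    apply: ge0_le_integral => //.
    - move=> x; rewrite /= in_itv/= => /andP[h _].
      by apply: u0; rewrite (le_trans (sK n))// ltW.
    - exact: measurable_funTS.
    - move=> x; rewrite /= in_itv/= => /andP[h1 h2].
      have gx0 : 0 < g x := lt_trans (s_gt0 n) h1.
      rewrite lee_fin ler_pM//.
        by apply: adm_ge0 => //; rewrite (le_trans _ (ltW h1))// (le_trans _ (sK n))// (le_trans _ K2)// ler1n.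
      exact: adm_le.
  rewrite integral_cst//.
  have F3 : F (s_ n.+1) <= 3 * F (s_ n) by rewrite sS adm_double// (le_trans K2)// sK.
  apply: (@le_trans _ _ ((6 * (s_ n * F (s_ n)))%:E * mu [set x | (s_ n < g x)%R])%E).
    apply: lee_pmul => //.
    - by rewrite lee_fin mulr_ge0// ltW.
    - rewrite lee_fin sS; have := s_gt0 n => sn0.
      have : s_ n * F (s_ n.+1) <= s_ n * (3 * F (s_ n)) by rewrite ler_wpM2l// ltW.
      rewrite sS; lra.
    - by rewrite le_measure ?inE// => x; rewrite /= in_itv/= => /andP[].
  have -> : mu [set x | (s_ n < g x)%R] = (superlevel g (s_ n))%:E by rewrite fineK// fin_num_measure.
  have -> : 6 * (s_ n * F (s_ n) * superlevel g (s_ n)) = 6 * (s_ n * F (s_ n)) * superlevel g (s_ n) by ring.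
  by rewrite EFinM.
have cvG : (\int[mu]_(x in G n) u x @[n --> \oo] --> \int[mu]_(x in \bigcup_n G n) u x)%E.
  apply: ge0_nondecreasing_set_cvg_integral => //.
  - move=> i j ij; apply/subsetPset => x; rewrite /G/= !in_itv/= => /andP[-> h].
    by rewrite (le_trans h)// le_s.
  - by move=> i; exact: mpre.
  - by move=> i; exact: measurable_funTS.
  - by move=> i x /GK/u0.
have UG : \bigcup_n G n = [set x | K <= g x].
  apply/seteqP; split=> [x [n _ /GK]//|x /= Kg].
  exists (Num.truncn (g x)).+1 => //; rewrite /G/= in_itv/= Kg/=.
  rewrite (le_trans (ltW (truncnS_gt _)))// /s_.
  apply: (@le_trans _ _ (2 ^+ (Num.truncn (g x)).+1)).
    by rewrite -natrX ler_nat ltnW// ltn_expl.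
  by rewrite ler_peMl ?exprn_ge0// (le_trans _ K2)// ler1n.
rewrite -UG -(cvg_lim _ cvG)//; apply: lime_le; first by apply/cvg_ex; eexists; exact: cvG.
apply: nearW => n; rewrite UG; apply: (le_trans (main n)); rewrite leeD2l//.
by rewrite EFinM lee_wpmul2l// lee_fin.
Qed.

Let superlevel_damped_cvg (f : 'rV[R]_d -> R) (m s : R) : smooth f -> 0 < m -> 0 < s ->
  superlevel (fun x => damped f n.+1%:R^-1 x ^+ 2 / m) s @[n --> \oo] -->
  superlevel (fun x => f x ^+ 2 / m) s.
Proof.
move=> sf m0 s0; pose g n x := damped f n.+1%:R^-1 x ^+ 2 / m.
have t0 n : 0 < n.+1%:R^-1 :> R by rewrite invr_gt0.
have mS h (t : R) : smooth h -> measurable [set x | t < h x ^+ 2 / m].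
  move=> sh; have mh : measurable_fun setT (fun x => h x ^+ 2 / m).
    apply: measurable_funM => //; apply: measurable_funX.
    by apply: continuous_measurable_rV; exact: smooth_continuous.
  by apply: (measurable_set_itv (i := `]t, +oo[) mh) => x; rewrite in_itv/= andbT.
have U : \bigcup_n [set x | s < g n x] = [set x | s < f x ^+ 2 / m].
  apply/seteqP; split=> [x [n _ /= h]|x /=].
    by rewrite (lt_le_trans h)// ler_wpM2r ?invr_ge0 ?(ltW m0)// sqr_damped_le.
  rewrite ltr_pdivlMr// => h; have [n hn] := damped_cvg (mulr_gt0 s0 m0) h.
  by exists n => //=; rewrite ltr_pdivlMr.
have mg n : measurable [set x | s < g n x] by apply: mS; exact: smooth_damped.
have cv : mu [set x | s < g n x] @[n --> \oo] --> mu (\bigcup_n [set x | s < g n x]).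
  apply: nondecreasing_cvg_mu => //; first exact: bigcupT_measurable.
  move=> i j ij; apply/subsetPset => x /= h; rewrite (lt_le_trans h)//.
  rewrite ler_wpM2r ?invr_ge0 ?(ltW m0)// le_sqr_damped ?(ltW (t0 _))//.
  by rewrite lef_pV2 ?posrE// ler_nat.
apply: fine_cvg; rewrite U in cv.
by rewrite fineK ?fin_num_measure//; exact: mS.
Qed.

(** The number n of layers stays fixed while the cutoff parameter 1/(j+1) tends to 0, so only
    finitely many superlevel masses must converge; the cost bound is uniform up to a term
    1/(j+1). *)
Lemma dyadic_bound : exists2 C : R, 0 < C & forall (f : 'rV[R]_d -> R) (m : R),
  smooth f -> 0 < m -> (\int[mu]_x (f x ^+ 2)%:E = m%:E)%E -> forall n,
  ((\sum_(k < n) s_ k * F (s_ k) * superlevel (fun x => f x ^+ 2 / m)%R (s_ k))%:E <=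
   (2 * (K * F K * fine (mu [set x | (K * m <= f x ^+ 2)%R])))%:E + C%:E * weight_cost f m)%E.
Proof.
have [C1 C10 sumP] := dyadic_sum; have [C2 C20 costP] := super_cost_damped.
exists (C1 * C2); first exact: mulr_gt0.
move=> f m sf m0 fm n.
have J0 : (0 <= weight_cost f m)%E.
  by apply: integral_ge0 => x _; rewrite lee_fin mulr_ge0 ?conj_cost_ge0// divr_ge0 ?sqr_ge0// ltW.
case: (weight_cost f m) J0 (fun t t0 tA => costP f m t sf m0 t0 tA fm) => [J|_ _|//]; last first.
  by rewrite gt0_muley ?lte_fin ?mulr_gt0// addey// leey.
rewrite lee_fin => J0 {}costP; rewrite -EFinM -EFinD lee_fin.
have t0 j : 0 < j.+1%:R^-1 :> R by rewrite invr_gt0.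
pose g j x := damped f j.+1%:R^-1 x ^+ 2 / m.
set P := fine _.
have FK0 : 0 <= K * F K by have := Fs0 0; rewrite /s_ expr0 mulr1 => h; rewrite mulr_ge0// ltW.
have cu : (\sum_(k < n) s_ k * F (s_ k) * superlevel (g j) (s_ k)) @[j --> \oo] -->
    \sum_(k < n) s_ k * F (s_ k) * superlevel (fun x => f x ^+ 2 / m) (s_ k).
  elim: n => [|n IH].
    by rewrite big_ord0; under eq_fun do rewrite big_ord0; exact: cvg_cst.
  rewrite big_ord_recr/=; under eq_fun do rewrite big_ord_recr/=.
  apply: cvgD => //; apply: cvgMr; exact: superlevel_damped_cvg.
have cv : (2 * (K * F K * P) + C1 * C2 * (J + j.+1%:R^-1)) @[j --> \oo] -->
    2 * (K * F K * P) + C1 * C2 * (J + 0).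
  apply: cvgD; first exact: cvg_cst.
  apply: cvgMr; apply: cvgD; first exact: cvg_cst.
  exact: cvg_harmonic.
rewrite addr0 in cv; apply: (ler_cvg_to cu cv).
have A20 : 0 < A ^+ 2 by rewrite exprn_gt0.
near=> j.
have tA : Num.sqrt (j.+1%:R^-1) <= A.
  rewrite -(ger0_norm (ltW A0)) -sqrtr_sqr ler_sqrt ?exprn_ge0 ?(ltW A0)//.
  by apply: ltW; near: j; exact: (near_infty_natSinv_lt (PosNum A20)).
have mS' : measurable [set x | K * m <= f x ^+ 2].
  apply: closed_measurable_rV; apply: closed_ge => x.
  have cf := smooth_continuous sf; exact: continuousM (cf x) (cf x).
have [N NP] := damped_bounded f (t0 j) (mulr_gt0 K0 m0).
have sg : smooth (g j).
  apply: smooth_expr_smooth.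
  rewrite (_ : g j = damped f j.+1%:R^-1 * damped f j.+1%:R^-1 * cst m^-1); last first.
    by apply/funext => x; rewrite /g expr2.
  apply: SE_mul; last exact: SE_cst.
  by apply: SE_mul; apply: SE_smooth; exact: smooth_damped.
have gpos x : 0 <= g j x by rewrite divr_ge0 ?sqr_ge0// ltW.
have g1 : (\int[mu]_x (g j x)%:E <= 1)%E.
  apply: (@le_trans _ _ (\int[mu]_x (m^-1%:E * (f x ^+ 2)%:E))%E).
    have mf2 : measurable_fun setT (fun x => f x ^+ 2).
      by apply: measurable_funX; apply: continuous_measurable_rV; exact: smooth_continuous.
    apply: ge0_le_integral => //.
    - by move=> x _; rewrite lee_fin.
    - by apply/measurable_EFinP; apply: continuous_measurable_rV; exact: smooth_continuous.
    - by apply: measurable_funeM; exact/measurable_EFinP.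
    - by move=> x _; rewrite -EFinM lee_fin /g [leLHS]mulrC ler_wpM2l ?invr_ge0 ?(ltW m0)// sqr_damped_le.
  rewrite ge0_integralZl//.
  - by rewrite fm -EFinM mulVf// gt_eqF.
  - apply/measurable_EFinP; apply: measurable_funX.
    by apply: continuous_measurable_rV; exact: smooth_continuous.
  - by move=> x _; rewrite lee_fin sqr_ge0.
  - by rewrite lee_fin invr_ge0 ltW.
have gN x : K <= g j x -> enorm x <= N by rewrite ler_pdivlMr//; exact: NP.
have h1 := sumP (g j) N sg gpos g1 gN n.
have h2 := costP _ (t0 j) tA; rewrite -/(g j) in h2.
have h3 : superlevel (g j) K <= P.
  apply: fine_le; rewrite ?fin_num_measure//.
    by apply: measurable_gt_rV; exact: smooth_continuous.
  apply: le_measure; rewrite ?inE//; first by apply: measurable_gt_rV; exact: smooth_continuous.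
  move=> x /=; rewrite ltr_pdivlMr// => /ltW h; rewrite (le_trans h)//.
  exact: sqr_damped_le.
have h4 : \sum_(k < n) s_ k * F (s_ k) * superlevel (g j) (s_ k) <=
    \sum_(k < n.+1) s_ k * F (s_ k) * superlevel (g j) (s_ k).
  by rewrite big_ord_recr/= lerDl !mulr_ge0// ltW.
rewrite (le_trans h4)// -lee_fin; apply: (le_trans h1).
rewrite EFinD; apply: leeD.
  by rewrite lee_fin ler_pM2l// ler_wpM2l.
rewrite [leRHS]EFinM [X in (_ <= X * _)%E]EFinM -muleA lee_wpmul2l ?lee_fin ?(ltW C10)//.
Unshelve. all: by end_near. Qed.

End dyadic.

(** * Variance and conclusion *)

Lemma integrable_sqr_integrable d (T : measurableType d) (R : realType) (mu : probability T R)
    (f : T -> R) : measurable_fun setT f ->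
  mu.-integrable setT (fun x => (f x ^+ 2)%:E) -> mu.-integrable setT (fun x => (f x)%:E).
Proof.
move=> mf if2.
have ig := integrableD measurableT (finite_measure_integrable_cst mu 1 measurableT) if2.
apply: (le_integrable measurableT _ _ ig).
  exact/measurable_EFinP.
move=> x _ /=; rewrite lee_fin [leRHS]ger0_norm ?addr_ge0 ?sqr_ge0//.
have := sqr_ge0 (`|f x| - 1); rewrite sqrrB real_normK ?num_real//.
by have := normr_ge0 (f x); lra.
Qed.

Section root_defect.
Context {R : realType} {d : nat} (mu : probability 'rV[R]_d R).
Variables (f : 'rV[R]_d -> R) (m : R).
Hypotheses (mf : measurable_fun setT f) (m0 : 0 < m).
Hypothesis fm : (\int[mu]_x (f x ^+ 2)%:E = m%:E)%E.

Let sig := Num.sqrt m.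
Let sig2 : sig ^+ 2 = m. Proof. by rewrite sqr_sqrtr// ltW. Qed.

Lemma integrable_sqr_f : mu.-integrable setT (fun x => (f x ^+ 2)%:E).
Proof.
apply/integrableP; split; first by apply/measurable_EFinP; exact: measurable_funX.
under eq_integral do rewrite gee0_abs ?lee_fin ?sqr_ge0//.
by rewrite fm ltry.
Qed.

Let if1 := integrable_sqr_integrable mf integrable_sqr_f.
Let ifn : mu.-integrable setT (fun x => `|f x|%:E).
Proof. exact: integrable_abse if1. Qed.

Let defectE x : (`|f x| - sig) ^+ 2 = (f x ^+ 2 - (2 * sig) * `|f x|) + m.
Proof. by rewrite sqrrB sig2 real_normK ?num_real//; ring. Qed.

Let i2 : mu.-integrable setT (EFin \o (fun x => 2 * sig * `|f x|)).
Proof. exact: (integrableZl measurableT (2 * sig) ifn). Qed.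

Let i3 : mu.-integrable setT (EFin \o (fun x => f x ^+ 2 - 2 * sig * `|f x|)).
Proof. exact: (integrableB measurableT integrable_sqr_f i2). Qed.

Let i4 : mu.-integrable setT (EFin \o (fun _ : 'rV[R]_d => m)).
Proof. exact: (finite_measure_integrable_cst mu m measurableT). Qed.

Lemma integrable_defect : mu.-integrable setT (fun x => ((`|f x| - sig) ^+ 2)%:E).
Proof.
have := integrableD measurableT i3 i4; apply: eq_integrable => // x _ /=.
by rewrite defectE EFinD.
Qed.

(** With b1, b2 the means of f and |f|, Q = 2 m - 2 sig b2 and v = m - b1^2. The claim is b1^2 <=
    sig b2, which holds since |b1| <= b2 <= sig, the last inequality being Q >= 0. *)
Lemma Var_defect : exists v Q : R, [/\ Var mu f = v%:E,
  (\int[mu]_x ((`|f x| - sig) ^+ 2)%:E = Q%:E)%E, 0 <= Q & Q <= 2 * v].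
Proof.
have E1 : (\int[mu]_x (f x)%:E = (\int[mu]_x f x)%R%:E)%E.
  by rewrite /Rintegral fineK//; exact: integrable_fin_num.
have E2 : (\int[mu]_x f x ^+ 2)%R = m by rewrite /Rintegral fm.
pose b1 := (\int[mu]_x f x)%R; pose b2 := (\int[mu]_x `|f x|)%R.
have b12 : `|b1| <= b2 by exact: le_normr_Rintegral.
have QE : (\int[mu]_x (`|f x| - sig) ^+ 2)%R = 2 * m - 2 * sig * b2.
  under eq_Rintegral do rewrite defectE.
  rewrite RintegralD// RintegralB//; last exact: integrable_sqr_f.
  have Em : (\int[mu]_(x in setT) m)%R = m.
    transitivity (m * fine (mu setT)); first exact: Rintegral_cst.
    by rewrite probability_setT/= mulr1.
  rewrite RintegralZl// E2 Em -/b2; ring.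
have Q0 : 0 <= (\int[mu]_x (`|f x| - sig) ^+ 2)%R.
  by apply: Rintegral_ge0 => // x _; exact: sqr_ge0.
exists (m - b1 ^+ 2), (2 * m - 2 * sig * b2); split.
- by rewrite /Var fm E1 -/b1 EFinB EFin_expe.
- by rewrite -QE /Rintegral fineK// integrable_fin_num//; exact: integrable_defect.
- by rewrite -QE.
rewrite QE in Q0.
have sig0 : 0 < sig by rewrite sqrtr_gt0.
have b2s : b2 <= sig.
  have : 2 * sig * (sig - b2) = 2 * m - 2 * sig * b2 by rewrite -sig2; ring.
  by move=> h; rewrite -h pmulr_rge0 ?mulr_gt0// subr_ge0 in Q0.
have : b1 ^+ 2 <= sig * b2.
  rewrite -[leLHS]real_normK ?num_real// expr2; apply: ler_pM => //.
  exact: le_trans b2s.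
lra.
Qed.

End root_defect.

Theorem theorem3p6 (R : realType) (d : nat) (hd : (0 < d)%N)
  (mu : probability 'rV[R]_d R)
  (mu_ac : mu `<< lebesgue_outer)
  (X_convex : convex_set (supp mu)) (X0 : supp mu 0)
  (alpha beta tau A : R) (F : R -> R)
  (alpha_gt1 : 1 < alpha) (betaE : beta = alpha / (alpha - 1))
  (tau_le1 : tau <= 1) (tau_ge : 2 / beta <= tau) (A_gt0 : 0 < A)
  (c : \bar R -> \bar R)
  (cE : c = cost_conj A (alpha * tau / (alpha - 1)))
  (F_adm : admissible F)
  (K : R) (K_ge2 : 2 <= K)
  (rho : R) (rho_gt0 : 0 < rho) (rhoE : mu (eball rho) = ((K - 1) / K)%:E)
  (HPhi : mu.-integrable (~` eball rho)
    (fun x => Phi F (4%:E * c (isop mu F (enorm x)))%E))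
  (HPhi2 : exists2 delta : R, 0 < delta &
    mu.-integrable (~` eball rho)
      (fun x => Phi_pos (psi tau beta \o F)
        (delta%:E * isop mu (psi tau beta \o F) (enorm x) ^+ 2)%E))
  (Poincare : exists2 lambda2 : R, 0 < lambda2 &
    forall f : 'rV[R]_d -> R, smooth f ->
      (\int[mu]_x ((f x - median mu f) ^+ 2)%:E <=
        lambda2%:E * \int[mu]_x (enorm (grad f x) ^+ 2)%:E)%E) :
  exists B C : R, [/\ 0 < B, 0 < C &
    forall f : 'rV[R]_d -> R, smooth f ->
      (0 < \int[mu]_x (f x ^+ 2)%:E < +oo)%E ->
      let m := (\int[mu]_x (f x ^+ 2))%R in
      (\int[mu]_x (f x ^+ 2 * F (f x ^+ 2 / m))%:E <=
        C%:E * \int[mu]_(x in [set x | (K * m <= f x ^+ 2)%R])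
                 ((f x ^+ 2)%:E * conjugate c (enorm (grad f x) / `|f x|)%:E)
        + B%:E * Var mu f)%E].
Proof.
have [lambda lambda0 {}Poincare] := Poincare.
set q := alpha * tau / (alpha - 1) in cE.
have a1 : 0 < alpha - 1 by rewrite subr_gt0.
have beta0 : 0 < beta by rewrite betaE divr_gt0// (lt_trans ltr01).
(* q = beta tau, so this is the hypothesis tau >= 2 / beta. *)
have q2 : 2 <= q.
  by rewrite /q mulrAC -betaE mulrC -ler_pdivrMr.
rewrite {c}cE in HPhi *.
have K0 : 0 < K by rewrite (lt_le_trans _ K_ge2).
have [C0 C00 sumP] := dyadic_bound hd mu_ac F_adm A_gt0 q2 K_ge2 rho_gt0 rhoE lambda0 Poincare HPhi.
have [p p0 Fp] := adm_supergradient F_adm.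
have [b b0 Fb] := adm_lower F_adm.
pose k := Num.sqrt K.
have k2 : k ^+ 2 = K by rewrite sqr_sqrtr// ltW.
have k0 : 0 <= k by exact: sqrtr_ge0.
have k1 : 0 < k - 1.
  by rewrite subr_gt0 -(ltr_pXn2r (_ : 0 < 2)%N) ?nnegrE// k2 expr1n (lt_le_trans _ K_ge2)// ltr1n.
have FK0 : 0 <= F K by apply: adm_ge0 => //; rewrite (le_trans _ K_ge2)// ler1n.
have KFK0 : 0 <= K * F K by rewrite mulr_ge0// ltW.
(* Both carry the factor 2 of [Var_defect]. In B2, 26 is twice 13 = 1 + 12: one K F(K) from the
   level y = K in [tail_integral], and 6 times the 2 of [dyadic_bound]. *)
pose B1 := 2 * p * (k + 1) ^+ 2; pose B2 := 26 * (K * F K) / (k - 1) ^+ 2.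
have B10 : 0 <= B1 by rewrite mulr_ge0 ?sqr_ge0// mulr_ge0.
have B20 : 0 <= B2 by rewrite divr_ge0 ?sqr_ge0// mulr_ge0.
exists (B1 + B2 + 1), (6 * C0); split; [by rewrite ltr_wpDl// addr_ge0|by rewrite mulr_gt0|].
move=> f sf /andP[f0 foo] /=; set m := (\int[mu]_x (f x ^+ 2))%R.
have fm : (\int[mu]_x (f x ^+ 2)%:E = m%:E)%E.
  by rewrite /m /Rintegral fineK// ge0_fin_numE// ltW.
have m0 : 0 < m by rewrite -lte_fin -fm.
have cf := smooth_continuous sf.
have mf : measurable_fun setT f by exact: continuous_measurable_rV.
have [v [Q [-> QE Q0 Qv]]] := Var_defect mf m0 fm.
have v0 : 0 <= v by move: (le_trans Q0 Qv); rewrite pmulr_rge0.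
set S := [set x | K * m <= f x ^+ 2].
have mS : measurable S.
  apply: closed_measurable_rV; apply: closed_ge => x; exact: continuousM (cf x) (cf x).
have mf2 : measurable_fun setT (fun x => f x ^+ 2) by exact: measurable_funX.
pose y x := f x ^+ 2 / m.
have y0 x : 0 <= y x by rewrite divr_ge0 ?sqr_ge0// ltW.
have my : measurable_fun setT y by exact: measurable_funM.
have SE : S = [set x | K <= y x] by apply/seteqP; split=> x /=; rewrite ler_pdivlMr.
set W := (X in (_ <= (6 * C0)%:E * X + _)%E).
have WE : (W = m%:E * weight_cost mu A q K f m)%E.
  rewrite /weight_cost -ge0_integralZl//; last 3 first.
  - apply: measurable_funTS; apply/measurable_EFinP; apply: measurable_funM => //.
    apply: (measurableT_comp (f := conj_cost A q : measurableTypeR R -> R)).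
      by apply: nondecreasing_measurable => //; exact: le_conj_cost.
    apply: measurable_funM; first exact: measurable_grad.
    by apply: measurable_fun_inv => //; exact: measurableT_comp.
  - by move=> x _; rewrite lee_fin mulr_ge0 ?conj_cost_ge0// y0.
  - by rewrite lee_fin ltW.
  apply: eq_integral => x _; rewrite conj_costE// -!EFinM; congr (_%:E).
  by rewrite mulrA mulrCA mulfV ?mulr1// gt_eqF.
have J0 : (0 <= weight_cost mu A q K f m)%E.
  by apply: integral_ge0 => x _; rewrite lee_fin mulr_ge0 ?conj_cost_ge0// y0.
have {}sumP := sumP f m sf m0 fm.
have := tail_integral F_adm K_ge2 my y0 sumP.
rewrite WE -SE; set P := fine (mu S).
case: (weight_cost mu A q K f m) J0 => [J||//]; last first.
  move=> _ _; rewrite [(m%:E * +oo)%E]gt0_muley ?lte_fin// gt0_muley ?lte_fin ?mulr_gt0//.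
  by rewrite addye// leey.
rewrite lee_fin => J0; rewrite -!EFinM -!EFinD => tailP.
pose u x := f x ^+ 2 * F (y x).
have uE x : u x = m * (y x * F (y x)) by rewrite /u mulrA [m * y x]mulrC divfK// gt_eqF.
have mu' : measurable_fun setT u.
  rewrite (_ : u = (fun x => m * (y x * F (y x)))); last exact/funext.
  by apply: measurable_funM => //; exact: measurable_adm_fun.
have uS0 x : S x -> 0 <= u x.
  rewrite SE/= => Ky; rewrite mulr_ge0 ?sqr_ge0// adm_ge0//.
  by rewrite (le_trans _ Ky)// (le_trans _ K_ge2)// ler1n.
have tail_u : (\int[mu]_(x in S) (u x)%:E <= (13 * (K * F K) * (m * P) + 6 * C0 * (m * J))%:E)%E.
  have -> : (\int[mu]_(x in S) (u x)%:E = m%:E * \int[mu]_(x in S) (y x * F (y x))%:E)%E.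
    rewrite -ge0_integralZl//.
    - by apply: eq_integral => x _; rewrite uE EFinM.
    - by apply: measurable_funTS; apply/measurable_EFinP; exact: measurable_adm_fun.
    - by move=> x /uS0; rewrite uE pmulr_rge0.
    - by rewrite lee_fin ltW.
  have m0' : (0 <= m%:E)%E by rewrite lee_fin ltW.
  apply: (le_trans (lee_wpmul2l m0' tailP)); rewrite -EFinM lee_fin.
  by rewrite le_eqVlt; apply/orP; left; apply/eqP; ring.
(* On S, |f| exceeds sqrt m by at least (k - 1) sqrt m, so the variance controls the mass P of S. *)
have defect_S x : S x -> m * (k - 1) ^+ 2 <= (`|f x| - Num.sqrt m) ^+ 2.
  rewrite /S/= => Kf; set sig := Num.sqrt m.
  have sig2 : sig ^+ 2 = m by rewrite sqr_sqrtr// ltW.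
  have sig0 : 0 <= sig by exact: sqrtr_ge0.
  have kf : k * sig <= `|f x|.
    by rewrite -(ler_pXn2r (_ : 0 < 2)%N) ?nnegrE ?mulr_ge0// exprMn k2 sig2 real_normK ?num_real.
  have kf' : sig * (k - 1) <= `|f x| - sig by rewrite mulrBr mulr1 lerD2r mulrC.
  have ks : 0 <= sig * (k - 1) by rewrite mulr_ge0// ltW.
  by rewrite -sig2 -exprMn lerXn2r ?nnegrE// (le_trans ks).
have PQ : m * P * (k - 1) ^+ 2 <= Q.
  rewrite -lee_fin -QE mulrAC EFinM /P fineK ?fin_num_measure// -integral_cst//.
  have idef := integrable_defect mf m0 fm.
  have [mdef _] := integrableP _ _ _ idef.
  apply: (@le_trans _ _ (\int[mu]_(x in S) ((`|f x| - Num.sqrt m) ^+ 2)%:E)%E).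
    apply: ge0_le_integral => //.
    - by move=> x _; rewrite lee_fin mulr_ge0 ?sqr_ge0// ltW.
    - exact: measurable_funTS.
  by apply: ge0_subset_integral => // x _; rewrite lee_fin sqr_ge0.
have mP0 : 0 <= P by rewrite fine_ge0.
have mPQ : 13 * (K * F K) * (m * P) <= B2 * v.
  have h : m * P <= 2 * v / (k - 1) ^+ 2 by rewrite ler_pdivlMr ?exprn_gt0// (le_trans PQ).
  have -> : B2 * v = 13 * (K * F K) * (2 * v / (k - 1) ^+ 2) by rewrite /B2; ring.
  by rewrite ler_wpM2l// mulr_ge0.
have uS_fin : (\int[mu]_(x in S) (u x)%:E)%E \is a fin_num.
  rewrite ge0_fin_numE; first exact: le_lt_trans tail_u (ltry _).
  by apply: integral_ge0 => x /uS0; rewrite lee_fin.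
pose US := fine (\int[mu]_(x in S) (u x)%:E)%E.
have USE : (\int[mu]_(x in S) (u x)%:E = US%:E)%E by rewrite /US fineK.
have iuS : mu.-integrable S (EFin \o u).
  apply/integrableP; split; first by apply: measurable_funTS; exact/measurable_EFinP.
  rewrite (_ : (\int[mu]_(x in S) `|(EFin \o u) x|)%E = US%:E) ?ltry// -USE.
  by apply: eq_integral => x; rewrite inE => /uS0 h; rewrite /= ger0_norm.
(* The majorant of u off S comes from f^2 (y - 1) = m (y - 1)^2 + (f^2 - m), where m (y - 1)^2 =
   (|f| - sig)^2 (|f| + sig)^2 / m and |f| + sig <= (k + 1) sig. The part [w2] has integral 0, and
   on S both [w1] and [w2] are nonnegative. *)
pose w1 x := p * (k + 1) ^+ 2 * (`|f x| - Num.sqrt m) ^+ 2.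
pose w2 x := p * (f x ^+ 2 - m).
pose w3 := (EFin \o u) \_ S.
have iw1 : mu.-integrable setT (EFin \o w1).
  exact: (integrableZl measurableT (p * (k + 1) ^+ 2) (integrable_defect mf m0 fm)).
have icst r : mu.-integrable setT (EFin \o (fun _ : 'rV[R]_d => r : R)).
  exact: (finite_measure_integrable_cst mu r measurableT).
have if2 := integrable_sqr_f mf fm.
have iw2' : mu.-integrable setT (EFin \o (fun x => f x ^+ 2 - m)).
  exact: (integrableB measurableT if2 (icst m)).
have iw2 : mu.-integrable setT (EFin \o w2) by exact: (integrableZl measurableT p iw2').
have iw3 : mu.-integrable setT w3 by apply/(integrable_mkcond _ mS).
have iw12 := integrableD measurableT iw1 iw2.
have iw := integrableD measurableT iw12 iw3.
have u_le x : ((u x)%:E <= (w1 x)%:E + (w2 x)%:E + w3 x)%E.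
  rewrite /w3 /= patchE; case: ifPn => [xS|xS].
    rewrite /= -!EFinD lee_fin lerDr addr_ge0//.
      by rewrite mulr_ge0 ?sqr_ge0// mulr_ge0 ?sqr_ge0.
    rewrite mulr_ge0// subr_ge0; move: xS; rewrite inE /S/=; apply: le_trans.
    by rewrite ler_peMl ?(ltW m0)// (le_trans _ K_ge2)// ler1n.
  rewrite adde0 -EFinD lee_fin.
  have xK : f x ^+ 2 < K * m by move: xS; rewrite notin_setE /S/= => /negP; rewrite -ltNge.
  pose sig := Num.sqrt m; have sig2 : sig ^+ 2 = m by rewrite sqr_sqrtr// ltW.
  have sig0 : 0 <= sig by exact: sqrtr_ge0.
  have kf : `|f x| <= k * sig.
    by rewrite -(ler_pXn2r (_ : 0 < 2)%N) ?nnegrE ?mulr_ge0// exprMn k2 sig2 real_normK ?num_real// ltW.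
  have f2 : f x ^+ 2 = `|f x| ^+ 2 by rewrite real_normK ?num_real.
  have hs : (`|f x| + sig) ^+ 2 <= (k + 1) ^+ 2 * m.
    rewrite -sig2 -exprMn lerXn2r ?nnegrE ?addr_ge0 ?mulr_ge0 ?addr_ge0//.
    by rewrite mulrDl mul1r lerD2r.
  have w12 : p * (f x ^+ 2 * (y x - 1)) <= w1 x + w2 x.
    have -> : w1 x + w2 x = p * ((k + 1) ^+ 2 * (`|f x| - sig) ^+ 2 + (f x ^+ 2 - m)).
      by rewrite /w1 /w2 -/sig; ring.
    rewrite ler_wpM2l// -lerBlDr.
    have -> : f x ^+ 2 * (y x - 1) - (f x ^+ 2 - m) = (`|f x| - sig) ^+ 2 * ((`|f x| + sig) ^+ 2 / m).
      rewrite mulrA -exprMn mulrC -subr_sqr /y -f2 sig2; field.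
      by rewrite gt_eqF.
    by rewrite mulrC ler_wpM2r ?sqr_ge0// ler_pdivrMr.
  apply: le_trans w12; have [fx0|fx0] := eqVneq (f x) 0.
    by rewrite /u fx0 expr0n/= !mul0r mulr0.
  have fx2 : 0 < f x ^+ 2 by rewrite exprn_even_gt0.
  by rewrite /u mulrCA ler_pM2l// Fp// divr_gt0.
have u_ge x : - (b * m) <= u x.
  rewrite uE (_ : - (b * m) = m * - b) ?ler_pM2l//; last by ring.
  have [->|y1] := eqVneq (y x) 0; first by rewrite mul0r oppr_le0.
  by rewrite Fb// lt_neqAle eq_sym y1 y0.
(* With w = w1 + w2 + w3, the bounds - b m <= u <= w give |u| <= w + 2 b m. *)
have iu : mu.-integrable setT (EFin \o u).
  apply: (le_integrable measurableT _ _ (integrableD measurableT iw (icst (2 * (b * m))))).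
    exact/measurable_EFinP.
  move=> x _; have := u_le x; have := u_ge x => h1.
  have bm0 : 0 <= b * m by rewrite mulr_ge0// ltW.
  move=> h2; apply: (@le_trans _ _ ((w1 x)%:E + (w2 x)%:E + w3 x + (2 * (b * m))%:E)%E); last exact: lee_abs.
  apply: le_trans (leeD2r _ h2); rewrite /= -EFinD lee_fin ler_norml; apply/andP; split; clear -h1 bm0; lra.
have h := le_integral measurableT iu iw (fun x _ => u_le x).
apply: (le_trans h); rewrite integralD// integralD//.
rewrite (_ : (\int[mu]_x (EFin \o w1) x)%E = (p * (k + 1) ^+ 2 * Q)%:E); last first.
  by rewrite /w1 /= (integralZl measurableT (integrable_defect mf m0 fm)) QE.
rewrite (_ : (\int[mu]_x (EFin \o w2) x)%E = 0%E); last first.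
  rewrite /w2 /= (integralZl measurableT iw2') (integralB measurableT if2 (icst m)) fm.
  have -> : (\int[mu]_x (EFin \o (fun _ : 'rV[R]_d => m)) x = m%:E)%E.
    transitivity (m%:E * mu setT)%E; first exact: integral_cst.
    by rewrite probability_setT mule1.
  by rewrite subee ?mule0.
rewrite -integral_mkcond USE adde0 -EFinD lee_fin.
have : US <= 13 * (K * F K) * (m * P) + 6 * C0 * (m * J) by rewrite -lee_fin -USE.
have : p * (k + 1) ^+ 2 * Q <= p * (k + 1) ^+ 2 * (2 * v) by rewrite ler_wpM2l// mulr_ge0 ?sqr_ge0.
have : (B1 + B2 + 1) * v = p * (k + 1) ^+ 2 * (2 * v) + B2 * v + v by rewrite /B1; ring.
move=> e1 e2 e3; clear -e1 e2 e3 mPQ v0; lra.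
Qed.
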